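(* Let $A\subset\mathbb R^n$ coincide with its reduced kernel. If $\alpha=2$, assume moreover that $c_\alpha(A^i)=0$ and that $D:=\mathbb R^n\setminus\overline A$ is a (connected open) domain. If $A$ is inner $\alpha$-thin at infinity, then $\kappa_\alpha\gamma_A<1$ on $\mathbb R^n\setminus\overline A$, and the support of $\gamma_A$ is $$S(\gamma_A)=\begin{cases}\overline A&\text{if }\alpha<2,\\ \partial D&\text{if }\alpha=2.\end{cases}$$
   Context: Standing assumptions: $n\ge3$, $\alpha\in(0,2]$, and $\kappa_\alpha(x,y)=|x-y|^{\alpha-n}$ is the Riesz kernel on $\mathbb R^n$. $\mathfrak M^+$ denotes the cone of positive Radon measures $\mu$ on $\mathbb R^n$ whose potential $\kappa_\alpha\mu(x)=\int|x-z|^{\alpha-n}d\mu(z)$ is not identically $+\infty$. The energy of $\mu$ is $\|\mu\|_\alpha^2=\iint\kappa_\alpha\,d\mu\,d\mu$; $\mathcal E^+_\alpha(A)$ is the set of positive measures of finite energy concentrated on $A$. The inner capacity of $A\subset\mathbb R^n$ is defined by $1/c_\alpha(A)=\inf\{\|\mu\|_\alpha^2:\ \mu\in\mathcal E^+_\alpha(A),\ \mu(\mathbb R^n)=1\}$. ''n.e. on $A$'' means: for all points of $A$ except a subset of inner capacity zero. The reduced kernel of $A$ is the set of $x\in A$ such that $c_\alpha(A\cap B(x,r))>0$ for every $r>0$ ($B(x,r)$ the open ball). Inner balayage: for $\mu\in\mathfrak M^+$ and arbitrary $A$, $\mu^A$ is the unique measure in $\mathfrak M^+$ with $\kappa_\alpha\mu^A=\inf\{\kappa_\alpha\nu:\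 \nu\in\mathfrak M^+,\ \kappa_\alpha\nu\ge\kappa_\alpha\mu \text{ n.e. on }A\}$ pointwise. $\varepsilon_y$ is the Dirac measure at $y$, $\varepsilon_y^A:=(\varepsilon_y)^A$, $A^r:=\{y:\ \varepsilon_y^A=\varepsilon_y\}$, $A^i:=\overline A\setminus A^r$. Inner equilibrium measure: $\gamma_A$, if it exists, is the unique measure in $\mathfrak M^+$ with $\kappa_\alpha\gamma_A=\inf\{\kappa_\alpha\nu:\ \nu\in\mathfrak M^+,\ \kappa_\alpha\nu\ge1\text{ n.e. on }A\}$ pointwise. $A$ is called inner $\alpha$-thin at infinity if $\gamma_A$ exists. $S(\mu)$ denotes the (closed) support of a measure $\mu$. *)

(* Defs.v *)
From HB Require Import structures.
From mathcomp Require Import all_boot all_order all_algebra.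
From mathcomp Require Import all_classical all_reals all_analysis.
Set Implicit Arguments. Unset Strict Implicit. Unset Printing Implicit Defensive.
Import Order.TTheory GRing.Theory Num.Theory.
Import numFieldNormedType.Exports.
Local Open Scope classical_set_scope.
Local Open Scope ring_scope.

Section Riesz.
Variables (R : realType) (n : nat) (alpha : R).

Definition pt := 'rV[R]_n.

Definition Rn := g_sigma_algebraType (@open pt).

Definition edist (x y : pt) : R :=
  Num.sqrt (\sum_(i < n) (x ord0 i - y ord0 i) ^+ 2).

Definition kappa (x y : pt) : \bar R :=
  if x == y then +oo%E else ((edist x y) `^ (alpha - n%:R))%:E.

Definition RMeasure := {measure set Rn -> \bar R}.

Definition pot (mu : RMeasure) (x : pt) : \bar R :=
  (\int[mu]_(z in [set: Rn]) kappa x z)%E.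

Definition energy (mu : RMeasure) : \bar R :=
  (\int[mu]_(x in [set: Rn]) \int[mu]_(z in [set: Rn]) kappa x z)%E.

Definition radon (mu : RMeasure) : Prop :=
  forall K : set pt, compact K -> (mu K < +oo)%E.

Definition Mplus (mu : RMeasure) : Prop :=
  radon mu /\ exists x, (pot mu x < +oo)%E.

Definition concentrated (mu : RMeasure) (A : set pt) : Prop :=
  mu.-negligible (~` A : set Rn).

Definition Eplus (A : set pt) (mu : RMeasure) : Prop :=
  Mplus mu /\ (energy mu < +oo)%E /\ concentrated mu A.

Definition cap (A : set pt) : \bar R :=
  let i := ereal_inf [set energy mu | mu in
             [set mu : RMeasure | Eplus A mu /\ mu [set: Rn] = 1%E]] in
  if i == +oo%E then 0%E
  else if i == 0%E then +oo%E
  else ((fine i)^-1)%:E.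

Definition nearly_on (A : set pt) (P : pt -> Prop) : Prop :=
  cap [set x | A x /\ ~ P x] = 0%E.

Definition reduced_kernel (A : set pt) : set pt :=
  [set x | A x /\ forall r : R, (0 < r)%R ->
     (0 < cap (A `&` [set y | (edist x y < r)%R]))%E].

Definition is_balayage (mu : RMeasure) (A : set pt) (nu : RMeasure) : Prop :=
  Mplus nu /\
  forall x, pot nu x =
    ereal_inf [set pot la x | la in
      [set la : RMeasure | Mplus la /\ nearly_on A (fun y => (pot mu y <= pot la y)%E)]].

Definition is_equilibrium (A : set pt) (ga : RMeasure) : Prop :=
  Mplus ga /\
  forall x, pot ga x =
    ereal_inf [set pot la x | la in
      [set la : RMeasure | Mplus la /\ nearly_on A (fun y => (1 <= pot la y)%E)]].

Definition thin_at_infinity (A : set pt) : Prop := exists ga, is_equilibrium A ga.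

Definition dirac_pt (y : pt) : RMeasure := @dirac _ Rn y R.

Definition regular_pts (A : set pt) : set pt :=
  [set y | is_balayage (dirac_pt y) A (dirac_pt y)].

Definition irregular_pts (A : set pt) : set pt :=
  closure A `\` regular_pts A.

Definition msupport (mu : RMeasure) : set pt :=
  [set x | forall U : set pt, open U -> U x -> (0 < mu U)%E].

Definition boundary (D : set pt) : set pt := closure D `\` interior D.

End Riesz.

(* Main.v *)
Require Import Defs.
From HB Require Import structures.
From mathcomp Require Import all_boot all_order all_algebra.
From mathcomp Require Import all_classical all_reals all_analysis.
From mathcomp Require Import measurable_realfun ring lra.
Import Order.TTheory GRing.Theory Num.Theory.
Import numFieldNormedType.Exports.
Set Implicit Arguments.
Unset Strict Implicit.
Unset Printing Implicit Defensive.
Local Open Scope classical_set_scope.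
Local Open Scope ring_scope.

Local Notation edist := Defs.edist.
Local Notation eball x r := ([set y : Rn _ _ | (edist x y < r)%R]).
Local Notation ecball x r := ([set y : Rn _ _ | (edist x y <= r)%R]).

(** Let [U] be the potential of the equilibrium measure [ga].  First, [ga] is
    admissible for the infimum defining it: [U >= 1] nearly everywhere on [A], as a
    measure of bounded potential carried by the set where [U < 1] can be shrunk
    to nothing.  Perturbing [ga] by moving mass shows that it is carried by the
    closure of [A] and that [U <= 1] on its support; Frostman's maximum principle
    then gives [U <= 1] everywhere.  As [A] is its own reduced kernel, every
    point of its closure is a limit of points of [A] where [U = 1].

    If [alpha < 2], the kernel is strictly subharmonic off its pole, so [U < 1]
    wherever [ga] has no mass, which gives both assertions.

    If [alpha = 2] and [U x = 1] at one point of [D], the strong maximum principle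
    gives [U = 1] on the connected set [D].  Also [U >= 1] at regular points, so
    [U = 1] up to a set of capacity zero, hence everywhere.  But [ga] has no mass
    where [U] is locally constant: [U] would be unchanged at the centre of a ball
    if the kernel were truncated there.  So [ga = 0], a contradiction.  The same
    two facts, applied locally, identify the support.

    Harmonicity is used only through second differences along the coordinate
    axes and maximum principles for them, so no integration over [R^n] or over
    spheres occurs. *)

(** Every point with [U < 1] brings its own competitor in the infimum, and nothing reduces these
    competitors to countably many. The way out is an estimate whose conclusion forgets the
    competitor. If [pot nu x < 1], the set where [pot nu >= 1] is thin at [x]: by the 3G inequality,
    a measure living on that set close to [x] has at [x] a potential at most [eta] times the
    supremum of its potential. Only the scale from which this holds depends on [x], so countably
    many closed sets cover the exceptional points. The 3G inequality also settles regular points,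
    where it turns a competitor with [pot nu y < 1] into a competitor for the balayage of the Dirac
    mass at [y]. Normalised volume on small balls is replaced by dilated copies of a bounded piece
    of [ga]: their mass is fixed, and their potential is bounded by a multiple of the right power of
    the radius. Frostman's principle needs a potential that is upper semicontinuous across its own
    support; Egorov's argument provides this after discarding a small part of the mass. The
    truncated kernel is obtained by reflecting the poles out of the ball, which keeps harmonicity
    inside. *)

Section EuclideanDistance.
Variables (R : realType) (n : nat).
Implicit Types x y z : pt R n.

Lemma sum_cauchy_schwarz (a b : 'I_n -> R) :
  (\sum_i a i * b i) ^+ 2 <= (\sum_i a i ^+ 2) * (\sum_i b i ^+ 2).
Proof.
set P := \sum_i a i * b i; set Sa := \sum_i a i ^+ 2; set Sb := \sum_i b i ^+ 2.
have Sb0 : 0 <= Sb by apply: sumr_ge0 => i _; exact: sqr_ge0.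
have [Sb_eq0|Sb_neq0] := eqVneq Sb 0.
  have b0 i : b i = 0.
    have /eqP := Sb_eq0; rewrite psumr_eq0; last by move=> j _; exact: sqr_ge0.
    by move=> /allP /(_ i (mem_index_enum i)) /=; rewrite sqrf_eq0 => /eqP.
  rewrite /P big1 ?expr0n ?mulr_ge0 //=; last by move=> i _; rewrite b0 mulr0.
  by apply: sumr_ge0 => i _; exact: sqr_ge0.
have Sb_gt0 : 0 < Sb by rewrite lt_neqAle eq_sym Sb_neq0.
have : 0 <= \sum_i (Sb * a i - P * b i) ^+ 2.
  by apply: sumr_ge0 => i _; exact: sqr_ge0.
have -> : \sum_i (Sb * a i - P * b i) ^+ 2 = Sb * (Sa * Sb - P ^+ 2).
  rewrite (eq_bigr (fun i => Sb ^+ 2 * a i ^+ 2 - (2 * Sb * P) * (a i * b i)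
     + P ^+ 2 * b i ^+ 2)); last by move=> i _; ring.
  by rewrite big_split sumrB /= -!mulr_sumr -/Sa -/Sb -/P; ring.
by rewrite pmulr_rge0 // subr_ge0.
Qed.

Lemma edist_ge0 x y : 0 <= edist x y. Proof. exact: sqrtr_ge0. Qed.

Lemma sqr_edist x y :
  edist x y ^+ 2 = \sum_(i < n) (x ord0 i - y ord0 i) ^+ 2.
Proof. by rewrite sqr_sqrtr //; apply: sumr_ge0 => i _; exact: sqr_ge0. Qed.

Lemma edistC x y : edist x y = edist y x.
Proof. by congr Num.sqrt; apply: eq_bigr => i _; rewrite -sqrrN opprB. Qed.

Lemma edist_eq0 x y : (edist x y == 0) = (x == y).
Proof.
apply/eqP/eqP => [d0|->]; last first.
  by rewrite /edist big1 ?sqrtr0 // => i _; rewrite subrr expr0n.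
have : edist x y ^+ 2 = 0 by rewrite d0 expr0n.
rewrite sqr_edist => /eqP; rewrite psumr_eq0; last by move=> j _; exact: sqr_ge0.
move=> /allP h; apply/rowP => i.
have := h i (mem_index_enum i); rewrite /= sqrf_eq0 subr_eq0 => /eqP.
by [].
Qed.

Lemma edistxx x : edist x x = 0. Proof. by apply/eqP; rewrite edist_eq0. Qed.

Lemma edist_gt0 x y : (0 < edist x y) = (x != y).
Proof. by rewrite lt_neqAle edist_ge0 andbT eq_sym edist_eq0. Qed.

Lemma edist_triangle y x z : edist x z <= edist x y + edist y z.
Proof.
rewrite -(ler_pXn2r (n := 2)) ?nnegrE ?addr_ge0 ?edist_ge0 //.
rewrite sqrrD !sqr_edist.
have CS : \sum_i (x ord0 i - y ord0 i) * (y ord0 i - z ord0 i) <=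
          edist x y * edist y z.
  apply: (le_trans (ler_norm _)).
  rewrite -(ler_pXn2r (n := 2)) ?nnegrE ?mulr_ge0 ?edist_ge0 //.
  rewrite exprMn !sqr_edist real_normK ?num_real //.
  exact: sum_cauchy_schwarz.
have -> : \sum_(i < n) (x ord0 i - z ord0 i) ^+ 2 =
   \sum_(i < n) (x ord0 i - y ord0 i) ^+ 2
   + (\sum_i (x ord0 i - y ord0 i) * (y ord0 i - z ord0 i)) *+ 2
   + \sum_(i < n) (y ord0 i - z ord0 i) ^+ 2.
  rewrite -sumrMnl -!big_split /=; apply: eq_bigr => i _; ring.
by rewrite lerD2r lerD2l lerMn2r CS orbT.
Qed.

Lemma edistDl w x y : edist (w + x) (w + y) = edist x y.
Proof.
congr Num.sqrt; apply: eq_bigr => i _; congr (_ ^+ 2); rewrite !mxE; ring.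
Qed.

Lemma edistZ (a : R) x y : edist (a *: x) (a *: y) = `|a| * edist x y.
Proof.
rewrite /edist -sqrtr_sqr -sqrtrM ?sqr_ge0 // mulr_sumr; congr Num.sqrt.
by apply: eq_bigr => i _; rewrite !mxE -mulrBr exprMn.
Qed.

(** The topology on row vectors comes from the maximum norm, while kernel and balls use the
    Euclidean distance; this bound and the next one identify the two topologies. *)
Lemma norm_le_edist x y : `|x - y| <= edist x y.
Proof.
rewrite [`|_|]mx_normrE; apply/Order.TotalTheory.bigmax_leP => /=; split; first exact: edist_ge0.
move=> [j i] _ /=; rewrite ord1 !mxE.
rewrite -(ler_pXn2r (n := 2)) ?nnegrE ?edist_ge0 ?normr_ge0 //.
rewrite sqr_edist real_normK ?num_real // (bigD1 i) //= lerDl.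
by apply: sumr_ge0 => k _; exact: sqr_ge0.
Qed.

Lemma edist_le_norm x y : edist x y <= n%:R * `|x - y|.
Proof.
rewrite -(ler_pXn2r (n := 2)) ?nnegrE ?edist_ge0 ?mulr_ge0 //.
rewrite sqr_edist exprMn.
have H i : (x ord0 i - y ord0 i) ^+ 2 <= `|x - y| ^+ 2.
  rewrite -[X in X <= _](@real_normK R) ?num_real //.
  rewrite ler_pXn2r ?nnegrE ?normr_ge0 //.
  have -> : x ord0 i - y ord0 i = (x - y) ord0 i by rewrite !mxE.
  by rewrite [X in _ <= X]mx_normrE; have /Order.TotalTheory.bigmax_leP[_ /(_ (ord0, i) isT)] := lexx (\big[Num.max/0]_ij `|(x - y) ij.1 ij.2|).
apply: (@le_trans _ _ (n%:R * `|x - y| ^+ 2)).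
  apply: (le_trans (ler_sum _ (fun i _ => H i))).
  by rewrite sumr_const card_ord mulr_natl.
rewrite ler_wpM2r ?sqr_ge0 //.
case: (n) => [|m]; first by rewrite expr0n.
by rewrite expr2 ler_peMl ?ler1n.
Qed.

Lemma nbhs_edistP x (U : set (pt R n)) :
  nbhs x U <-> exists2 r : R, 0 < r & forall y, edist x y < r -> U y.
Proof.
split=> [/nbhs_ballP[r /= r0 h]|[r r0 h]].
  exists r => // y xy; apply: h; rewrite -ball_normE /=.
  exact: le_lt_trans (norm_le_edist _ _) xy.
(* [n.+1] instead of [n] keeps the radius meaningful when [n = 0]. *)
apply/nbhs_ballP; exists (r / n.+1%:R) => /=; first by rewrite divr_gt0 ?ltr0Sn.
move=> y; rewrite -ball_normE /= ltr_pdivlMr ?ltr0Sn // => xy; apply: h.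
apply: (le_lt_trans (edist_le_norm _ _)); apply: le_lt_trans xy.
by rewrite mulrC ler_wpM2l // ler_nat.
Qed.

Lemma open_edistP (U : set (pt R n)) :
  open U <-> forall x, U x -> exists2 r : R, 0 < r & forall y, edist x y < r -> U y.
Proof.
rewrite openE; split=> h x Ux; first exact/nbhs_edistP/h.
exact/nbhs_edistP/h.
Qed.

Lemma closure_edistP (A : set (pt R n)) x :
  closure A x <-> forall r : R, 0 < r -> exists2 y, A y & edist x y < r.
Proof.
split=> [cA r r0|h B /nbhs_edistP[r r0 rB]].
  have /cA[y [Ay xy]] : nbhs x [set y | edist x y < r].
    by apply/nbhs_edistP; exists r.
  by exists y.
by have [y Ay xy] := h r r0; exists y; split => //; exact: rB.
Qed.

Lemma open_eball x (r : R) : open [set y | edist x y < r].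
Proof.
apply/open_edistP => y /= xy; exists (r - edist x y); first by rewrite subr_gt0.
by move=> z yz; rewrite (le_lt_trans (edist_triangle y _ _)) // -ltrBrDl.
Qed.

Lemma open_eball_compl x (r : R) : open [set y | r < edist x y].
Proof.
apply/open_edistP => y /= xy; exists (edist x y - r); first by rewrite subr_gt0.
move=> z yz; have := edist_triangle z x y; rewrite (edistC z y).
by move: yz; lra.
Qed.

Lemma closed_ecball x (r : R) : closed [set y | edist x y <= r].
Proof.
rewrite -(setCK [set y | _]); apply: open_closedC.
rewrite (_ : ~` _ = [set y | r < edist x y]); first exact: open_eball_compl.
by apply/seteqP; split => y /=; rewrite ltNge => /negP.
Qed.

Lemma compact_ecball x (r : R) : compact [set y | edist x y <= r].
Proof.
apply: bounded_closed_compact; last exact: closed_ecball.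
exists (r + `|x|); split; first exact: num_real.
move=> M hM y /= xy.
rewrite -(subrK x y) (le_trans (ler_normD _ _)) // (le_trans _ (ltW hM)) //.
by rewrite lerD2r -normrN opprB (le_trans (norm_le_edist _ _)).
Qed.

End EuclideanDistance.

(** * Taylor estimates for real powers *)

Section PowerEstimates.
Variable R : realType.
Implicit Types p e t : R.

Lemma powR_le_decr (a b e : R) : e <= 0 -> 0 < a -> a <= b -> b `^ e <= a `^ e.
Proof.
move=> e0 a0 ab; rewrite -(opprK e) 2!(powRN _ (- e)).
rewrite lef_pV2 ?posrE ?powR_gt0 ?(lt_le_trans a0) //.
by apply: ge0_ler_powR; rewrite ?oppr_ge0 // nnegrE ltW // (lt_le_trans a0).
Qed.

Lemma powR_lt_decr (a b e : R) : e < 0 -> 0 < a -> a < b -> b `^ e < a `^ e.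
Proof.
move=> e0 a0 ab; rewrite -(opprK e) 2!(powRN _ (- e)).
have b0 := lt_trans a0 ab.
rewrite ltf_pV2 ?posrE ?powR_gt0 //.
by apply: gt0_ltr_powR; rewrite ?oppr_gt0 ?nnegrE ?(ltW a0) ?(ltW b0).
Qed.

Lemma powR_taylor1 p e : 0 < e -> exists2 c : R, 0 < c < 1 &
  forall u, `|u| <= c -> `|(1 + u) `^ (- p) - 1 + p * u| <= e * `|u|.
Proof.
move=> e0.
have [dv dE] := is_derive1_powR (- p) (ltr01 : 0 < (1 : R)).
have := dv => /cvg_ex[l /= Hl].
have lE : l = - p by move: dE; rewrite /derive (cvg_lim _ Hl) // powR1 mulr1.
have [d /= d0 Hd] := (iffLR (cvgrPdist_le _ _) Hl) _ e0.
have c0 : 0 < Num.min (d / 2) (2^-1 : R) by rewrite lt_min divr_gt0 //= invr_gt0.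
exists (Num.min (d / 2) (2^-1 : R)).
  by rewrite c0 /= gt_min; apply/orP; right; rewrite invf_lt1 // ltr1n.
move=> u; rewrite le_min => /andP[u1 u2].
have [->|u_neq0] := eqVneq u 0.
  by rewrite normr0 mulr0 mulr0 addr0 addr0 powR1 subrr normr0.
have /Hd /(_ u_neq0) : ball 0 d u.
  rewrite /ball /= sub0r normrN (le_lt_trans u1) // ltr_pdivrMr // mulr2n.
  by rewrite mulrDr mulr1 ltrDl.
rewrite lE -[_ *: 1]/(u * 1) mulr1 powR1 (addrC u 1) => H.
have -> : (1 + u) `^ (- p) - 1 + p * u =
   - (u * (- p - u^-1 *: ((1 + u) `^ (- p) - 1))).
  by rewrite -[_ *: _]/(u^-1 * _) mulrBr mulrA divff // mul1r; ring.
by rewrite normrN normrM mulrC ler_wpM2r.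
Qed.

Lemma is_derive_powR_affine p (a t : R) : 0 < 1 + a * t ->
  is_derive t 1 (fun t : R => (1 + a * t) `^ (- p))
    (- p * a * (1 + a * t) `^ (- (p + 1))).
Proof.
move=> pos.
have D1 : is_derive t 1 (fun t : R => 1 + a * t) a.
  have -> : (fun t : R => 1 + a * t) = cst 1 + (a \*: @id R) by [].
  by apply: is_derive_eq; rewrite add0r /= -[_ *: _]/(a * 1) mulr1.
have D2 := is_derive1_powR (- p) pos.
have := @is_derive1_comp R (fun x => x `^ (- p)) (fun t : R => 1 + a * t) t _ _ D2 D1.
move=> H; apply: (is_derive_eq H).
rewrite -[LHS]/((- p * (1 + a * t) `^ (- p - 1)) * a).
by rewrite opprD; ring.
Qed.

(** The derivative of the quantity to be bounded is a difference of two first-order remainders for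
    the exponent [p + 1], so the mean value theorem reduces the claim to [powR_taylor1]; the
    tolerance [e / (2 * p)] compensates the factor [p] and the two terms. Evenness leaves only
    [t >= 0]. *)
Lemma powR_even_taylor2 p e : 0 < p -> 0 < e -> exists2 c : R, 0 < c < 1 &
  forall t, `|t| <= c ->
    `|(1 + t) `^ (- p) + (1 - t) `^ (- p) - 2 - p * (p + 1) * t ^+ 2|
      <= e * t ^+ 2.
Proof.
move=> p0 e0.
have e'0 : 0 < e / (2 * p) by rewrite divr_gt0 // mulr_gt0.
have [c /andP[c0 c1] Hc] := powR_taylor1 (p + 1) e'0.
exists c; first by rewrite c0.
pose g t := (1 + 1 * t) `^ (- p) + (1 + (-1) * t) `^ (- p) - 2 - p * (p + 1) * t ^+ 2.
pose g' t := - p * 1 * (1 + 1 * t) `^ (- (p + 1))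
  + - p * (-1) * (1 + (-1) * t) `^ (- (p + 1)) - 2 * p * (p + 1) * t.
have pos t : 0 <= t <= c -> 0 < 1 + 1 * t /\ 0 < 1 + (-1) * t by lra.
have Dg t : 0 <= t <= c -> is_derive t 1 g (g' t).
  move=> /pos[p1 p2].
  have D1 := is_derive_powR_affine p p1.
  have D2 := is_derive_powR_affine p p2.
  have D3 : is_derive t 1 (fun t : R => p * (p + 1) * t ^+ 2) (2 * p * (p + 1) * t).
    have -> : (fun t : R => p * (p + 1) * t ^+ 2) = (p * (p + 1)) \*: (@id R ^+ 2).
      by apply/funext => x.
    by apply: is_derive_eq; rewrite /= expr1 -!/( _ *: _ ) /GRing.scale /=; ring.
  have -> : g = (fun t : R => (1 + 1 * t) `^ (- p)) + (fun t : R => (1 + (-1) * t) `^ (- p))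
     - cst 2 - (fun t : R => p * (p + 1) * t ^+ 2) by apply/funext => x.
  by apply: is_derive_eq; rewrite /g' subr0.
have g'_le t : 0 <= t <= c -> `|g' t| <= e * t.
  move=> /andP[t0 tc].
  have h1 := Hc t; have h2 := Hc (- t).
  rewrite normrN ger0_norm // in h1 h2; have {}h1 := h1 tc; have {}h2 := h2 tc.
  have -> : g' t = - p * (((1 + t) `^ (- (p + 1)) - 1 + (p + 1) * t)
      - ((1 - t) `^ (- (p + 1)) - 1 + (p + 1) * (- t))).
    by rewrite /g' !mul1r mulN1r; ring.
  rewrite normrM normrN (gtr0_norm p0).
  apply: (@le_trans _ _ (p * (2 * (e / (2 * p) * t)))).
    rewrite ler_wpM2l ?(ltW p0) //; apply: (le_trans (ler_normB _ _)).
    by move: h1 h2; rewrite -[- t]mulN1r; lra.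
  by rewrite le_eqVlt; apply/orP; left; apply/eqP; field; rewrite gt_eqF.
have main t : 0 <= t <= c -> `|g t| <= e * t ^+ 2.
  move=> /andP[t0 tc].
  have [->|t_neq0] := eqVneq t 0.
    by rewrite /g !mulr0 addr0 powR1 expr0n /= !mulr0 !subr0 (_ : 1 + 1 - 2 = 0 :> R) ?normr0 //; lra.
  have tpos : 0 < t by rewrite lt_neqAle eq_sym t_neq0.
  have [||x /[!in_itv] /= /andP[x0 xt]] := @MVT R g g' 0 t tpos.
  - by move=> x; rewrite in_itv /= => /andP[x0 xt]; apply: Dg; move: x0 xt tc; lra.
  - apply: derivable_within_continuous => x; rewrite in_itv /= => /andP[x0 xt].
    by have [] : is_derive x 1 g (g' x) by apply: Dg; move: x0 xt tc; lra.
  - have -> : g 0 = 0 by rewrite /g !mulr0 addr0 powR1 expr0n /= !mulr0 subr0; lra.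
    rewrite !subr0 => ->; rewrite normrM (gtr0_norm tpos) expr2 mulrA.
    rewrite ler_wpM2r //; apply: le_trans (g'_le x _) _.
      by move: x0 xt tc; lra.
    by rewrite ler_wpM2l ?(ltW e0) ?(ltW xt).
move=> t tc; have [t0|t0] := leP 0 t.
  by have := main t; rewrite /g mul1r mulN1r; apply; rewrite t0 (le_trans (ler_norm _)).
have := main (- t); rewrite /g mul1r mulN1r opprK sqrrN (addrC ((1 - t) `^ _)).
by apply; rewrite oppr_ge0 (ltW t0) /= -(ltr0_norm t0).
Qed.

End PowerEstimates.

(** * Second differences of powers of the distance *)

Section DiscreteLaplacian.
Variables (R : realType) (n : nat).

(* Second-order expansion of the sum of [|x +- h e_i|^(-2p)] over the coordinate
   directions: the Laplacian of [|x|^(-2p)] is [2p (2p + 2 - n) |x|^(-2p-2)]. *)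
Lemma discrete_laplacian (p e : R) : 0 < p -> 0 < e ->
  exists2 c : R, 0 < c < 1 & forall (v : 'I_n -> R) (h : R),
    let q := \sum_i v i ^+ 2 in
    0 < q -> h ^+ 2 <= c * q ->
    `|\sum_i ((q + h ^+ 2 + 2 * h * v i) `^ (- p)
              + (q + h ^+ 2 - 2 * h * v i) `^ (- p))
      - q `^ (- p) * (2 * n%:R + 2 * p * (2 * p + 2 - n%:R) * (h ^+ 2 / q))|
    <= e * (q `^ (- p) * (h ^+ 2 / q)).
Proof.
move=> p0 e0.
have e1_gt0 : 0 < e / 12 by rewrite divr_gt0.
have n1_gt0 : 0 < 6 * (n%:R + 1) :> R by rewrite mulr_gt0 // ltr_wpDl.
have e2_gt0 : 0 < e / (6 * (n%:R + 1)) by rewrite divr_gt0.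
have [c1 /andP[c1_gt0 c1_lt1] H1] := powR_even_taylor2 p0 e1_gt0.
have [c2 /andP[c2_gt0 c2_lt1] H2] := powR_taylor1 p e2_gt0.
have [c3 /andP[c3_gt0 c3_lt1] H3] := powR_taylor1 (p + 2) (@ltr01 R).
have d_gt0 : 0 < 12 * p * (p + 1) * (p + 3) by rewrite !mulr_gt0 // addr_gt0.
(* [c2] and [c3] allow the first-order expansions in [u = h^2 / q]; [c1^2 / 4] gives [|t i| <= c1],
   as [t i ^+ 2 <= 4 * u]; the last bound tames the term quadratic in [u]. The three errors [E1],
   [E2], [E3] are then each at most [e / 3 * u]. *)
pose c := Num.min (Num.min c2 c3) (Num.min (c1 ^+ 2 / 4) (e / (12 * p * (p + 1) * (p + 3)))).
have c_gt0 : 0 < c by rewrite !lt_min c2_gt0 c3_gt0 !divr_gt0 // exprn_gt0.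
exists c; first by rewrite c_gt0 !gt_min c2_lt1.
move=> v h q q0 hq; set u := h ^+ 2 / q.
have u0 : 0 <= u by rewrite divr_ge0 ?sqr_ge0 ?ltW.
have : u <= c by rewrite ler_pdivrMr.
rewrite !le_min => /andP[/andP[uc2 uc3] /andP[uc1 ud]].
have hE : h ^+ 2 = q * u by rewrite /u mulrC divfK // gt_eqF.
have u1_gt0 : 0 < 1 + u by rewrite ltr_pwDl.
have u1_ge1 : 1 <= (1 + u) ^+ 2 by rewrite exprn_ege1 // lerDl.
(* As [a = q + h^2], factoring out [a] leaves [1 + t i] and [1 - t i], so only the even part of the
   power is seen. *)
pose a := q * (1 + u).
have a0 : 0 < a by rewrite mulr_gt0.
pose t i := 2 * h * v i / a.
have tE i : t i ^+ 2 = 4 * h ^+ 2 * v i ^+ 2 / a ^+ 2.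
  by rewrite /t; field; rewrite gt_eqF.
have v_le i : v i ^+ 2 <= q.
  by rewrite /q (bigD1 i) //= lerDl; apply: sumr_ge0 => k _; exact: sqr_ge0.
have t_le i : `|t i| <= c1.
  rewrite -(ler_pXn2r (n := 2)) ?nnegrE ?(ltW c1_gt0) // real_normK ?num_real //.
  rewrite tE; apply: (@le_trans _ _ (4 * u)); last by move: uc1; lra.
  rewrite ler_pdivrMr ?exprn_gt0 // hE.
  apply: (@le_trans _ _ (4 * (q * u) * q)); first by apply: ler_wpM2l (v_le i); apply: mulr_ge0 => //; apply: mulr_ge0 => //; exact: ltW.
  have -> : 4 * u * a ^+ 2 = 4 * (q * u) * q * (1 + u) ^+ 2 by rewrite /a; ring.
  apply: ler_peMr u1_ge1; apply: mulr_ge0; last exact: ltW.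
  by apply: mulr_ge0 => //; apply: mulr_ge0 => //; exact: ltW.
have t_lt1 i : -1 < t i < 1 by rewrite -ltr_norml (le_lt_trans (t_le i)).
pose r i := (1 + t i) `^ (- p) + (1 - t i) `^ (- p) - 2 - p * (p + 1) * t i ^+ 2.
have r_le i : `|r i| <= e / 12 * t i ^+ 2 by exact: H1.
(* The sum over directions is exact because the [v i ^+ 2] add up to [q]; after it the direction of
   [v] is felt only through the remainder [r0]. *)
have sumt : \sum_i t i ^+ 2 = 4 * u / (1 + u) ^+ 2.
  rewrite (eq_bigr (fun i => 4 * h ^+ 2 / a ^+ 2 * v i ^+ 2)); last first.
    by move=> i _; rewrite tE; ring.
  rewrite -mulr_sumr -/q hE /a; field.
  by rewrite !gt_eqF.
have u1_inv : (1 + u) ^- 2 <= 1 by rewrite invf_le1 // exprn_gt0.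
pose r0 := \sum_i r i.
have r0_le : `|r0| <= e / 3 * u.
  apply: (le_trans (ler_norm_sum _ _ _)).
  apply: (le_trans (ler_sum _ (fun i _ => r_le i))).
  rewrite -mulr_sumr sumt.
  have -> : e / 12 * (4 * u / (1 + u) ^+ 2) = e / 3 * u * (1 + u) ^- 2 by field; rewrite gt_eqF.
  by rewrite ler_piMr // mulr_ge0 // divr_ge0 // ltW.
have sumE : \sum_i ((q + h ^+ 2 + 2 * h * v i) `^ (- p)
              + (q + h ^+ 2 - 2 * h * v i) `^ (- p))
   = q `^ (- p) * ((1 + u) `^ (- p) * (2 * n%:R + r0)
        + (1 + u) `^ (- (p + 2)) * (4 * p * (p + 1) * u)).
  have aE i (s : R) : s = 1 \/ s = -1 ->
     (q + h ^+ 2 + s * (2 * h * v i)) `^ (- p) = a `^ (- p) * (1 + s * t i) `^ (- p).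
    move=> sE; rewrite -powRM ?(ltW a0) //.
      by congr (_ `^ _); rewrite mulrDr mulr1 /t hE /a; field; rewrite !gt_eqF.
    by have := t_lt1 i; case: sE => ->; lra.
  rewrite (eq_bigr (fun i => a `^ (- p) * (2 + p * (p + 1) * t i ^+ 2 + r i))); last first.
    move=> i _; have := aE i 1 (or_introl erefl); rewrite !mul1r => ->.
    have := aE i (-1) (or_intror erefl); rewrite !mulN1r => ->.
    by rewrite -mulrDr /r; congr (_ * _); ring.
  rewrite -mulr_sumr big_split /= -/r0 big_split /= -mulr_sumr sumt sumr_const card_ord.
  rewrite /a powRM ?(ltW q0) ?(ltW u1_gt0) //.
  rewrite (opprD p 2) powRD; last by apply/implyP => _; rewrite gt_eqF.
  rewrite -(mulr_natr 2) -mulrA; congr (_ * _).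
  rewrite (_ : (1 + u) `^ (- 2) = (1 + u) ^- 2); last first.
    by rewrite powRN powR_mulrn ?ltW.
  by field; rewrite gt_eqF.
rewrite sumE -mulrBr normrM (ger0_norm (powR_ge0 _ _)) [X in _ <= X]mulrCA.
apply: ler_wpM2l; first exact: powR_ge0.
have := H2 u; rewrite (ger0_norm u0) => /(_ uc2).
have := H3 u; rewrite (ger0_norm u0) mul1r => /(_ uc3).
set B := (1 + u) `^ (- p); set B2 := (1 + u) `^ (- (p + 2)).
move=> hB2 hB.
have B_ge0 : 0 <= B by exact: powR_ge0.
have B_le1 : B <= 1.
  have <- : 1 `^ (- p) = 1 :> R by rewrite powR1.
  by apply: powR_le_decr; rewrite ?oppr_le0 ?lerDl ?(ltW p0).
have -> : B * (2 * n%:R + r0) + B2 * (4 * p * (p + 1) * u)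
     - (2 * n%:R + 2 * p * (2 * p + 2 - n%:R) * u)
   = 2 * n%:R * (B - 1 + p * u) + B * r0 + 4 * p * (p + 1) * u * (B2 - 1) by ring.
have E1 : `|2 * n%:R * (B - 1 + p * u)| <= e / 3 * u.
  rewrite normrM ger0_norm ?mulr_ge0 //.
  apply: (@le_trans _ _ (2 * n%:R * (e / (6 * (n%:R + 1)) * u))); first by apply: ler_wpM2l hB; exact: mulr_ge0.
  have -> : 2 * n%:R * (e / (6 * (n%:R + 1)) * u) = (n%:R / (n%:R + 1)) * (e / 3 * u).
    by field; rewrite -[1]/(1%:R) -natrD pnatr_eq0 addn1.
  apply: ler_piMl.
    by apply: mulr_ge0 => //; apply: divr_ge0 => //; exact: ltW.
  by rewrite ler_pdivrMr ?mul1r ?lerDl // ltr_wpDl.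
have E2 : `|B * r0| <= e / 3 * u.
  by rewrite normrM ger0_norm // (le_trans _ r0_le) // ler_piMl.
have E3 : `|4 * p * (p + 1) * u * (B2 - 1)| <= e / 3 * u.
  have K0 : 0 <= 4 * p * (p + 1) * u.
    apply: mulr_ge0 => //; apply: mulr_ge0; last by apply: addr_ge0 => //; exact: ltW.
    by apply: mulr_ge0 => //; exact: ltW.
  have hB2' : `|B2 - 1| <= (p + 3) * u.
    rewrite -[B2 - 1](addrK ((p + 2) * u)).
    apply: (le_trans (ler_normB _ _)); rewrite (ger0_norm (x := (p + 2) * u)).
      by move: hB2; lra.
    by rewrite mulr_ge0 // addr_ge0 // ltW.
  rewrite normrM (ger0_norm K0).
  apply: (@le_trans _ _ (4 * p * (p + 1) * u * ((p + 3) * (e / (12 * p * (p + 1) * (p + 3)))))).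
    apply: ler_wpM2l => //; apply: (le_trans hB2').
    by apply: ler_wpM2l => //; apply: addr_ge0 => //; exact: ltW.
  rewrite le_eqVlt; apply/orP; left; apply/eqP; field.
  by rewrite !gt_eqF // addr_gt0.
apply: (le_trans (ler_normD _ _)).
have := ler_normD (2 * n%:R * (B - 1 + p * u)) (B * r0).
by lra.
Qed.

End DiscreteLaplacian.

Section Measurability.
Variables (R : realType) (n : nat).

Lemma open_measurable_Rn (U : set (pt R n)) : open U -> measurable (U : set (Rn R n)).
Proof. exact: sub_sigma_algebra. Qed.

Lemma closed_measurable_Rn (U : set (pt R n)) : closed U -> measurable (U : set (Rn R n)).
Proof.
move=> cU; rewrite -(setCK U); apply: measurableC; apply: open_measurable_Rn.
exact: closed_openC.
Qed.

Lemma measurable_set1_Rn (x : pt R n) : measurable ([set x] : set (Rn R n)).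
Proof.
apply: closed_measurable_Rn; apply: accessible_closed_set1.
exact/hausdorff_accessible/norm_hausdorff.
Qed.

Lemma continuous_measurable_Rn (f : pt R n -> R) :
  continuous f -> measurable_fun [set: Rn R n] (f : Rn R n -> R).
Proof.
move=> cf; apply: (measurability _ (RGenOInfty.measurableE R)).
move=> _ [_ [x ->] <-]; rewrite setTI; apply: open_measurable_Rn.
by move/continuousP : cf; apply; exact: rray_open.
Qed.

Lemma measurable_coord (i : 'I_n) :
  measurable_fun [set: Rn R n] ((fun x : pt R n => x ord0 i) : Rn R n -> R).
Proof. by apply: continuous_measurable_Rn => x; exact: coord_continuous. Qed.

(* A map into [Rn] with measurable coordinates need not be known measurable; the
   distance between two such maps is measurable nevertheless. *)
Lemma measurable_edist d (T : measurableType d) (f g : T -> pt R n) :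
  (forall i, measurable_fun [set: T] (fun t => f t ord0 i)) ->
  (forall i, measurable_fun [set: T] (fun t => g t ord0 i)) ->
  measurable_fun [set: T] (fun t => edist (f t) (g t)).
Proof.
move=> mf mg; rewrite (_ : (fun t => _) =
  (fun t => (\sum_(i < n) (f t ord0 i - g t ord0 i) ^+ 2) `^ 2^-1)); last first.
  by apply/funext => t; rewrite powR12_sqrt // sumr_ge0 // => i _; exact: sqr_ge0.
apply: (measurableT_comp (measurable_powR _)).
apply: measurable_sum => i; apply: measurable_funX; exact: measurable_funB.
Qed.

End Measurability.

(** * The Riesz kernel: homogeneity, semicontinuity, 3G inequality *)

Section RieszKernel.
Variables (R : realType) (n : nat) (alpha : R).
Hypothesis aln : alpha < n%:R.
Implicit Types x y z w : pt R n.
Local Notation k := (kappa alpha).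

Lemma kappa_neq x y : x != y -> k x y = (edist x y `^ (alpha - n%:R))%:E.
Proof. by rewrite /kappa => /negbTE ->. Qed.

Lemma kappaxx x : k x x = +oo%E. Proof. by rewrite /kappa eqxx. Qed.

Lemma kappa_ge0 x y : (0 <= k x y)%E.
Proof. by rewrite /kappa; case: ifP => // _; rewrite lee_fin powR_ge0. Qed.

Lemma kappa_gt0 x y : (0 < k x y)%E.
Proof.
rewrite /kappa; case: ifPn => [_|xy]; first exact: ltry.
by rewrite lte_fin powR_gt0 // edist_gt0.
Qed.

Lemma kappaC x y : k x y = k y x.
Proof. by rewrite /kappa eq_sym edistC. Qed.

Lemma kappa_lb x y (r : R) : 0 < r -> edist x y <= r -> ((r `^ (alpha - n%:R))%:E <= k x y)%E.
Proof.
move=> r0 xyr; have [->|xy] := eqVneq x y; first by rewrite kappaxx leey.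
rewrite kappa_neq // lee_fin; apply: powR_le_decr => //; last by rewrite edist_gt0.
by rewrite subr_le0 ltW.
Qed.

Lemma kappa_ub x y (r : R) : 0 < r -> r <= edist x y -> (k x y <= (r `^ (alpha - n%:R))%:E)%E.
Proof.
move=> r0 rxy; have xy : x != y by rewrite -edist_gt0 (lt_le_trans r0).
rewrite kappa_neq // lee_fin; apply: powR_le_decr => //.
by rewrite subr_le0 ltW.
Qed.

Lemma kappa_le_dist x w p z (a : R) : 0 < a -> edist p z <= a * edist x w ->
  (k x w <= (a `^ (n%:R - alpha))%:E * k p z)%E.
Proof.
move=> a0 H; have c0 : (0 < (a `^ (n%:R - alpha))%:E)%E by rewrite lte_fin powR_gt0.
have [->|pz] := eqVneq p z; first by rewrite kappaxx mulry gtr0_sg ?powR_gt0 // mul1e leey.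
have xw : x != w.
  by rewrite -edist_gt0 -(pmulr_rgt0 _ a0) (lt_le_trans _ H) // edist_gt0.
rewrite !kappa_neq // -EFinM lee_fin -(opprB alpha) powRN ler_pdivlMl ?powR_gt0 //.
rewrite -powRM ?(ltW a0) ?edist_ge0 //.
apply: powR_le_decr => //; last by rewrite edist_gt0.
by rewrite subr_le0 ltW.
Qed.

(** The larger of the distances from [z] to [x] and to [w] is at least half the distance from [x] to
    [w], so the corresponding kernel is at most 2^s times [k x w]. *)
Lemma kappa_3G x z w : (k x z * k z w <=
   (2 `^ (n%:R - alpha))%:E * (k x w * (k x z + k z w)))%E.
Proof.
have C0 : (0 <= (2 `^ (n%:R - alpha))%:E :> \bar R)%E by rewrite lee_fin powR_ge0.
have T := edist_triangle z x w.
have [H|/ltW H] := leP (edist x z) (edist z w).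
  have : (k z w <= (2 `^ (n%:R - alpha))%:E * k x w)%E.
    by apply: kappa_le_dist => //; move: T H; lra.
  move=> /(lee_wpmul2l (kappa_ge0 x z)) /le_trans; apply.
  rewrite muleCA lee_wpmul2l // muleC lee_wpmul2l ?kappa_ge0 // leeDl ?kappa_ge0 //.
have : (k x z <= (2 `^ (n%:R - alpha))%:E * k x w)%E.
  by apply: kappa_le_dist => //; move: T H; lra.
move=> /(lee_wpmul2r (kappa_ge0 z w)) /le_trans; apply.
by rewrite -muleA lee_wpmul2l // lee_wpmul2l ?kappa_ge0 // leeDr ?kappa_ge0.
Qed.

Lemma kappa_dilate y x z (a : R) : 0 < a ->
  (k (y + a *: x)%R (y + a *: z)%R = (a `^ (alpha - n%:R))%:E * k x z)%E.
Proof.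
move=> a0; have d : edist (y + a *: x) (y + a *: z) = a * edist x z.
  by rewrite edistDl edistZ gtr0_norm.
have [->|xz] := eqVneq x z; first by rewrite !kappaxx mulry gtr0_sg ?powR_gt0 // mul1e.
have neq : y + a *: x != y + a *: z by rewrite -edist_gt0 d mulr_gt0 // edist_gt0.
by rewrite !kappa_neq // d powRM ?(ltW a0) ?edist_ge0.
Qed.

Lemma kappa_lsc x z (c : \bar R) : (c < k x z)%E ->
  exists2 r : R, 0 < r & forall x', edist x x' < r -> (c < k x' z)%E.
Proof.
case: c => [c| |_]; last 2 first.
- by move=> h; have := leey (k x z); rewrite leNgt h.
- exists 1; first exact: ltr01.
  by move=> x' _; exact: lt_le_trans (ltNyr 0) (kappa_ge0 _ _).
move=> ck; have e0 : alpha - n%:R < 0 by rewrite subr_lt0.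
have [c0|c0] := leP c 0.
  exists 1; first exact: ltr01.
  by move=> x' _; apply: le_lt_trans (kappa_gt0 x' z); rewrite lee_fin.
pose d := c `^ (alpha - n%:R)^-1.
have d0 : 0 < d by rewrite powR_gt0.
have cE : c = d `^ (alpha - n%:R) by rewrite -powRrM mulVf ?lt_eqF // powRr1 // ltW.
have kd y : (c%:E < k y z)%E <-> edist y z < d.
  have [->|yz] := eqVneq y z; first by rewrite kappaxx ltry edistxx d0.
  rewrite kappa_neq // lte_fin cE; split => [|H]; last first.
    by apply: powR_lt_decr => //; rewrite edist_gt0.
  by apply: contraTT; rewrite -!leNgt => H; apply: powR_le_decr => //; exact: ltW.
have {}ck := (kd x).1 ck.
exists (d - edist x z); first by rewrite subr_gt0.
move=> x' xx'; apply/kd; rewrite (le_lt_trans (edist_triangle x _ _)) //.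
by rewrite edistC -ltrBrDr.
Qed.

Lemma measurable_kappa_comp d (T : measurableType d) (f g : T -> pt R n) :
  (forall i, measurable_fun [set: T] (fun t => f t ord0 i)) ->
  (forall i, measurable_fun [set: T] (fun t => g t ord0 i)) ->
  measurable_fun [set: T] (fun t => k (f t) (g t)).
Proof.
move=> mf mg; have md := measurable_edist mf mg.
rewrite (_ : (fun t => _) = (fun t => if edist (f t) (g t) == 0 then +oo%E
   else (edist (f t) (g t) `^ (alpha - n%:R))%:E)); last first.
  by apply/funext => t; rewrite /kappa edist_eq0.
apply: measurable_fun_ifT => //.
  by apply: measurable_fun_eqr => //; exact: measurable_cst.
apply/measurable_EFinP; exact: (measurableT_comp (measurable_powR _) md).
Qed.

Lemma measurable_kappa x : measurable_fun [set: Rn R n] (k x : Rn R n -> \bar R).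
Proof.
have := @measurable_kappa_comp _ (Rn R n) (cst x) id; apply => i.
  exact: measurable_cst.
exact: measurable_coord.
Qed.

Lemma measurable_kappa2 :
  measurable_fun [set: Rn R n * Rn R n] (fun p : Rn R n * Rn R n => k p.1 p.2).
Proof.
apply: measurable_kappa_comp => i.
  exact: (measurableT_comp (measurable_coord i) measurable_fst).
exact: (measurableT_comp (measurable_coord i) measurable_snd).
Qed.

End RieszKernel.

(** * Operations on Radon measures, Tonelli, semicontinuity of integrals *)

Section MeasuresOnRn.
Variables (R : realType) (n : nat).
Local Notation RM := (@RMeasure R n).
Local Notation pt := (pt R n).
Local Open Scope ereal_scope.

Definition restrict_meas (mu : RM) (F : set (Rn R n)) (mF : measurable F) : RM := mrestr mu mF.
Definition add_meas (mu nu : RM) : RM := measure_add mu nu.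
Definition scale_meas (c : {nonneg R}) (mu : RM) : RM := mscale c mu.

Lemma restrict_measE (mu : RM) F (mF : measurable F) B :
  restrict_meas mu mF B = mu (B `&` F).
Proof. by []. Qed.

Lemma integral_restrict_meas (mu : RM) F (mF : measurable F) (f : Rn R n -> \bar R) :
  measurable_fun [set: Rn R n] f -> (forall x, 0 <= f x) ->
  \int[restrict_meas mu mF]_x f x = \int[mu]_(x in F) f x.
Proof.
move=> mf f0; have mFc := measurableC mF.
rewrite -(setUv F) (ge0_integral_setU _ mF mFc) //; last 2 first.
- by rewrite setUv.
- by rewrite disj_set2E setICr.
rewrite [X in _ + X](_ : _ = 0) ?adde0; last first.
  by apply: null_set_integral; [|exact: measurable_funTS|rewrite restrict_measE setICl measure0].
apply: eq_measure_integral => A mA AF.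
by rewrite restrict_measE setIidl.
Qed.

Lemma integral_restrict_measC (mu : RM) F (mF : measurable F) (f : Rn R n -> \bar R) :
  measurable_fun [set: Rn R n] f -> (forall x, 0 <= f x) ->
  \int[mu]_x f x = \int[restrict_meas mu mF]_x f x
                   + \int[restrict_meas mu (measurableC mF)]_x f x.
Proof.
move=> mf f0; rewrite !integral_restrict_meas // -{1}(setUv F).
rewrite (ge0_integral_setU _ mF (measurableC mF)) //.
- by rewrite setUv.
- by rewrite disj_set2E setICr.
Qed.

Lemma integral_null_compl (mu : RM) (F : set (Rn R n)) (f g : Rn R n -> \bar R) :
  measurable F -> mu (~` F) = 0 ->
  measurable_fun [set: Rn R n] f -> measurable_fun [set: Rn R n] g ->
  (forall x, 0 <= f x) -> (forall x, 0 <= g x) ->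
  (forall x, F x -> f x <= g x) -> \int[mu]_x f x <= \int[mu]_x g x.
Proof.
move=> mF F0 mf mg f0 g0 fg; apply: ae_ge0_le_integral => //.
exists (~` F); split => //; first exact: measurableC.
by move=> x /= h Fx; apply: h => _; exact: fg.
Qed.

Lemma ge0_integral_RnD (mu : RM) (f g : Rn R n -> \bar R) :
  measurable_fun [set: Rn R n] f -> measurable_fun [set: Rn R n] g ->
  (forall x, 0 <= f x) -> (forall x, 0 <= g x) ->
  \int[mu]_x (f x + g x) = \int[mu]_x f x + \int[mu]_x g x.
Proof. by move=> mf mg f0 g0; apply: ge0_integralD. Qed.

Lemma ge0_integral_RnZl (mu : RM) (c : \bar R) (f : Rn R n -> \bar R) :
  measurable_fun [set: Rn R n] f -> (forall x, 0 <= f x) -> 0 <= c ->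
  \int[mu]_x (c * f x) = c * \int[mu]_x f x.
Proof. by move=> mf f0 c0; apply: ge0_integralZl. Qed.

Lemma ge0_le_integral_Rn (mu : RM) (f g : Rn R n -> \bar R) :
  measurable_fun [set: Rn R n] f -> measurable_fun [set: Rn R n] g ->
  (forall x, 0 <= f x) -> (forall x, f x <= g x) ->
  \int[mu]_x f x <= \int[mu]_x g x.
Proof. by move=> mf mg f0 fg; apply: ge0_le_integral. Qed.

Lemma ge0_le_integral_RnZlD (mu : RM) (c : \bar R) (f g h : Rn R n -> \bar R) :
  measurable_fun [set: Rn R n] f -> measurable_fun [set: Rn R n] g ->
  measurable_fun [set: Rn R n] h ->
  (forall x, 0 <= f x) -> (forall x, 0 <= g x) -> (forall x, 0 <= h x) -> 0 <= c ->
  (forall x, h x <= c * (f x + g x)) ->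
  \int[mu]_x h x <= c * (\int[mu]_x f x + \int[mu]_x g x).
Proof.
move=> mf mg mh f0 g0 h0 c0 hfg.
have mfg : measurable_fun [set: Rn R n] (fun x => f x + g x) by exact: emeasurable_funD.
have fg0 x : 0 <= f x + g x by exact: adde_ge0.
rewrite -ge0_integral_RnD // -ge0_integral_RnZl //; apply: ge0_le_integral_Rn => //.
by apply: emeasurable_funM => //; exact: measurable_cst.
Qed.

Lemma radon_ecball_lty (mu : RM) x (r : R) : radon mu -> mu [set y | (edist x y <= r)%R] < +oo.
Proof. by apply; exact: compact_ecball. Qed.

Lemma measurable_eball x (r : R) : measurable ([set y | (edist x y < r)%R] : set (Rn R n)).
Proof. by apply: open_measurable_Rn; exact: open_eball. Qed.

Lemma measurable_ecball x (r : R) : measurable ([set y | (edist x y <= r)%R] : set (Rn R n)).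
Proof. by apply: closed_measurable_Rn; exact: closed_ecball. Qed.

Lemma bigcup_ecball (x : pt) : \bigcup_j [set y | (edist x y <= j%:R)%R] = [set: pt].
Proof.
apply/seteqP; split => // y _; have := edist_ge0 x y => d0.
exists (Num.truncn (edist x y)).+1 => //=.
by have /andP[_ /ltW] := truncn_itv d0.
Qed.

Lemma radon_sigma_finite (mu : RM) : radon mu -> sigma_finite [set: Rn R n] mu.
Proof.
move=> rmu; exists (fun j => [set y | (edist (0%R : pt) y <= j%:R)%R]).
  by rewrite bigcup_ecball.
by move=> j; split; [exact: measurable_ecball|exact: radon_ecball_lty].
Qed.

Lemma tonelli_radon (mu nu : RM) (f : Rn R n * Rn R n -> \bar R) :
  radon mu -> radon nu -> measurable_fun [set: _] f -> (forall p, 0 <= f p) ->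
  \int[mu]_x \int[nu]_y f (x, y) = \int[nu]_y \int[mu]_x f (x, y).
Proof.
move=> rmu rnu mf f0.
pose Smu := isSFinite.Build _ _ _ (Measure.sort mu)
  (sfinite_measure_sigma_finite (radon_sigma_finite rmu)).
pose Mmu := isSigmaFinite.Build _ _ _ (Measure.sort mu) (radon_sigma_finite rmu).
pose mu' := HB.pack_for (SigmaFiniteMeasure.type (Rn R n) R) (Measure.sort mu) Smu Mmu.
pose Snu := isSFinite.Build _ _ _ (Measure.sort nu)
  (sfinite_measure_sigma_finite (radon_sigma_finite rnu)).
pose Mnu := isSigmaFinite.Build _ _ _ (Measure.sort nu) (radon_sigma_finite rnu).
pose nu' := HB.pack_for (SigmaFiniteMeasure.type (Rn R n) R) (Measure.sort nu) Snu Mnu.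
exact: (@fubini_tonelli _ _ _ _ R mu' nu' f mf f0).
Qed.

Lemma measurable_integral_radon (nu : RM) (f : Rn R n * Rn R n -> \bar R) :
  radon nu -> measurable_fun [set: _] f -> (forall p, 0 <= f p) ->
  measurable_fun [set: Rn R n] (fun x => \int[nu]_y f (x, y)).
Proof.
move=> rnu mf f0.
pose Snu := isSFinite.Build _ _ _ (Measure.sort nu)
  (sfinite_measure_sigma_finite (radon_sigma_finite rnu)).
pose Mnu := isSigmaFinite.Build _ _ _ (Measure.sort nu) (radon_sigma_finite rnu).
pose nu' := HB.pack_for (SigmaFiniteMeasure.type (Rn R n) R) (Measure.sort nu) Snu Mnu.
exact: (@measurable_fun_fubini_tonelli_F _ _ _ _ R nu' f mf f0).
Qed.

Lemma measurable_weighted_integral (nu : RM) (f : Rn R n -> \bar R)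
    (K : Rn R n * Rn R n -> \bar R) :
  radon nu -> measurable_fun [set: _] K -> (forall p, 0 <= K p) ->
  measurable_fun [set: Rn R n] f -> (forall w, 0 <= f w) ->
  measurable_fun [set: Rn R n] (fun z => \int[nu]_w (f w * K (z, w))).
Proof.
move=> rnu mK K0 mf f0.
apply: (measurable_integral_radon (f := fun p => f p.2 * K p) rnu).
  by apply: emeasurable_funM => //; exact: measurableT_comp mf measurable_snd.
by move=> p; exact: mule_ge0.
Qed.

Lemma tonelli_weighted (mu nu : RM) (f : Rn R n -> \bar R)
    (K : Rn R n * Rn R n -> \bar R) :
  radon mu -> radon nu -> measurable_fun [set: _] K -> (forall p, 0 <= K p) ->
  measurable_fun [set: Rn R n] f -> (forall w, 0 <= f w) ->
  \int[mu]_z \int[nu]_w (f w * K (z, w)) = \int[nu]_w (f w * \int[mu]_z K (z, w)).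
Proof.
move=> rmu rnu mK K0 mf f0.
have mF : measurable_fun [set: _] (fun p : Rn R n * Rn R n => f p.2 * K p).
  by apply: emeasurable_funM => //; exact: measurableT_comp mf measurable_snd.
rewrite (tonelli_radon (f := fun p => f p.2 * K p) rmu rnu mF); last first.
  by move=> p; exact: mule_ge0.
apply: eq_integral => w _.
apply: (@ge0_integral_RnZl mu (f w) (fun z => K (z, w))) => //.
exact: measurable_fun_pair1.
Qed.

Lemma radon_restrict (mu : RM) F (mF : measurable F) : radon mu -> radon (restrict_meas mu mF).
Proof.
move=> rmu K cK.
have mK : measurable (K : set (Rn R n)).
  apply: closed_measurable_Rn; apply: compact_closed cK.
  exact: norm_hausdorff.
apply: (@le_lt_trans _ _ (mu K)); last exact: rmu.
rewrite restrict_measE le_measure ?inE //; exact: measurableI.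
Qed.

Lemma radon_add (mu nu : RM) : radon mu -> radon nu -> radon (add_meas mu nu).
Proof.
move=> rmu rnu K cK; rewrite /add_meas [X in X < _]measure_addE lte_add_pinfty //.
  exact: rmu.
exact: rnu.
Qed.

Lemma radon_scale c (mu : RM) : radon mu -> radon (scale_meas c mu).
Proof.
move=> rmu K cK; rewrite /scale_meas /mscale /= lte_mul_pinfty // ?lee_fin //.
exact: rmu.
Qed.

Lemma radon_finite (mu : RM) : mu [set: Rn R n] < +oo -> radon mu.
Proof.
move=> fmu K cK.
have mK : measurable (K : set (Rn R n)).
  apply: closed_measurable_Rn; apply: compact_closed cK.
  exact: norm_hausdorff.
by apply: le_lt_trans fmu; rewrite le_measure ?inE.
Qed.

Lemma ereal_between (a b : \bar R) : a < b -> exists c, a < c < b.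
Proof.
case: a => [a| |]; case: b => [b| |] //=; rewrite ?ltxx //.
- rewrite lte_fin => ab; exists ((a + b) / 2)%:E.
  by rewrite !lte_fin midf_lt // midf_lt.
- by move=> _; exists (a + 1)%:E; rewrite lte_fin ltrDl ltr01 ltry.
- by move=> _; exists (b - 1)%:E; rewrite lte_fin gtrDl ltrN10 ltNyr.
- by move=> _; exists 0; rewrite ltNy0 lt0y.
Qed.

(* Fatou's lemma along a sequence violating the conclusion. *)
Lemma lsc_integral (mu : RM) (f : pt -> Rn R n -> \bar R) x0 :
  (forall x, measurable_fun [set: Rn R n] (f x)) -> (forall x z, 0 <= f x z) ->
  (forall z c, c < f x0 z -> exists2 r : R, (0 < r)%R &
     forall x, (edist x0 x < r)%R -> c < f x z) ->
  forall c, c < \int[mu]_z f x0 z -> exists2 r : R, (0 < r)%R &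
     forall x, (edist x0 x < r)%R -> c < \int[mu]_z f x z.
Proof.
move=> mf f0 lf c cf; apply: contrapT => H.
have /choice[xs Hxs] j : exists x, (edist x0 x < j.+1%:R^-1)%R /\ \int[mu]_z f x z <= c.
  apply: contrapT => Hj; apply: H; exists (j.+1%:R^-1)%R; first by rewrite invr_gt0 ltr0Sn.
  move=> x xx0; rewrite ltNge; apply/negP => xc; apply: Hj; exists x; split => //.
have lim_sup (u : (\bar R)^nat) : limn_einf u = ereal_sup (range (einfs u)).
  by rewrite limn_einf_lim; apply/cvg_lim => //; exact: cvg_einfs_sup.
have F := fatou mu measurableT (fun j => mf (xs j)) (fun j z _ => f0 (xs j) z).
suff : \int[mu]_z f x0 z <= c by rewrite leNgt cf.
apply: (@le_trans _ _ (\int[mu]_z limn_einf (fun j => f (xs j) z))).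
  apply: ge0_le_integral => //.
    apply: measurableT_comp => //; apply: measurable_fun_limn_esup => j.
    exact: measurableT_comp (mf (xs j)).
  move=> z _; rewrite leNgt; apply/negP => hz.
  have [c' /andP[c1 c2]] := ereal_between hz.
  have [r r0 Hr] := lf z _ c2.
  pose N := (Num.truncn r^-1).+1.
  have : c' <= einfs (fun j => f (xs j) z) N.
    apply: le_ereal_inf_tmp => _ [j /= Nj <-]; apply/ltW/Hr.
    apply: (lt_trans (Hxs j).1); rewrite -[r]invrK ltf_pV2 ?posrE ?invr_gt0 ?ltr0Sn //.
    by rewrite (lt_le_trans (truncnS_gt _)) // ler_nat ltnW.
  move=> /(lt_le_trans c1); rewrite lim_sup ltNge => /negP; apply.
  by apply: ereal_sup_ubound; exists N.
apply: (le_trans F); rewrite lim_sup; apply: ge_ereal_sup => _ [N _ <-].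
apply: (@le_trans _ _ (\int[mu]_z f (xs N) z)); last exact: (Hxs N).2.
by apply: ereal_inf_lbound; exists N => /=.
Qed.

End MeasuresOnRn.

(** * Locally null sets, supports, near projections *)

Section NullSets.
Variables (R : realType) (n : nat).
Local Notation RM := (@RMeasure R n).
Local Notation pt := (pt R n).

(** Finite subcovers in the form of an induction on sets; it is applied both to negligibility and to
    the existence of maxima. *)
Lemma compact_covering_ind (K : set pt) (P : set pt -> Prop) : compact K ->
  P set0 -> (forall A B, P A -> P B -> P (A `|` B)) ->
  (forall A B, A `<=` B -> P B -> P A) ->
  (forall x, K x -> exists2 r : R, 0 < r & P [set y | edist x y < r]) -> P K.
Proof.
move=> cK P0 PU Psub H.
have /choice[r Hr] x : exists r : R, K x -> 0 < r /\ P [set y | edist x y < r].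
  by have [/H[r r0 Hr]|nK] := pselect (K x); [exists r|exists 0].
rewrite compact_cover in cK.
have [|x Kx|D DK Kcov] := cK pt K (fun x => [set y | edist x y < r x]).
- by move=> x _; exact: open_eball.
- by exists x => //=; rewrite edistxx; have [] := Hr x Kx.
apply: (Psub _ _ Kcov); rewrite /cover bigcup_seq.
have {}DK x : x \in finmap.enum_fset D -> K x by move=> /DK; rewrite inE.
elim: (finmap.enum_fset D) DK => [_|x s IH sK]; first by rewrite big_nil.
rewrite big_cons; apply: PU; first exact: (Hr x (sK x (mem_head _ _))).2.
by apply: IH => y ys; apply: sK; rewrite in_cons ys orbT.
Qed.

Lemma compact_locally_null (mu : RM) (K : set pt) : compact K ->
  (forall x, K x -> exists2 r : R, 0 < r & mu [set y | edist x y < r] = 0%E) ->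
  mu K = 0%E.
Proof.
move=> cK H.
have mK : measurable (K : set (Rn R n)).
  by apply: closed_measurable_Rn; apply: compact_closed cK; exact: norm_hausdorff.
apply/(negligibleP mu mK).
apply: (compact_covering_ind (P := fun A : set (Rn R n) => mu.-negligible A) cK) => [|A B|A B|x Kx].
- exact: negligible_set0.
- exact: negligibleU.
- by move=> AB; apply: negligibleS.
have [r r0 Hr] := H x Kx; exists r => //; apply/negligibleP => //.
exact: measurable_eball.
Qed.

Lemma open_locally_null (mu : RM) (O : set pt) : open O ->
  (forall x, O x -> exists2 r : R, 0 < r & mu [set y | edist x y < r] = 0%E) ->
  mu O = 0%E.
Proof.
move=> oO H; pose F w (j : nat) := [set y : pt | edist w y < j.+1%:R^-1].
(* Compact exhaustion of [O]: points of the ball of radius [j] at distance at least [1 / (j + 1)]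
   from the complement, written as the complement of a union of open balls so that closedness is
   immediate. *)
pose C (j : nat) := [set y : pt | edist (0 : pt) y <= j%:R] `&` ~` \bigcup_(w in ~` O) F w j.
have OE : O = \bigcup_j C j.
  apply/seteqP; split => x.
    move=> Ox; have [r r0 Hr] := (open_edistP O).1 oO x Ox.
    pose j := maxn (Num.truncn (edist 0 x)).+1 (Num.truncn r^-1).+1.
    exists j => //; split => /=.
      by rewrite ltW // (lt_le_trans (truncnS_gt _)) // ler_nat leq_maxl.
    move=> [w Ow]; rewrite /F /= => wx; apply: Ow; apply: Hr; rewrite edistC.
    apply: (lt_trans wx); rewrite -[r]invrK ltf_pV2 ?posrE ?invr_gt0 ?ltr0Sn //.
    by rewrite (lt_le_trans (truncnS_gt _)) // ler_nat ltnW // ltnS leq_maxr.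
  move=> [j _ [_ Hj]]; apply: contrapT => nO; apply: Hj; exists x => //.
  by rewrite /F /= edistxx invr_gt0 ltr0Sn.
have cC j : compact (C j).
  apply: (subclosed_compact _ (@compact_ecball R n 0 j%:R)); last by move=> x [].
  apply: closedI; first exact: closed_ecball.
  by apply: open_closedC; apply: bigcup_open => w _; exact: open_eball.
have mC j : measurable (C j : set (Rn R n)).
  by apply: closed_measurable_Rn; apply: compact_closed (cC j); exact: norm_hausdorff.
rewrite OE; apply/(negligibleP mu) => /=; first exact: bigcupT_measurable.
apply: negligible_bigcup => j; apply/(negligibleP mu (mC j)).
apply: compact_locally_null (cC j) _ => x Cx; apply: H; rewrite OE; exists j => //.
Qed.

Lemma msupport_compl_null (mu : RM) : mu (~` msupport mu) = 0%E.
Proof.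
have H x : (~` msupport mu) x -> exists2 r : R, 0 < r & mu [set y | edist x y < r] = 0%E.
  move=> /existsNP[U /not_implyP[oU /not_implyP[Ux nU]]].
  have [r r0 Hr] := (open_edistP U).1 oU x Ux; exists r => //.
  have U0 : mu U = 0%E.
    by apply/eqP; rewrite eq_le measure_ge0 andbT leNgt; apply/negP.
  apply: subset_measure0 U0 => //; [exact: measurable_eball|exact: open_measurable_Rn].
apply: open_locally_null => //; apply/open_edistP => x /H[r r0 Hr].
exists r => // y xy Sy; have := Sy _ (@open_eball R n x r) xy.
by rewrite Hr ltxx.
Qed.

Lemma msupport_closed (mu : RM) : closed (msupport mu).
Proof.
move=> x cx U oU Ux; have [y [Sy Uy]] := cx U (open_nbhs_nbhs (conj oU Ux)).
exact: Sy.
Qed.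

Lemma not_msupport_null (mu : RM) x : ~ msupport mu x ->
  exists2 r : R, 0 < r & mu [set y | edist x y < r] = 0%E.
Proof.
move=> nx; have /open_edistP : open (~` msupport mu) by exact/closed_openC/msupport_closed.
move=> /(_ x nx)[r r0 Hr]; exists r => //.
apply: subset_measure0 (msupport_compl_null mu) => //; first exact: measurable_eball.
by apply: measurableC; apply: closed_measurable_Rn; exact: msupport_closed.
Qed.

(** A point of [F] at less than twice the infimal distance suffices: [3] is this [2] plus the
    distance from [x] to [z]. It is the source of every factor 3^s below. *)
Lemma near_projection (F : set pt) x : closed F -> F !=set0 ->
  exists2 x', F x' & forall z, F z -> edist x' z <= 3 * edist x z.
Proof.
move=> cF [f Ff]; have [Fx|nFx] := pselect (F x).
  by exists x => // z _; rewrite ler_peMl ?edist_ge0 // ler1n.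
pose D := [set edist x z | z in F].
have D0 : D !=set0 by exists (edist x f), f.
have Dlb : has_lbound D by exists 0 => _ [z _ <-]; exact: edist_ge0.
have hD : has_inf D by split.
have /open_edistP/(_ _ nFx)[r r0 Hr] : open (~` F) by exact: closed_openC.
have rD : r <= inf D.
  by apply: lb_le_inf => // _ [z Fz <-]; rewrite leNgt; apply/negP => /Hr; apply.
have inf0 := lt_le_trans r0 rD.
have [_ [x' Fx' <-] hx'] := inf_adherent inf0 hD.
exists x' => // z Fz; have dz : inf D <= edist x z by apply: ge_inf => //; exists z.
by have := edist_triangle x x' z; rewrite (edistC x' x); move: hx' dz; lra.
Qed.

End NullSets.

(** * Elementary bounds for potentials; sets of capacity zero *)

Section Potentials.
Variables (R : realType) (n : nat) (alpha : R).
Hypothesis aln : alpha < n%:R.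
Local Notation RM := (@RMeasure R n).
Local Notation pt := (pt R n).
Local Notation k := (kappa alpha).
Local Notation pot := (pot alpha).
Local Notation s := (n%:R - alpha).
Implicit Types (mu nu : RM) (x y : pt).
Local Open Scope ereal_scope.

Lemma pot_ge0 mu x : 0 <= pot mu x.
Proof. by apply: integral_ge0 => z _; exact: kappa_ge0. Qed.

Lemma pot_restrict mu F (mF : measurable F) x :
  pot (restrict_meas mu mF) x = \int[mu]_(z in F) k x z.
Proof.
by rewrite /Defs.pot integral_restrict_meas //; [exact: measurable_kappa|exact: kappa_ge0].
Qed.

Lemma pot_restrictC mu F (mF : measurable F) x :
  pot mu x = pot (restrict_meas mu mF) x + pot (restrict_meas mu (measurableC mF)) x.
Proof.
by apply: integral_restrict_measC; [exact: measurable_kappa|exact: kappa_ge0].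
Qed.

Lemma pot_restrict_le mu F (mF : measurable F) x : pot (restrict_meas mu mF) x <= pot mu x.
Proof. by rewrite (pot_restrictC mu mF) leeDl // pot_ge0. Qed.

Lemma pot_restrict_sub mu F G (mF : measurable F) (mG : measurable G) x :
  F `<=` G -> pot (restrict_meas mu mF) x <= pot (restrict_meas mu mG) x.
Proof.
move=> FG; rewrite !pot_restrict; apply: ge0_subset_integral => //.
  by apply: measurable_funTS; exact: measurable_kappa.
by move=> z _; exact: kappa_ge0.
Qed.

Lemma pot_add mu nu x : pot (add_meas mu nu) x = pot mu x + pot nu x.
Proof.
rewrite /Defs.pot /add_meas; apply: ge0_integral_measure_add => //.
  by move=> z _; exact: kappa_ge0.
exact: measurable_kappa.
Qed.

Lemma pot_scale c mu x : pot (scale_meas c mu) x = c%:num%:E * pot mu x.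
Proof.
rewrite /Defs.pot /scale_meas; apply: ge0_integral_mscale => //.
  exact: measurable_kappa.
by move=> z _; exact: kappa_ge0.
Qed.

Lemma pot_dirac y x : pot (dirac_pt y) x = k x y.
Proof.
rewrite /Defs.pot /dirac_pt integral_dirac //; last exact: measurable_kappa.
by rewrite diracT mul1e.
Qed.

Lemma pot_lsc mu x c : c < pot mu x ->
  exists2 r : R, (0 < r)%R & forall x', (edist x x' < r)%R -> c < pot mu x'.
Proof.
move=> cx; apply: (lsc_integral (f := fun x z => k x z)) cx => [z|z w|z c'].
- exact: measurable_kappa.
- exact: kappa_ge0.
- exact: kappa_lsc.
Qed.

Lemma open_pot_gt mu c : open [set x | c < pot mu x].
Proof. by apply/open_edistP => x /= /pot_lsc. Qed.

Lemma closed_pot_le mu c : closed [set x | pot mu x <= c].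
Proof.
rewrite -(setCK [set x | _]); apply: open_closedC.
rewrite (_ : ~` _ = [set x | c < pot mu x]); first exact: open_pot_gt.
by apply/seteqP; split => x /=; rewrite ltNge => /negP.
Qed.

Lemma measurable_pot mu : radon mu -> measurable_fun [set: Rn R n] (pot mu : Rn R n -> \bar R).
Proof.
move=> rmu.
apply: (measurable_integral_radon (f := fun p : Rn R n * Rn R n => k p.1 p.2)) => //.
  exact: measurable_kappa2.
by move=> p; exact: kappa_ge0.
Qed.

Lemma pot_tonelli mu nu : radon mu -> radon nu ->
  \int[mu]_x pot nu x = \int[nu]_x pot mu x.
Proof.
move=> rmu rnu.
have T := @tonelli_radon R n mu nu (fun p : Rn R n * Rn R n => k p.1 p.2) rmu rnu
  (@measurable_kappa2 R n alpha) (fun p => @kappa_ge0 R n alpha p.1 p.2).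
apply: (etrans T); apply: eq_integral => y _; apply: eq_integral => x _; exact: kappaC.
Qed.

Lemma measurable_kappaZ (c : \bar R) x :
  measurable_fun [set: Rn R n] (fun z : Rn R n => c * k x z).
Proof. by apply: emeasurable_funM; [exact: measurable_cst|exact: measurable_kappa]. Qed.

Lemma pot_le_pot mu F x p (a : R) : measurable (F : set (Rn R n)) -> mu (~` F) = 0 -> (0 < a)%R ->
  (forall w, F w -> (edist p w <= a * edist x w)%R) ->
  pot mu x <= (a `^ s)%:E * pot mu p.
Proof.
move=> mF F0 a0 H; have c0 : 0 <= (a `^ s)%:E by rewrite lee_fin powR_ge0.
rewrite /Defs.pot -ge0_integralZl //; last 2 first.
- exact: measurable_kappa.
- by move=> z _; exact: kappa_ge0.
apply: (integral_null_compl mF F0); [exact: measurable_kappa|exact: measurable_kappaZ| | |].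
- by move=> z; exact: kappa_ge0.
- by move=> z; rewrite mule_ge0 // kappa_ge0.
- by move=> w Fw; apply: kappa_le_dist => //; exact: H.
Qed.

Lemma pot_far_ub mu F x (r : R) : measurable (F : set (Rn R n)) -> mu (~` F) = 0 -> (0 < r)%R ->
  (forall w, F w -> (r <= edist x w)%R) -> pot mu x <= (r `^ (alpha - n%:R))%:E * mu [set: Rn R n].
Proof.
move=> mF F0 r0 H; rewrite -integral_cst //.
apply: (integral_null_compl mF F0) => //; first exact: measurable_kappa.
- by move=> z; exact: kappa_ge0.
- by move=> z; rewrite /= lee_fin powR_ge0.
- by move=> w Fw; apply: kappa_ub => //; exact: H.
Qed.

Lemma pot_near_lb mu F x (r : R) : measurable (F : set (Rn R n)) -> mu (~` F) = 0 -> (0 < r)%R ->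
  (forall w, F w -> (edist x w <= r)%R) -> (r `^ (alpha - n%:R))%:E * mu [set: Rn R n] <= pot mu x.
Proof.
move=> mF F0 r0 H; rewrite -integral_cst //.
apply: (integral_null_compl mF F0) => //; first exact: measurable_kappa.
- by move=> z; rewrite /= lee_fin powR_ge0.
- by move=> z; exact: kappa_ge0.
- by move=> w Fw; apply: kappa_lb => //; exact: H.
Qed.

Lemma restrict_compl_null mu F (mF : measurable F) : restrict_meas mu mF (~` F) = 0.
Proof. by rewrite restrict_measE setICl measure0. Qed.

Lemma Mplus_restrict mu F (mF : measurable F) : Mplus alpha mu -> Mplus alpha (restrict_meas mu mF).
Proof.
move=> [rmu [x px]]; split; first exact: radon_restrict.
by exists x; apply: le_lt_trans (pot_restrict_le _ _ _) px.
Qed.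

Lemma pot_lty_off_mass mu x (r : R) : Mplus alpha mu -> (0 < r)%R ->
  mu [set y | (edist x y < r)%R] = 0 -> pot mu x < +oo.
Proof.
move=> [rmu [p pp]] r0 m0.
have mB := @measurable_eball R n x r.
apply: (@le_lt_trans _ _ (((1 + edist p x / r) `^ s)%:E * pot mu p)); last first.
  by rewrite lte_mul_pinfty // lee_fin powR_ge0.
apply: (pot_le_pot (measurableC mB)); first by rewrite setCK.
  by rewrite ltr_pwDl // divr_ge0 ?edist_ge0 // ltW.
move=> w /= /negP; rewrite -leNgt => rw.
rewrite mulrDl mul1r addrC (le_trans (edist_triangle x _ _)) // lerD2r.
by rewrite -mulrA ler_peMr ?edist_ge0 // ler_pdivlMl // mulr1.
Qed.

(** Moving [x] to its near projection on [F] at most triples the distances to the mass, hence costs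
    a factor 3^s. *)
Lemma weak_maximum_principle mu F (M : \bar R) : closed F -> mu (~` F) = 0 -> 0 <= M ->
  (forall x, F x -> pot mu x <= M) -> forall x, pot mu x <= (3 `^ s)%:E * M.
Proof.
move=> cF F0 M0 H x; have mF : measurable (F : set (Rn R n)) by exact: closed_measurable_Rn.
have c0 : 0 <= (3 `^ s)%:E :> \bar R by rewrite lee_fin powR_ge0.
have [FE|/set0P Fn0] := eqVneq F set0.
  rewrite (_ : pot mu x = 0) ?mule_ge0 //.
  apply: null_set_integral => //; first exact: measurable_kappa.
  by move: F0; rewrite FE setC0.
have [x' Fx' Hx'] := near_projection x cF Fn0.
apply: (le_trans (pot_le_pot mF F0 _ Hx')) => //.
by rewrite lee_wpmul2l // H.
Qed.

Lemma pot_eq0 mu x : radon mu -> pot mu x = 0 -> mu [set: Rn R n] = 0.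
Proof.
move=> rmu p0; rewrite -(bigcup_ecball x).
have mB j := @measurable_ecball R n x j%:R.
apply/(negligibleP mu) => /=; first exact: bigcupT_measurable.
apply: negligible_bigcup => j; apply/(negligibleP mu (mB j)).
have [] := eqVneq (mu [set y : Rn R n | (edist x y <= j%:R)%R]) 0 => // m0.
have : (j.+1%:R `^ (alpha - n%:R))%:E * mu [set y : Rn R n | (edist x y <= j%:R)%R] <= 0.
  rewrite -p0; apply: le_trans (pot_restrict_le _ (mB j) _).
  have := @pot_near_lb (restrict_meas mu (mB j)) _ x j.+1%:R (mB j) (restrict_compl_null _ _).
  rewrite restrict_measE setTI; apply; first by rewrite ltr0Sn.
  by move=> w /= /le_trans; apply; rewrite ler_nat.
rewrite leNgt => /negP; case; apply: mule_gt0; first by rewrite lte_fin powR_gt0 // ltr0Sn.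
by rewrite lt_neqAle eq_sym m0 measure_ge0.
Qed.

(** A unit measure of finite energy makes the infimum finite, and then [cap] is [+oo] or a nonzero
    inverse; so the capacity vanishes only when the infimum runs over the empty set. *)
Lemma cap_eq0P (E : set pt) :
  cap alpha E = 0 <-> forall mu, Eplus alpha E mu -> mu [set: Rn R n] <> 1.
Proof.
rewrite /cap; set i := ereal_inf _; split => [h mu Emu mu1|h]; last first.
  rewrite (_ : i = +oo) // /i (_ : [set _ | _ in _] = set0) ?ereal_inf0 //.
  by apply/seteqP; split => // y [mu [Emu mu1] _]; exact: (h mu Emu mu1).
have i_lty : i < +oo.
  apply: (@le_lt_trans _ _ (energy alpha mu)); last exact: Emu.2.1.
  by apply: ereal_inf_lbound; exists mu.
have i0 : 0 <= i.
  apply: le_ereal_inf_tmp => _ [nu _ <-].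
  by apply: integral_ge0 => z _; exact: pot_ge0.
move: h; rewrite lt_eqF //; case: ifPn => // i_neq0 /eqP.
rewrite eqe invr_eq0 fine_eq0 ?(negbTE i_neq0) //.
by rewrite ge0_fin_numE.
Qed.

Lemma Eplus_normalize mu (E G : set pt) (M : R) : radon mu ->
  (forall x, pot mu x <= M%:E) -> measurable (G : set (Rn R n)) -> G `<=` E ->
  mu G < +oo -> mu G != 0 -> exists2 nu, Eplus alpha E nu & nu [set: Rn R n] = 1.
Proof.
move=> rmu HM mG GE Goo G0.
have G_fin : mu G \is a fin_num by rewrite ge0_fin_numE.
have g_gt0 : (0 < fine (mu G))%R.
  by rewrite fine_gt0 // Goo andbT lt_neqAle eq_sym G0 measure_ge0.
have c0 : (0 <= (fine (mu G))^-1)%R by rewrite invr_ge0 ltW.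
pose nu := scale_meas (NngNum c0) (restrict_meas mu mG).
have potnu x : pot nu x <= ((fine (mu G))^-1 * M)%:E.
  rewrite pot_scale EFinM lee_wpmul2l //.
  exact: le_trans (pot_restrict_le _ _ _) (HM x).
have nuT : nu [set: Rn R n] = 1.
  rewrite (_ : nu [set: Rn R n] = (fine (mu G))^-1%:E * mu (setT `&` G)) // setTI.
  by rewrite -[X in _ * X](fineK G_fin) -EFinM mulVf // gt_eqF.
exists nu => //; split; [split|split].
- exact/radon_scale/radon_restrict.
- by exists 0%R; apply: le_lt_trans (potnu _) (ltry _).
- apply: (@le_lt_trans _ _ (((fine (mu G))^-1 * M)%:E * nu [set: Rn R n])); last first.
    by rewrite nuT mule1 ltry.
  rewrite -integral_cst //; apply: ge0_le_integral => //.
    by move=> x _; exact: pot_ge0.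
    by apply: measurable_pot; exact/radon_scale/radon_restrict.
  by move=> x _; exact: potnu.
- exists (~` G : set (Rn R n)); split; first exact: measurableC.
    rewrite (_ : nu (~` G) = (fine (mu G))^-1%:E * mu (~` G `&` G)) //.
    by rewrite setICl measure0 mule0.
  by move=> y Ey Gy; apply: Ey; exact: GE.
Qed.

(** The passage from nearly everywhere to almost everywhere: otherwise the normalised restriction to
    [G] would be a unit measure of finite energy on [E]. The set [E] is arbitrary, so the statement
    is about its measurable subsets. *)
Lemma cap0_null mu (E G : set pt) (M : R) : cap alpha E = 0 -> radon mu ->
  (forall x, pot mu x <= M%:E) -> measurable (G : set (Rn R n)) -> G `<=` E ->
  mu G < +oo -> mu G = 0.
Proof.
move=> /cap_eq0P cE rmu HM mG GE Goo; have [//|G0] := eqVneq (mu G) 0.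
by have [nu /cE] := Eplus_normalize rmu HM mG GE Goo G0.
Qed.

Lemma cap0_sub (E F : set pt) : E `<=` F -> cap alpha F = 0 -> cap alpha E = 0.
Proof.
move=> EF /cap_eq0P cF; apply/cap_eq0P => mu [Mmu [emu cmu]].
apply: cF; split => //; split => //; apply: negligibleS cmu.
by move=> y Fy Ey; apply: Fy; exact: EF.
Qed.

End Potentials.

(** * A potential near a point where it is finite or below [1] *)

Section Thinness.
Variables (R : realType) (n : nat) (alpha : R).
Hypothesis aln : alpha < n%:R.
Local Notation RM := (@RMeasure R n).
Local Notation pt := (pt R n).
Local Notation k := (kappa alpha).
Local Notation pot := (pot alpha).
Local Notation s := (n%:R - alpha).
Implicit Types (mu nu : RM) (x y : pt).
Local Open Scope ereal_scope.

Lemma pot_lty_atomless nu x : pot nu x < +oo -> nu [set x] = 0.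
Proof.
move=> px; have m1 := measurable_set1_Rn x.
have [//|nx] := eqVneq (nu [set x]) 0.
suff : +oo <= pot nu x by rewrite leNgt px.
have -> : +oo = +oo * nu [set x] by rewrite gt0_mulye // lt_neqAle eq_sym nx measure_ge0.
rewrite -integral_cst //; apply: (@le_trans _ _ (\int[nu]_(z in [set x]) k x z)).
  apply: (@ge0_le_integral _ _ R nu [set x] m1 (cst +oo) (k x)) => [z _|||z ->].
  - exact: leey.
  - exact: measurable_cst.
  - by apply: measurable_funTS; exact: measurable_kappa.
  - by rewrite kappaxx.
by rewrite -pot_restrict; exact: pot_restrict_le.
Qed.

(** Monotone convergence over the complements of shrinking balls; the limit misses only the pole
    [x], which carries no mass because the potential there is finite. *)
Lemma pot_near_small nu x (e r0 : R) : pot nu x < +oo -> (0 < e)%R -> (0 < r0)%R ->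
  exists2 r : R, (0 < r <= r0)%R & pot (restrict_meas nu (measurable_eball x r)) x <= e%:E.
Proof.
move=> px e0 r00.
have nx := pot_lty_atomless px.
have m1 := measurable_set1_Rn x.
pose r (j : nat) : R := (r0 / j.+1%:R)%R.
have r_gt0 j : (0 < r j)%R by rewrite divr_gt0 // ltr0Sn.
pose E j := ~` eball x (r j).
have mE j : measurable (E j) by apply: measurableC; exact: measurable_eball.
pose g j w := k x w * (\1_(E j) w)%:E.
have mg j : measurable_fun [set: Rn R n] (g j).
  apply: emeasurable_funM; first exact: measurable_kappa.
  by apply/measurable_EFinP; exact: measurable_indic.
have g0 j w : 0 <= g j w by apply: mule_ge0; [exact: kappa_ge0|rewrite lee_fin indicE ler0n].
have g_homo w : {homo g^~ w : i j / (i <= j)%N >-> i <= j}.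
  move=> i j ij; rewrite lee_wpmul2l ?kappa_ge0 // lee_fin !indicE ler_nat.
  case: (boolP (w \in E i)) => //; rewrite !inE /E /= => /negP; rewrite -leNgt => h.
  rewrite mem_set //=; apply/negP; rewrite -leNgt; apply: le_trans h.
  by rewrite ler_pM2l // lef_pV2 ?posrE ?ltr0Sn // ler_nat.
have gE w : w != x -> limn (g^~ w) = k x w.
  move=> wx; apply/cvg_lim => //.
  have d0 : (0 < edist x w)%R by rewrite edist_gt0 eq_sym.
  pose N := Num.truncn (r0 / edist x w)%R.
  apply: cvg_near_cst; exists N => // j /= Nj.
  rewrite /g indicE mem_set ?mule1 // /E /=; apply/negP; rewrite -leNgt.
  rewrite ler_pdivrMr ?ltr0Sn // mulrC -ler_pdivrMr //.
  by rewrite (le_trans (ltW (truncnS_gt _))) // ler_nat ltnS.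
have int_g : \int[nu]_w limn (g^~ w) = limn (fun j => \int[nu]_w g j w).
  by apply: monotone_convergence => // w _; exact: g_homo.
have pE : pot nu x <= \int[nu]_w limn (g^~ w).
  apply: (@integral_null_compl _ _ nu _ (k x) (fun w => limn (g^~ w)) (measurableC m1)).
  - by rewrite setCK.
  - exact: measurable_kappa.
  - apply: (@emeasurable_fun_cvg _ (Rn R n) R setT g (fun w => limn (g^~ w)) mg) => w _.
    by apply: ereal_nondecreasing_is_cvgn => i j; exact: g_homo.
  - by move=> w; exact: kappa_ge0.
  - move=> w; apply: lime_ge; last by apply: nearW.
    by apply: ereal_nondecreasing_is_cvgn => i j; exact: g_homo.
  - by move=> w /eqP wx; rewrite gE.
have p_fin : pot nu x \is a fin_num by rewrite ge0_fin_numE // pot_ge0.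
have [j Hj] : exists j, pot nu x - e%:E < \int[nu]_w g j w.
  apply: contrapT => /forallNP H.
  have : \int[nu]_w limn (g^~ w) <= pot nu x - e%:E.
    rewrite int_g; apply: lime_le.
      apply: ereal_nondecreasing_is_cvgn => i j ij.
      by apply: ge0_le_integral => // w _; exact: g_homo.
    by apply: nearW => j; rewrite leNgt; apply/negP/H.
  move=> /(le_trans pE); rewrite leNgt => /negP; apply.
  by rewrite lteBlDr // lteDl // lte_fin.
exists (r j); first by rewrite r_gt0 ler_pdivrMr ?ltr0Sn // ler_peMr ?(ltW r00) // ler1n.
have gP : \int[nu]_w g j w = pot (restrict_meas nu (mE j)) x.
  rewrite pot_restrict [RHS]integral_mkcond; apply: eq_integral => w _.
  rewrite /g patchE indicE; case: ifPn => _; first by rewrite mule1.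
  by rewrite mule0.
move: Hj; rewrite gP (pot_restrictC alpha nu (measurable_eball x (r j)) x).
have -> : pot (restrict_meas nu (measurableC (measurable_eball x (r j)))) x
        = pot (restrict_meas nu (mE j)) x by [].
have b_fin : pot (restrict_meas nu (mE j)) x \is a fin_num.
  by rewrite ge0_fin_numE ?pot_ge0 // (le_lt_trans _ px) // pot_restrict_le.
by rewrite lteBlDr // addeC lteD2lE // => /ltW.
Qed.

(** Integrating the pointwise bound gives [t] times the integral of [g] at most [C] times [t] times
    the integral of [f], plus the integral of [f * g] multiplied by [C]. The assumption
    [C * e <= c / 2] lets half of the left side absorb the first term. The intended [f], [g], [t]
    are [k x], [k z] and [k x z]. *)
Lemma integral_3G (mu : RM) (f g : Rn R n -> \bar R) (t C c e : R) :
  measurable_fun [set: Rn R n] f -> measurable_fun [set: Rn R n] g ->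
  (forall w, 0 <= f w) -> (forall w, 0 <= g w) ->
  (0 < t)%R -> (0 < C)%R -> (0 < c)%R -> (C * e <= c / 2)%R ->
  (forall w, t%:E * g w <= C%:E * (f w * (t%:E + g w))) ->
  \int[mu]_w f w <= e%:E -> c%:E <= \int[mu]_w g w ->
  t%:E <= (C * (2 / c))%:E * \int[mu]_w (f w * g w).
Proof.
move=> mf mg f0 g0 t0 C0 c0 ec G3 fe cg.
have mtf : measurable_fun [set: Rn R n] (fun w => t%:E * f w).
  by apply: emeasurable_funM => //; exact: measurable_cst.
have mtg : measurable_fun [set: Rn R n] (fun w => t%:E * g w).
  by apply: emeasurable_funM => //; exact: measurable_cst.
have mfg : measurable_fun [set: Rn R n] (fun w => f w * g w) by exact: emeasurable_funM.
have tE0 : 0 <= t%:E by rewrite lee_fin ltW.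
have CE0 : 0 <= C%:E by rewrite lee_fin ltW.
have := ge0_le_integral_RnZlD mu mtf mfg mtg.
move=> /(_ C%:E); rewrite !ge0_integral_RnZl // => H0.
have {H0} H : t%:E * \int[mu]_w g w <= C%:E * (t%:E * \int[mu]_w f w + \int[mu]_w (f w * g w)).
  apply: H0 => // w; [exact: mule_ge0|exact: mule_ge0|exact: mule_ge0|].
  apply: (le_trans (G3 w)).
  by rewrite lee_wpmul2l // ge0_muleDr // (muleC (f w) t%:E).
have : 0 <= \int[mu]_w (f w * g w) by apply: integral_ge0 => w _; exact: mule_ge0.
move: H; case: (\int[mu]_w (f w * g w)) => [j| |] //; last first.
  by move=> _ _; rewrite gt0_muley ?leey // lte_fin mulr_gt0 // divr_gt0.
move=> H _.
have {H} : (t * c)%:E <= C%:E * ((t * e)%:E + j%:E).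
  apply: le_trans (le_trans _ H) _; first by rewrite EFinM lee_wpmul2l.
  by rewrite lee_wpmul2l // leeD2r // EFinM lee_wpmul2l.
rewrite -EFinD -!EFinM !lee_fin => H.
have H2 : (t * (C * e) <= t * (c / 2))%R by rewrite ler_pM2l.
have -> : (C * (2 / c) * j = (C * j * 2) / c)%R by ring.
by rewrite ler_pdivlMr //; move: H H2; lra.
Qed.

(** Where [pot nu] is at least [c], the kernel with pole [x] is dominated by the potential of the
    measure of density [k x] with respect to [nu], whose mass [pot nu x] is small. *)
Lemma kappa_le_double_pot nu x z (c e : R) : x != z -> (0 < c)%R ->
  (2 `^ s * e <= c / 2)%R -> pot nu x <= e%:E -> c%:E <= pot nu z ->
  k x z <= (2 `^ s * (2 / c))%:E * \int[nu]_w (k x w * k z w).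
Proof.
move=> xz c0 ec px pz.
have C0 : (0 < 2 `^ s :> R)%R by rewrite powR_gt0.
have t0 : (0 < edist x z `^ (alpha - n%:R))%R by rewrite powR_gt0 // edist_gt0.
have G3 := kappa_3G aln x z; rewrite kappa_neq // in G3 *.
exact: (integral_3G (measurable_kappa alpha x) (measurable_kappa alpha z)
  (kappa_ge0 alpha x) (kappa_ge0 alpha z) t0 C0 c0 ec G3 px pz).
Qed.

(** For [z] within [r * (1 - 1/a)] of [x], distances to the mass shrink by a factor at most [a], so
    the potential grows by at most a^s, which is [1 + c]; and [c] is taken so that
    [c * pot nu x <= e]. *)
Lemma pot_usc_off_mass nu x (r e : R) : (0 < r)%R -> (0 < e)%R -> pot nu x < +oo ->
  nu (eball x r) = 0 -> exists2 d : R, (0 < d <= r)%R & forall z, (edist x z < d)%R ->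
    pot nu z <= pot nu x + e%:E.
Proof.
move=> r_gt0 e0 p_lty nuB.
have p_fin : pot nu x \is a fin_num by rewrite ge0_fin_numE // pot_ge0.
pose u := fine (pot nu x).
have uE : pot nu x = u%:E by rewrite fineK.
have u0 : (0 <= u)%R by rewrite fine_ge0 // pot_ge0.
pose c := (e / (1 + u))%R.
have c0 : (0 < c)%R by rewrite divr_gt0 // ltr_pwDl.
have s0 : (0 < s)%R by rewrite subr_gt0.
pose a := ((1 + c) `^ s^-1)%R.
have a1 : (1 < a)%R.
  have -> : 1%R = (1 `^ s^-1)%R :> R by rewrite powR1.
  apply: gt0_ltr_powR; rewrite ?invr_gt0 ?nnegrE ?ltrDl //.
  by rewrite addr_ge0 // ltW.
have a0 : (0 < a)%R by exact: lt_trans a1.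
have as_ : (a `^ s = 1 + c)%R.
  by rewrite /a -powRrM mulVf ?gt_eqF // powRr1 // addr_ge0 // ltW.
have ai : (a^-1 < 1)%R by rewrite invf_lt1.
have ai0 : (0 < a^-1)%R by rewrite invr_gt0.
exists (r * (1 - a^-1))%R.
  by rewrite mulr_gt0 ?subr_gt0 //= ler_piMr ?(ltW r_gt0) // lerBlDr lerDl ltW.
move=> z xz; have mB := measurable_eball x r.
apply: (@le_trans _ _ ((a `^ s)%:E * pot nu x)).
  apply: (pot_le_pot aln (measurableC mB) _ a0); first by rewrite setCK.
  move=> w /= /negP; rewrite -leNgt => rw.
  have tri := edist_triangle z x w.
  have : (edist x z <= (1 - a^-1) * edist x w)%R.
    apply: le_trans (ltW xz) _; rewrite mulrC ler_wpM2l // subr_ge0 ltW //.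
  rewrite mulrBl mul1r => h.
  by rewrite -ler_pdivrMl //; move: tri h; lra.
rewrite as_ uE -EFinM -EFinD lee_fin mulrDl mul1r lerD2l /c mulrAC.
by rewrite ler_pdivrMr ?ltr_pwDl // ler_pM2l // lerDr.
Qed.

(* The potential of the mass far from [x] is continuous at [x], so the jump to
   the points where [pot nu >= 1] comes from the mass near [x]. *)
Lemma thin_localization nu x : Mplus alpha nu -> pot nu x < 1 ->
  exists2 c : R, (0 < c)%R & forall e r0 : R, (0 < e)%R -> (0 < r0)%R ->
  exists r d : R, [/\ (0 < d <= r)%R, (r <= r0)%R,
    pot (restrict_meas nu (measurable_eball x r)) x <= e%:E &
    forall z, (edist x z < d)%R -> 1 <= pot nu z ->
      c%:E <= pot (restrict_meas nu (measurable_eball x r)) z].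
Proof.
move=> Mnu p1.
have p_lty : pot nu x < +oo by exact: lt_trans p1 (ltry _).
have p_fin : pot nu x \is a fin_num by rewrite ge0_fin_numE // pot_ge0.
pose u := fine (pot nu x).
have uE : pot nu x = u%:E by rewrite fineK.
have u0 : (0 <= u)%R by rewrite fine_ge0 // pot_ge0.
have u1 : (u < 1)%R by rewrite -lte_fin -uE.
(* The far part may exceed [u] by [c], which leaves [1 - (u + c) = c] for the near part. *)
pose c := ((1 - u) / 2)%R.
have c0 : (0 < c)%R by rewrite divr_gt0 // subr_gt0.
exists c => // e r0 e0 r00.
have [r /andP[r_gt0 rr0] He] := pot_near_small p_lty e0 r00.
have mB := measurable_eball x r.
have q_lty : pot (restrict_meas nu (measurableC mB)) x < +oo.
  exact: le_lt_trans (pot_restrict_le _ _ _ _) p_lty.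
have nuB : restrict_meas nu (measurableC mB) (eball x r) = 0.
  by rewrite restrict_measE setICr measure0.
have [d d0r Hd] := pot_usc_off_mass r_gt0 c0 q_lty nuB.
exists r, d; split => // z xz pz.
have {Hd} far : pot (restrict_meas nu (measurableC mB)) z <= (u + c)%:E.
  by apply: (le_trans (Hd z xz)); rewrite EFinD leeD2r // -uE pot_restrict_le.
move: pz; rewrite (pot_restrictC alpha nu mB) => pz.
have := le_trans pz (leeD2l _ far).
rewrite -leeBlDr // -EFinB; apply: le_trans; rewrite lee_fin /c; lra.
Qed.

End Thinness.

(** * Thinness expressed as an estimate for other measures *)

Section ThinEstimate.
Variables (R : realType) (n : nat) (alpha : R).
Hypothesis aln : alpha < n%:R.
Local Notation RM := (@RMeasure R n).
Local Notation pt := (pt R n).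
Local Notation k := (kappa alpha).
Local Notation pot := (pot alpha).
Local Notation s := (n%:R - alpha).
Implicit Types (mu nu : RM) (x y : pt).
Local Open Scope ereal_scope.

(** The potential at [z] of the measure with density [k x] with respect to [nu]. *)
Definition double_pot nu x z : \bar R := \int[nu]_w (k x w * k z w).

Lemma double_pot_ge0 nu x z : 0 <= double_pot nu x z.
Proof. by apply: integral_ge0 => w _; rewrite mule_ge0 // kappa_ge0. Qed.

Lemma measurable_double_pot nu x : radon nu ->
  measurable_fun [set: Rn R n] (double_pot nu x : Rn R n -> \bar R).
Proof.
move=> rnu; exact: (measurable_weighted_integral rnu (@measurable_kappa2 R n alpha)
  (fun p => kappa_ge0 alpha p.1 p.2) (measurable_kappa alpha x) (kappa_ge0 alpha x)).
Qed.

Lemma integral_double_pot mu nu x : radon mu -> radon nu ->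
  \int[mu]_z double_pot nu x z = \int[nu]_w (k x w * pot mu w).
Proof.
move=> rmu rnu; have H := tonelli_weighted rmu rnu (@measurable_kappa2 R n alpha)
  (fun p => kappa_ge0 alpha p.1 p.2) (measurable_kappa alpha x) (kappa_ge0 alpha x).
transitivity (\int[nu]_w (k x w * \int[mu]_z k z w)); first exact: H.
apply: eq_integral => w _; have -> : pot mu w = \int[mu]_z k z w; last by [].
by apply: eq_integral => z _; exact: kappaC.
Qed.

(** Let [nu1] be the part of [nu] near [x]. On the set carrying [mu], [k x] is at most a constant
    times [double_pot nu1 x]; by Tonelli the integral of the latter against [mu] is that of
    [k x w * pot mu w] against [nu1], hence at most [M * pot nu1 x], and [pot nu1 x] can be made as
    small as desired. *)
Lemma thin_estimate nu x (eta : R) : Mplus alpha nu -> pot nu x < 1 -> (0 < eta)%R ->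
  exists2 d : R, (0 < d)%R & forall mu (M : R), radon mu ->
    mu (~` eball x d) = 0 -> mu [set z | pot nu z < 1] = 0 ->
    (forall z, pot mu z <= M%:E) -> pot mu x <= (eta * M)%:E.
Proof.
move=> Mnu p1 eta0.
have [c c0 Hc] := thin_localization aln Mnu p1.
set C := (2 `^ s)%R.
have C0 : (0 < C)%R by rewrite powR_gt0.
(* The first bound permits the absorption in [kappa_le_double_pot], the second turns the final
   constant into [eta]. *)
pose e := Num.min (c / (2 * C))%R (eta * c / (2 * C))%R.
have e0 : (0 < e)%R by rewrite lt_min !divr_gt0 ?mulr_gt0.
have [r [d [/andP[d0 dr] _ He Hz]]] := Hc e 1%R e0 ltr01.
exists d => // mu M rmu muB muN HM.
have mB := measurable_eball x r.
pose nu1 := restrict_meas nu mB.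
have rnu1 : radon nu1 by apply: radon_restrict; case: Mnu.
have M0 : (0 <= M)%R by rewrite -lee_fin (le_trans (pot_ge0 alpha mu x)).
have mux : mu [set x] = 0 by apply: pot_lty_atomless (le_lt_trans (HM x) (ltry _)).
have m1 := measurable_set1_Rn x.
have mN : measurable ([set z | pot nu z < 1] : set (Rn R n)).
  rewrite -[X in measurable X]setTI; apply: emeasurable_fun_infty_o => //.
  by apply: measurable_pot; case: Mnu.
pose N := ~` eball x d `|` ([set z | pot nu z < 1] `|` [set x]) : set (Rn R n).
have mNN : measurable N.
  apply: measurableU; first by apply: measurableC; exact: measurable_eball.
  exact: measurableU.
have N0 : mu N = 0.
  apply/(negligibleP mu mNN); apply: negligibleU.
    by apply/negligibleP => //; apply: measurableC; exact: measurable_eball.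
  by apply: negligibleU; apply/negligibleP.
have K0 : (0 <= C * (2 / c))%R by rewrite mulr_ge0 ?divr_ge0 // ltW.
have ec : (C * e <= c / 2)%R.
  have : (e <= c / (2 * C))%R by rewrite ge_min lexx.
  by rewrite ler_pdivlMr ?mulr_gt0 // => h; move: h; lra.
have eeta : (C * (2 / c) * (M * e) <= eta * M)%R.
  have : (e <= eta * c / (2 * C))%R by rewrite ge_min lexx orbT.
  rewrite ler_pdivlMr ?mulr_gt0 // => h.
  have -> : (C * (2 / c) * (M * e) = (C * M * e * 2) / c)%R by ring.
  by rewrite ler_pdivrMr //; nra.
apply: (@le_trans _ _ (\int[mu]_z ((C * (2 / c))%:E * double_pot nu1 x z))).
  apply: (integral_null_compl (measurableC mNN)).
  - by rewrite setCK.
  - exact: measurable_kappa.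
  - by apply: emeasurable_funM; [exact: measurable_cst|exact: measurable_double_pot].
  - by move=> z; exact: kappa_ge0.
  - by move=> z; rewrite mule_ge0 ?lee_fin ?double_pot_ge0.
  - move=> z /not_orP[/contrapT zd /not_orP[/negP zN /eqP zx]].
    have zN' : 1 <= pot nu z by rewrite leNgt.
    rewrite eq_sym in zx.
    exact: (kappa_le_double_pot aln zx c0 ec He (Hz z zd zN')).
rewrite ge0_integral_RnZl //; last 2 first.
- exact: measurable_double_pot.
- by move=> z; exact: double_pot_ge0.
rewrite integral_double_pot //.
apply: (@le_trans _ _ ((C * (2 / c))%:E * (M%:E * pot nu1 x))).
  have ME0 : 0 <= M%:E by rewrite lee_fin.
  have EM : \int[nu1]_w (M%:E * k x w) = M%:E * pot nu1 x :=
    ge0_integral_RnZl nu1 (measurable_kappa alpha x) (kappa_ge0 alpha x) ME0.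
  rewrite lee_wpmul2l ?lee_fin //.
  apply: (@le_trans _ _ (\int[nu1]_w (M%:E * k x w))); last by rewrite EM.
  apply: ge0_le_integral_Rn.
  - by apply: emeasurable_funM; [exact: measurable_kappa|exact: measurable_pot].
  - by apply: emeasurable_funM; [exact: measurable_cst|exact: measurable_kappa].
  - by move=> w; rewrite mule_ge0 ?kappa_ge0 ?pot_ge0.
  - by move=> w; rewrite muleC lee_wpmul2r ?kappa_ge0.
apply: (@le_trans _ _ ((C * (2 / c))%:E * (M%:E * e%:E))).
  by rewrite lee_wpmul2l ?lee_fin // lee_wpmul2l ?lee_fin.
by rewrite -!EFinM lee_fin.
Qed.

End ThinEstimate.

(** * The equilibrium measure competes in its own infimum *)

Section InfimumIsCompetitor.
Variables (R : realType) (n : nat) (alpha : R).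
Hypothesis aln : alpha < n%:R.
Local Notation RM := (@RMeasure R n).
Local Notation pt := (pt R n).
Local Notation pot := (pot alpha).
Local Notation s := (n%:R - alpha).
Implicit Types (mu nu : RM) (x y : pt).
Local Open Scope ereal_scope.

(* By the weak maximum principle a bound of [pot mu] can be halved indefinitely. *)
Lemma self_improving_null mu (G : set pt) (eta M0 : R) : closed G -> radon mu ->
  mu (~` G) = 0 -> (forall z, pot mu z <= M0%:E) -> (3 `^ s * eta <= 1 / 2)%R ->
  (forall M : R, (forall z, pot mu z <= M%:E) -> forall x, G x -> pot mu x <= (eta * M)%:E) ->
  mu [set: Rn R n] = 0.
Proof.
move=> cG rmu muG HM0 Heta H.
pose S := ereal_sup (range (pot mu)).
have SM z : pot mu z <= S by apply: ereal_sup_ubound; exists z.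
have S0 : 0 <= S by apply: le_trans (SM 0%R); exact: pot_ge0.
have S_fin : S \is a fin_num.
  rewrite ge0_fin_numE //; apply: le_lt_trans (ltry M0).
  by apply: ge_ereal_sup => _ [z _ <-].
have SE := fineK S_fin; set t := fine S in SE.
have t0 : (0 <= t)%R by rewrite fine_ge0.
have {}H x : G x -> pot mu x <= (eta * t)%:E by apply: H => z; rewrite SE.
have [eta0|eta0] := leP 0%R eta; last first.
  have [Gx|G0] := pselect (exists x, G x).
    have [x Gx'] := Gx.
    have := le_trans (pot_ge0 alpha mu x) (H x Gx'); rewrite lee_fin => h.
    have tE : t = 0%R by apply/eqP; rewrite eq_le t0 andbT; nra.
    apply: (pot_eq0 aln (x := 0%R)) => //.
    by apply/eqP; rewrite eq_le pot_ge0 andbT -[0%E]/(0%R%:E) -tE SE.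
  rewrite (_ : setT = ~` G) //; apply/seteqP; split => // x _ Gx; apply: G0.
  by exists x.
have W := weak_maximum_principle aln cG muG _ H.
have : S <= (3 `^ s * (eta * t))%:E.
  by apply: ge_ereal_sup => _ [z _ <-]; rewrite EFinM; apply: W; rewrite lee_fin mulr_ge0.
rewrite -SE lee_fin => h.
have tE : t = 0%R.
  apply/eqP; rewrite eq_le t0 andbT.
  have : (3 `^ s * eta * t <= 1 / 2 * t)%R by rewrite ler_wpM2r.
  by move: h; rewrite mulrA; lra.
apply: (pot_eq0 aln (x := 0%R)) => //.
by apply/eqP; rewrite eq_le pot_ge0 andbT -[0%E]/(0%R%:E) -tE SE.
Qed.

(** Otherwise the potential would exceed every integer [j] almost everywhere, and the energy of a
    unit measure would be at least [j]. *)
Lemma Eplus_bounded_level (E : set pt) mu : Eplus alpha E mu -> mu [set: Rn R n] = 1 ->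
  exists2 M : R, (0 <= M)%R & mu [set z | pot mu z <= M%:E] != 0.
Proof.
move=> [[rmu _] [en _]] mu1; apply: contrapT => H.
have mpot := measurable_pot alpha rmu.
have {}H (j : nat) : mu [set z | pot mu z <= j%:R%:E] = 0.
  apply/eqP/negPn/negP => h; apply: H; exists j%:R => //.
have en_fin : energy alpha mu \is a fin_num.
  by rewrite ge0_fin_numE //; apply: integral_ge0 => x _; exact: pot_ge0.
pose j := (Num.truncn (fine (energy alpha mu))).+1.
have : j%:R%:E * mu [set: Rn R n] <= energy alpha mu.
  have mL : measurable ([set z | pot mu z <= j%:R%:E] : set (Rn R n)).
    by apply: closed_measurable_Rn; exact: closed_pot_le.
  rewrite -integral_cst //; apply: (integral_null_compl (measurableC mL)) => //.
  - by rewrite setCK H.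
  - by move=> x; rewrite /= lee_fin.
  - by move=> x; exact: pot_ge0.
  - by move=> x /= /negP; rewrite -ltNge => /ltW.
rewrite mu1 mule1 -[energy _ _]fineK // lee_fin leNgt => /negP; apply.
exact: truncnS_gt.
Qed.

(** If the exceptional set had positive capacity it would carry a measure [mu0] of bounded
    potential. Each exceptional point has a competitor below [1] there, and [thin_estimate] converts
    it into a property of [mu0] alone at some scale [1 / (m + 1)]. Countable additivity picks one
    scale, and on a small closed piece of [mu0] the estimate holds at every point, so the piece is
    null. *)
Lemma equilibrium_is_competitor (A : set pt) (ga : RM) : is_equilibrium alpha A ga ->
  nearly_on alpha A (fun y => 1 <= pot ga y).
Proof.
move=> [Mga gaE]; rewrite /nearly_on; set E := [set x | _].
apply/cap_eq0P => mu Emu mu1.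
have [M M0 muM] := Eplus_bounded_level Emu mu1.
have rmu : radon mu by case: Emu => [[]].
pose F0 := [set z | pot mu z <= M%:E].
have cF0 : closed F0 by exact: closed_pot_le.
have mF0 : measurable (F0 : set (Rn R n)) by exact: closed_measurable_Rn.
pose mu0 := restrict_meas mu mF0.
have rmu0 : radon mu0 by exact: radon_restrict.
have mu0M z : pot mu0 z <= (3 `^ s * M)%:E.
  rewrite EFinM; apply: (weak_maximum_principle aln cF0).
  - exact: restrict_compl_null.
  - by rewrite lee_fin.
  - by move=> x Fx; exact: le_trans (pot_restrict_le _ _ _ _) Fx.
have mu0_lty B : measurable B -> mu0 B < +oo.
  move=> mB; apply: (@le_lt_trans _ _ (mu [set: Rn R n])); last by rewrite mu1 ltry.
  by rewrite /mu0 restrict_measE le_measure ?inE //; exact: measurableI.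
have [N [mN N0 EN]] : mu.-negligible (~` E : set (Rn R n)) := Emu.2.2.
have mu0N : mu0 N = 0.
  apply/eqP; rewrite eq_le measure_ge0 andbT -N0 /mu0 restrict_measE.
  by rewrite le_measure ?inE //; exact: measurableI.
have Nc x : ~ N x -> E x by move=> Nx; apply: contrapT => Ex; apply: Nx; exact: EN.
(* The weak maximum principle loses 3^s, so this [eta] halves the supremum. *)
pose eta := (1 / (2 * 3 `^ s))%R : R.
have c3 : (0 < 3 `^ s :> R)%R by rewrite powR_gt0.
have eta0 : (0 < eta)%R by rewrite divr_gt0 // mulr_gt0.
pose K (m : nat) := [set x : pt | forall (G : set (Rn R n)) (mG : measurable G) (M' : R),
  G `<=` eball x (m.+1%:R^-1)%R -> (forall z, pot (restrict_meas mu0 mG) z <= M'%:E) ->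
  pot (restrict_meas mu0 mG) x <= (eta * M')%:E].
have EK : E `<=` \bigcup_m K m.
  move=> x [Ax /negP]; rewrite -ltNge gaE => /ereal_inf_lt[_ [nu [Mnu nuA] <-] nux].
  have [d d0 Hd] := thin_estimate aln Mnu nux eta0.
  pose m := Num.truncn d^-1; exists m => // G mG M' Gx HM'.
  apply: Hd => //; first exact: radon_restrict.
    rewrite /restrict_meas restrict_measE; apply: subset_measure0 (measure0 mu0) => //.
      apply: measurableI => //; apply: measurableC; exact: measurable_eball.
    move=> z [/= zd /Gx /= zm]; case: zd; apply: (lt_trans zm).
    by rewrite -[d]invrK ltf_pV2 ?posrE ?invr_gt0 ?ltr0Sn ?truncnS_gt.
  have mL : measurable ([set z | pot nu z < 1] : set (Rn R n)).
    rewrite -[X in measurable X]setTI; apply: emeasurable_fun_infty_o => //.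
    by apply: measurable_pot; case: Mnu.
  rewrite restrict_measE.
  (* Off [N] the measure lives on [E], hence on [A], where [pot nu < 1] only on a set of capacity
     zero. *)
  have L0 : mu0 ([set z | pot nu z < 1] `&` ~` N) = 0.
    apply: (cap0_null nuA rmu0 mu0M) => //.
    - by apply: measurableI => //; exact: measurableC.
    - move=> z [/= zL zN]; split; first exact: (Nc z zN).1.
      by apply/negP; rewrite -ltNge.
    - by apply: mu0_lty; apply: measurableI => //; exact: measurableC.
  apply/(negligibleP mu0 (measurableI _ _ mL mG)).
  have NU : mu0.-negligible ((([set z | pot nu z < 1] `&` ~` N) `|` N) : set (Rn R n)).
    apply: negligibleU; apply/negligibleP => //.
    by apply: measurableI => //; exact: measurableC.
  apply: negligibleS NU.
  by move=> z [zL _]; have [zN|zN] := pselect (N z); [right|left].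
(* [K m] has no evident measurability, so it is replaced by its closure: a violated estimate at [x]
   is violated nearby by lower semicontinuity, and half the scale leaves room to move the centre. *)
have clK m x : closure (K m) x -> forall (G : set (Rn R n)) (mG : measurable G) (M' : R),
    G `<=` eball x (m.+1%:R^-1 / 2)%R -> (forall z, pot (restrict_meas mu0 mG) z <= M'%:E) ->
    pot (restrict_meas mu0 mG) x <= (eta * M')%:E.
  move=> cx G mG M' Gx HM'; rewrite leNgt; apply/negP => h.
  have [r r0 Hr] := pot_lsc aln h.
  have m0 : (0 < m.+1%:R^-1 / 2 :> R)%R by rewrite divr_gt0 // invr_gt0 ltr0Sn.
  have rm0 : (0 < Num.min r (m.+1%:R^-1 / 2))%R by rewrite lt_min r0.
  have [y Ky] := (closure_edistP _ _).1 cx _ rm0.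
  rewrite lt_min => /andP[xyr xym].
  have := Hr y xyr; rewrite ltNge => /negP; apply; apply: Ky => // z /Gx /= xz.
  have := edist_triangle x y z; rewrite (edistC y x); move: xz xym.
  set q := (m.+1%:R^-1)%R => *; lra.
have mcK m : measurable (closure (K m) : set (Rn R n)).
  by apply: closed_measurable_Rn; exact: closed_closure.
have [m Km] : exists m, mu0 (closure (K m)) != 0.
  apply: contrapT => /forallNP H.
  move: muM; rewrite -/F0 => /negP; apply.
  have -> : mu F0 = mu0 [set: Rn R n] by rewrite /mu0 restrict_measE setTI.
  apply/eqP/(negligibleP mu0 measurableT).
  have NU : mu0.-negligible ((N `|` \bigcup_m closure (K m)) : set (Rn R n)).
    apply: negligibleU; first exact/negligibleP.
    apply: negligible_bigcup => m; apply/(negligibleP mu0 (mcK m)).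
    by apply/eqP/negPn/negP/H.
  apply: negligibleS NU => x _.
  have [Nx|/Nc/EK[m _ Kx]] := pselect (N x); [by left|right].
  by exists m => //; exact: subset_closure.
pose r := (m.+1%:R^-1 / 2)%R : R.
have r0 : (0 < r)%R by rewrite divr_gt0 // invr_gt0 ltr0Sn.
(* With radius [r / 3], two points of the piece are at distance at most [2 * r / 3], so the piece
   lies in the ball of radius [r] about each of its points. *)
have [x0 Hx0] : exists x0, mu0 (closure (K m) `&` [set y | (edist x0 y <= r / 3)%R]) != 0.
  apply: contrapT => /forallNP H; move/negP: Km; apply; apply/eqP.
  have -> : mu0 (closure (K m)) = restrict_meas mu0 (mcK m) [set: Rn R n].
    by rewrite [RHS]restrict_measE setTI.
  apply: (open_locally_null openT) => x _; exists (r / 3)%R; first by rewrite divr_gt0.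
  rewrite restrict_measE; apply/eqP/negPn/negP => /negP h; apply: (H x); apply/negP => /eqP h'.
  apply: h; apply/eqP; apply: subset_measure0 h'.
  - by apply: measurableI => //; exact: measurable_eball.
  - by apply: measurableI => //; exact: measurable_ecball.
  - by move=> y [/= /ltW].
pose G := closure (K m) `&` [set y | (edist x0 y <= r / 3)%R].
have cG : closed G by apply: closedI; [exact: closed_closure|exact: closed_ecball].
have mG : measurable (G : set (Rn R n)) by exact: closed_measurable_Rn.
move/negP: Hx0; apply; apply/eqP.
have -> : mu0 (closure (K m) `&` [set y | (edist x0 y <= r / 3)%R]) =
    restrict_meas mu0 mG [set: Rn R n] by rewrite [RHS]restrict_measE setTI.
apply: (self_improving_null cG (eta := eta) (M0 := (3 `^ s * M)%R)).
- exact: radon_restrict.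
- exact: restrict_compl_null.
- by move=> z; apply: le_trans (mu0M z); exact: pot_restrict_le.
- rewrite /eta le_eqVlt; apply/orP; left; apply/eqP; field; by rewrite gt_eqF.
- move=> M' HM' x [cx xx0]; apply: (clK m x cx) => // y [_ yx0] /=.
  have := edist_triangle x0 x y; rewrite (edistC x x0); move: xx0 yx0 => /=.
  by rewrite -/r; move: r0; lra.
Qed.

End InfimumIsCompetitor.

(** * Perturbations of the equilibrium measure *)

Section Perturbation.
Variables (R : realType) (n : nat) (alpha : R).
Hypotheses (aln : alpha < n%:R) (n_gt0 : (0 < n)%N).
Local Notation RM := (@RMeasure R n).
Local Notation pt := (pt R n).
Local Notation k := (kappa alpha).
Local Notation pot := (pot alpha).
Local Notation s := (n%:R - alpha).
Implicit Types (mu nu : RM) (x y : pt).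
Local Open Scope ereal_scope.

Lemma radon_dirac y : radon (dirac_pt y).
Proof.
apply: radon_finite; have -> : dirac_pt y [set: Rn R n] = 1 by exact: diracT.
exact: ltry.
Qed.

Lemma edist_delta x (i : 'I_n) (h : R) : edist x (x + h *: delta_mx ord0 i)%R = `|h|%R.
Proof.
rewrite /Defs.edist (bigD1 i) //= big1 => [|j ji].
  by rewrite !mxE !eqxx mulr1 addr0 opprD addrA subrr sub0r sqrrN sqrtr_sqr.
by rewrite !mxE eqxx /= (negbTE ji) mulr0 addr0 subrr expr0n.
Qed.

Lemma edist_surj x (r : R) : (0 <= r)%R -> exists y, edist x y = r.
Proof.
move=> r0; exists (x + r *: delta_mx ord0 (Ordinal n_gt0))%R.
by rewrite edist_delta ger0_norm.
Qed.

Lemma pot_le_kappa mu F x p (a : R) : measurable (F : set (Rn R n)) -> mu (~` F) = 0 ->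
  (0 < a)%R -> (forall w, F w -> (edist x p <= a * edist x w)%R) ->
  pot mu x <= (a `^ s)%:E * k x p * mu [set: Rn R n].
Proof.
move=> mF F0 a0 H; have c0 : 0 <= (a `^ s)%:E * k x p.
  by rewrite mule_ge0 ?lee_fin ?powR_ge0 ?kappa_ge0.
rewrite -integral_cst //; apply: (integral_null_compl mF F0) => //.
- exact: measurable_kappa.
- by move=> w; exact: kappa_ge0.
- by move=> w Fw; apply: kappa_le_dist => //; exact: H.
Qed.

Variables (A : set pt) (ga : RM).
Hypothesis gaE : is_equilibrium alpha A ga.

Lemma equilibrium_le nu x : Mplus alpha nu -> nearly_on alpha A (fun y => 1 <= pot nu y) ->
  pot ga x <= pot nu x.
Proof.
move=> Mnu nuA; case: gaE => _ ->; apply: ereal_inf_lbound.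
by exists nu.
Qed.

(** Since [ga] is a competitor, a modified measure has to be tested only where [pot ga >= 1], and
    there it can be compared with [ga] itself. *)
Lemma equilibrium_le_of_ge1 nu x : Mplus alpha nu ->
  (forall y, A y -> 1 <= pot ga y -> 1 <= pot nu y) -> pot ga x <= pot nu x.
Proof.
move=> Mnu H; apply: equilibrium_le => //.
apply: cap0_sub (equilibrium_is_competitor aln gaE) => y [Ay ny]; split => //.
by move=> gy; apply: ny; exact: H.
Qed.

Lemma ecball_lty mu x (r : R) : radon mu -> mu (eball x r) < +oo.
Proof.
move=> rmu; apply: le_lt_trans (radon_ecball_lty x r rmu).
rewrite le_measure ?inE //; [exact: measurable_eball|exact: measurable_ecball|].
by move=> y /= /ltW.
Qed.

(** The mass [m] of the unit ball about [y] is replaced by a point mass on the unit sphere, so the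
    potential at [y] becomes finite. In the weight 3^s (1 + m), the part with [m] compensates the
    removed mass at distance at least [2] from [y], and the part with [1] makes the potential at
    least [1] closer to [y]. *)
Lemma equilibrium_pot_lty y : pot ga y < +oo.
Proof.
have [Mga _] := gaE; have rga := Mga.1.
have [y' yy'] := edist_surj y ler01.
have mB := measurable_eball y 1%R.
have m_lty := ecball_lty y 1%R rga.
set B := eball y 1%R in mB m_lty.
have m_fin : ga B \is a fin_num by rewrite ge0_fin_numE.
pose m := fine (ga B).
have m0 : (0 <= m)%R by rewrite fine_ge0.
have c0 : (0 <= 3 `^ s * (1 + m))%R by rewrite mulr_ge0 ?powR_ge0 ?addr_ge0.
pose nu := add_meas (restrict_meas ga (measurableC mB)) (scale_meas (NngNum c0) (dirac_pt y')).
have potE x : pot nu x = pot (restrict_meas ga (measurableC mB)) x + (3 `^ s * (1 + m))%:E * k x y'.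
  by rewrite pot_add pot_scale pot_dirac.
have y_neq : y != y' by rewrite -edist_gt0 yy'.
have fin1 : pot nu y < +oo.
  rewrite potE lte_add_pinfty //.
    apply: (pot_lty_off_mass aln (Mplus_restrict _ Mga) (ltr01 : (0 < 1 :> R)%R)).
    by rewrite restrict_measE setICr measure0.
  by rewrite kappa_neq // -EFinM ltry.
apply: (le_lt_trans _ fin1); apply: equilibrium_le_of_ge1.
  split; last by exists y.
  apply: radon_add; first exact: radon_restrict.
  exact/radon_scale/radon_dirac.
have c3 : (0 < 3 `^ s :> R)%R by rewrite powR_gt0.
move=> x Ax px; rewrite potE; have [xy|xy] := leP 2%R (edist y x).
  apply: (le_trans px); rewrite (pot_restrictC alpha ga mB) addeC leeD2l //.
  have F0 := restrict_compl_null ga mB.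
  have L : pot (restrict_meas ga mB) x <=
      (3 `^ s)%:E * k x y' * restrict_meas ga mB [set: Rn R n].
    apply: (pot_le_kappa mB F0) => // w yw.
    rewrite /B /= in yw; have := edist_triangle w x y'; have := edist_triangle y w y'.
    have := edist_triangle w y x; rewrite yy' (edistC w y) (edistC w x).
    by move: xy yw; lra.
  apply: (le_trans L).
  rewrite restrict_measE setTI -[ga B](fineK m_fin) -/m.
  rewrite -muleA (muleC (k x y')) muleA -EFinM lee_wpmul2r ?kappa_ge0 // lee_fin.
  by rewrite ler_wpM2l ?(ltW c3) // lerDr.
apply: (@le_trans _ _ ((3 `^ s * (1 + m))%:E * k x y')); last by rewrite leeDr // pot_ge0.
have h : ((3 `^ (alpha - n%:R))%:E <= k x y').
  apply: kappa_lb => //; have := edist_triangle y x y'; rewrite yy' (edistC x y).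
  by move: xy; lra.
have e3 : (3 `^ s * 3 `^ (alpha - n%:R) = 1 :> R)%R.
  rewrite -powRD; last by apply/implyP => _; rewrite gt_eqF.
  by rewrite addrA subrK subrr powRr0.
have c0E : 0 <= (3 `^ s * (1 + m))%:E by rewrite lee_fin.
apply: le_trans (lee_wpmul2l c0E h).
rewrite -EFinM lee_fin -mulrA (mulrC (1 + m)%R) mulrA e3 mul1r.
by rewrite lerDl.
Qed.

(* Moving a small part of the mass near a support point [y] to a nearby point
   [y'] raises the potential far from [y] and lowers it at [y]. *)
Lemma support_perturbation y (r t : R) : msupport ga y -> (0 < r)%R -> (0 < t <= 1)%R ->
  ~ (forall x, A x -> (edist y x < r)%R -> 1 <= (1 - t)%:E * pot ga x).
Proof.
move=> Sy r0 /andP[t0 t1] H.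
have [Mga _] := gaE; have rga := Mga.1.
(* Beyond distance [r], points are at most twice as far from [y'] as from the ball of radius [rho],
   so 2^s times the removed mass suffices at [y']. At [y] this factor amounts to halving [h], and
   [rho < h / 2] makes the exchange a strict loss. *)
pose rho := (r / 16)%R; pose h := (r / 4)%R.
have rho0 : (0 < rho)%R by rewrite divr_gt0.
have h0 : (0 < h)%R by rewrite divr_gt0.
have [y' yy'] := edist_surj y (ltW h0).
have mB := measurable_eball y rho.
have m_lty := ecball_lty y rho rga.
have m_gt0 : 0 < ga (eball y rho) by apply: Sy; [exact: open_eball|rewrite /= edistxx].
set B := eball y rho in mB m_lty m_gt0.
have m_fin : ga B \is a fin_num by rewrite ge0_fin_numE.
pose m := fine (ga B).
have mE : ga B = m%:E by rewrite fineK.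
have m0 : (0 < m)%R by rewrite -lte_fin -mE.
pose C := (2 `^ s)%R : R; have C0 : (0 < C)%R by rewrite powR_gt0.
have c0 : (0 <= t * (C * m))%R by rewrite !mulr_ge0 ?(ltW t0) ?(ltW C0) ?(ltW m0).
have u0 : (0 <= 1 - t)%R by rewrite subr_ge0.
pose ga' := restrict_meas ga mB.
pose ga'' := restrict_meas ga (measurableC mB).
pose nu := add_meas ga'' (add_meas (scale_meas (NngNum u0) ga') (scale_meas (NngNum c0) (dirac_pt y'))).
have potE x : pot nu x = pot ga'' x + ((1 - t)%:E * pot ga' x + (t * (C * m))%:E * k x y').
  by rewrite !pot_add !pot_scale pot_dirac.
have gaD x : pot ga x = pot ga'' x + pot ga' x by rewrite (pot_restrictC alpha ga mB) addeC.
have fin' x : pot ga' x \is a fin_num.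
  rewrite ge0_fin_numE ?pot_ge0 //; apply: le_lt_trans (equilibrium_pot_lty x).
  exact: pot_restrict_le.
have fin'' x : pot ga'' x \is a fin_num.
  rewrite ge0_fin_numE ?pot_ge0 //; apply: le_lt_trans (equilibrium_pot_lty x).
  exact: pot_restrict_le.
have F0 := restrict_compl_null ga mB.
have y_neq : y != y' by rewrite -edist_gt0 yy'.
have Mnu : Mplus alpha nu.
  split; last first.
    exists y; rewrite potE; apply: lte_add_pinfty; first by rewrite -ge0_fin_numE ?pot_ge0.
    apply: lte_add_pinfty; last by rewrite kappa_neq // -EFinM ltry.
    by rewrite -(fineK (fin' y)) -EFinM ltry.
  apply: radon_add; first exact: radon_restrict.
  apply: radon_add; first exact/radon_scale/radon_restrict.
  exact/radon_scale/radon_dirac.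
have : pot ga y <= pot nu y.
  apply: equilibrium_le_of_ge1 => // x Ax px.
  have [xy|xy] := ltP (edist y x) r.
    apply: le_trans (H x Ax xy) _; rewrite potE gaD.
    rewrite -(fineK (fin' x)) -(fineK (fin'' x)).
    have f0 : (0 <= fine (pot ga'' x))%R by rewrite fine_ge0 // pot_ge0.
    apply: (@le_trans _ _ (fine (pot ga'' x) + (1 - t) * fine (pot ga' x))%:E).
      by rewrite -EFinD -EFinM lee_fin; nra.
    by rewrite EFinD leeD2l // EFinM leeDl // mule_ge0 ?lee_fin // kappa_ge0.
  apply: (le_trans px); rewrite potE gaD leeD2l //.
  have : pot ga' x <= C%:E * k x y' * ga' [set: Rn R n].
    apply: (pot_le_kappa mB F0) => // w yw; rewrite /B /= in yw.
    have := edist_triangle w x y'; have := edist_triangle y w y'.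
    have := edist_triangle w y x; rewrite yy' (edistC w y) (edistC w x).
    by move: xy yw r0; rewrite /rho /h; lra.
  rewrite /ga' restrict_measE setTI mE -/ga' => le'.
  rewrite -{1}[pot ga' x]mul1e.
  have -> : 1 = (1 - t)%:E + t%:E by rewrite -EFinD subrK.
  rewrite muleDl // leeD2l // EFinM -muleA.
  rewrite lee_wpmul2l ?lee_fin ?(ltW t0) //; apply: (le_trans le').
  by rewrite EFinM -!muleA (muleC (k x y')).
apply/negP; rewrite -ltNge potE gaD lteD2lE //.
have lb : (rho `^ (alpha - n%:R))%:E * m%:E <= pot ga' y.
  have := pot_near_lb aln mB F0 rho0; rewrite restrict_measE setTI mE; apply.
  by move=> w /ltW.
rewrite kappa_neq // yy' -(fineK (fin' y)) -!EFinM -EFinD lte_fin.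
rewrite -(fineK (fin' y)) -EFinM lee_fin in lb.
suff : (C * h `^ (alpha - n%:R) < rho `^ (alpha - n%:R))%R.
  move=> hh; move: lb; set p := fine _; set q1 := (h `^ _)%R => lb.
  have q1p : (C * m * q1 < p)%R.
    by rewrite mulrAC; apply: lt_le_trans lb; rewrite ltr_pM2r.
  have : (t * (C * m * q1) < t * p)%R by rewrite ltr_pM2l.
  by rewrite mulrBl mul1r -!mulrA; lra.
have -> : (C * h `^ (alpha - n%:R) = (h / 2) `^ (alpha - n%:R))%R.
  rewrite powRM ?invr_ge0 ?(ltW h0) // mulrC; congr (_ * _)%R.
  by rewrite -powR_inv1 // -powRrM mulN1r opprB.
apply: powR_lt_decr => //; first by rewrite subr_lt0.
by rewrite /rho /h; move: r0; lra.
Qed.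

Lemma equilibrium_msupport_sub : msupport ga `<=` closure A.
Proof.
move=> y Sy; apply: contrapT => nA.
have /open_edistP/(_ _ nA)[r r0 Hr] : open (~` closure A) by exact/closed_openC/closed_closure.
(* No point of [A] is near [y], so all the mass there may be moved. *)
apply: (support_perturbation (r := r) (t := 1%R) Sy r0).
  by rewrite ltr01 lexx.
by move=> x Ax xy; case: (Hr x xy); exact: subset_closure.
Qed.

Lemma equilibrium_le1_msupport y : msupport ga y -> pot ga y <= 1.
Proof.
move=> Sy; rewrite leNgt; apply/negP => h.
have [c /andP[c1 cp]] := ereal_between h.
have c_fin : c \is a fin_num.
  rewrite ge0_fin_numE ?(le_trans _ (ltW c1)) //.
  exact: lt_trans cp (equilibrium_pot_lty y).
have cE := fineK c_fin.
have c1' : (1 < fine c)%R by rewrite -lte_fin cE.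
have [r r0 Hr] := pot_lsc aln cp.
have c0 : (0 < fine c)%R by exact: lt_trans c1'.
(* Near [y] the potential exceeds [c > 1], so scaling it by [1 - t], the inverse of [c], keeps it at
   least [1]. *)
apply: (support_perturbation (r := r) (t := (1 - (fine c)^-1)%R) Sy r0).
  by rewrite subr_gt0 invf_lt1 // c1' gerBl invr_ge0 ltW.
move=> x Ax /Hr /ltW cx; rewrite opprB addrC subrK.
apply: (@le_trans _ _ ((fine c)^-1%:E * (fine c)%:E)).
  by rewrite -EFinM mulVf ?gt_eqF.
by rewrite cE; apply: lee_wpmul2l cx; rewrite lee_fin invr_ge0 ltW.
Qed.

End Perturbation.

(** * Second differences of the kernel and of potentials *)

Section KernelLaplacian.
Variables (R : realType) (n : nat) (alpha : R).
Hypothesis aln : alpha < n%:R.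
Local Notation RM := (@RMeasure R n).
Local Notation pt := (pt R n).
Local Notation k := (kappa alpha).
Local Notation pot := (pot alpha).
Local Notation s := (n%:R - alpha).
Local Notation e_ i := (delta_mx ord0 i : pt).
Implicit Types (mu nu : RM) (x y z : pt).

(** Subtracting [2 * n] times [F x] and dividing by [h^2] would give the discrete Laplacian; the
    bare sum stays meaningful for infinite values. *)
Definition shift_sum (F : pt -> \bar R) x (h : R) : \bar R :=
  (\sum_(i < n) (F (x + h *: e_ i)%R + F (x - h *: e_ i)%R))%E.

Lemma sqr_edist_shift x z (h : R) i :
  edist (x + h *: e_ i) z ^+ 2 =
  edist x z ^+ 2 + h ^+ 2 + 2 * h * (x ord0 i - z ord0 i).
Proof.
rewrite !sqr_edist (bigD1 i) //= [in RHS](bigD1 i) //= !mxE !eqxx mulr1.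
rewrite (eq_bigr (fun j => (x ord0 j - z ord0 j) ^+ 2)); first by ring.
by move=> j ji; rewrite !mxE eqxx (negbTE ji) mulr0 addr0.
Qed.

Lemma kappa_sqr x z : x != z ->
  k x z = ((edist x z ^+ 2) `^ (- (s / 2)))%:E.
Proof.
move=> xz; rewrite kappa_neq //; congr EFin.
rewrite -powR_mulrn ?edist_ge0 // -powRrM; congr (_ `^ _).
by field.
Qed.

Lemma kappa_shift_sum (e : R) : 0 < e ->
  exists2 c : R, 0 < c < 1 & forall x z (h : R), x != z -> 0 < h ->
    h ^+ 2 <= c * edist x z ^+ 2 ->
    exists2 t : R, `|t| <= e & shift_sum (k ^~ z) x h =
      ((2 * n%:R + (s * (2 - alpha) + t) * (h ^+ 2 / edist x z ^+ 2))%:E * k x z)%E.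
Proof.
move=> e0; have p0 : 0 < s / 2 by rewrite divr_gt0 // subr_gt0.
have [c c01 Hc] := discrete_laplacian n p0 e0; exists c => // x z h xz h0 hc.
have /andP[c0 c1] := c01.
pose v (i : 'I_n) := x ord0 i - z ord0 i.
have d0 : 0 < edist x z by rewrite edist_gt0.
have q0 : 0 < edist x z ^+ 2 by rewrite exprn_gt0.
have qE : \sum_i v i ^+ 2 = edist x z ^+ 2 by rewrite sqr_edist.
have hd : h < edist x z.
  rewrite -(ltr_pXn2r (n := 2)) ?nnegrE ?ltW //.
  by apply: (le_lt_trans hc); rewrite gtr_pMl.
have shift_neq i (sg : R) : `|sg| = 1 -> x + (sg * h) *: e_ i != z.
  move=> sg1; rewrite -edist_gt0; have := edist_triangle (x + (sg * h) *: e_ i) x z.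
  by rewrite edist_delta normrM sg1 mul1r (gtr0_norm h0); move: hd; lra.
have kE i (sg : R) : `|sg| = 1 -> sg ^+ 2 = 1 -> k (x + (sg * h) *: e_ i) z =
   ((edist x z ^+ 2 + h ^+ 2 + sg * (2 * h * v i)) `^ (- (s / 2)))%:E.
  move=> sg1 sg2; rewrite kappa_sqr ?shift_neq // sqr_edist_shift.
  by congr (_ `^ _)%:E; rewrite exprMn sg2 mul1r /v; ring.
have SE : shift_sum (k ^~ z) x h = (\sum_i ((edist x z ^+ 2 + h ^+ 2 + 2 * h * v i) `^ (- (s / 2))
              + (edist x z ^+ 2 + h ^+ 2 - 2 * h * v i) `^ (- (s / 2))))%:E.
  rewrite -sumEFin; apply: eq_bigr => i _.
  have := kE i 1 (normr1 _) (expr1n _ _); rewrite !mul1r => ->.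
  have := kE i (-1) _ _; rewrite !mulN1r scaleNr => ->.
  - by rewrite EFinD.
  - by rewrite normrN normr1.
  - by rewrite sqrrN expr1n.
have := Hc v h; rewrite qE => /(_ q0 hc).
rewrite SE kappa_sqr //.
set S := \sum_i _; set f := _ `^ _; set u := h ^+ 2 / _.
have f0 : 0 < f by rewrite powR_gt0.
have u0 : 0 < u by rewrite divr_gt0 // exprn_gt0.
move=> HS.
exists ((S - f * (2 * n%:R + s * (2 - alpha) * u)) / (f * u)).
  have fu0 := mulr_gt0 f0 u0.
  rewrite normrM normfV (gtr0_norm fu0) ler_pdivrMr //.
  apply: le_trans HS; rewrite le_eqVlt; apply/orP; left; apply/eqP; congr `|_|.
  by field.
by rewrite -EFinM; congr EFin; field; rewrite !gt_eqF.
Qed.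

Lemma shift_sum_ge0 (F : pt -> \bar R) x h : (forall y, 0 <= F y)%E -> (0 <= shift_sum F x h)%E.
Proof. by move=> F0; apply: sume_ge0 => i _; exact: adde_ge0. Qed.

Lemma measurable_shift_sum_kappa x h :
  measurable_fun [set: Rn R n] (fun z : Rn R n => shift_sum (k ^~ z) x h).
Proof.
apply: emeasurable_sum => i; apply: emeasurable_funD; exact: measurable_kappa.
Qed.

Lemma shift_sum_integral nu (f : pt -> Rn R n -> \bar R) x h :
  (forall y, measurable_fun [set: Rn R n] (f y)) -> (forall y z, 0 <= f y z)%E ->
  shift_sum (fun y => \int[nu]_z f y z)%E x h = (\int[nu]_z shift_sum (f ^~ z) x h)%E.
Proof.
move=> mf f0; rewrite /shift_sum ge0_integral_sum //.
- by apply: eq_bigr => i _; rewrite ge0_integral_RnD.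
- by move=> i; apply: emeasurable_funD.
- by move=> i z _; apply: adde_ge0.
Qed.

Lemma shift_sum_pot nu x h :
  shift_sum (pot nu) x h = (\int[nu]_z shift_sum (k ^~ z) x h)%E.
Proof. exact: shift_sum_integral (measurable_kappa alpha) (kappa_ge0 alpha). Qed.

Lemma shift_sum_pot_ge nu F x (h a : R) : measurable (F : set (Rn R n)) -> nu (~` F) = 0%E ->
  0 <= a -> (forall z, F z -> (a%:E * k x z <= shift_sum (k ^~ z) x h)%E) ->
  (a%:E * pot nu x <= shift_sum (pot nu) x h)%E.
Proof.
move=> mF F0 a0 H; have aE0 : (0 <= a%:E)%E by rewrite lee_fin.
have E : (\int[nu]_z (a%:E * k x z) = a%:E * pot nu x)%E :=
  ge0_integral_RnZl nu (measurable_kappa alpha x) (kappa_ge0 alpha x) aE0.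
rewrite -E shift_sum_pot; apply: (integral_null_compl mF F0) => //.
- exact: measurable_kappaZ.
- exact: measurable_shift_sum_kappa.
- by move=> z; rewrite mule_ge0 // kappa_ge0.
- by move=> z; apply: shift_sum_ge0 => y; exact: kappa_ge0.
Qed.

Hypotheses (ha2 : alpha <= 2) (n_gt0 : (0 < n)%N).

(** The main term is nonnegative as [alpha <= 2], and the error is uniform because all the mass is
    at distance at least [r]; the tolerance [e * r^2] for the kernel becomes [e] after division by
    the squared distance. *)
Lemma shift_sum_pot_off_mass nu x (r e : R) : 0 < r -> 0 < e ->
  nu [set y | edist x y < r] = 0%E ->
  exists2 h0 : R, 0 < h0 & forall h, 0 < h <= h0 ->
    0 <= 2 * n%:R - e * h ^+ 2 /\
    ((2 * n%:R - e * h ^+ 2)%:E * pot nu x <= shift_sum (pot nu) x h)%E.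
Proof.
move=> r0 e0 nuB.
have s0 : 0 <= s * (2 - alpha) by rewrite mulr_ge0 // subr_ge0 // ltW.
have er0 : 0 < e * r ^+ 2 by rewrite mulr_gt0 // exprn_gt0.
have [c /andP[c0 c1] Hc] := kappa_shift_sum er0.
have n0 : 0 <= 2 * n%:R :> R by rewrite mulr_ge0.
have n0' : 0 < 2 * n%:R :> R by rewrite mulr_gt0 // ltr0n.
pose h0 := Num.min (Num.sqrt c * r) (Num.sqrt (2 * n%:R / e)).
exists h0; first by rewrite lt_min mulr_gt0 ?sqrtr_gt0 //= divr_gt0.
move=> h /andP[h_gt0]; rewrite le_min => /andP[hc he].
have hc2 : h ^+ 2 <= c * r ^+ 2.
  rewrite -[c in c * _](sqr_sqrtr (ltW c0)) -exprMn.
  by apply: lerXn2r hc; rewrite nnegrE ?mulr_ge0 ?sqrtr_ge0 // ltW.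
have he2 : e * h ^+ 2 <= 2 * n%:R.
  rewrite mulrC -ler_pdivlMr //.
  have q0 : 0 <= 2 * n%:R / e by rewrite ltW // divr_gt0.
  rewrite -(sqr_sqrtr q0).
  by apply: lerXn2r he; rewrite nnegrE ?sqrtr_ge0 // ltW.
have a0 : 0 <= 2 * n%:R - e * h ^+ 2 by rewrite subr_ge0.
split => //; have mB := @measurable_eball R n x r.
apply: (shift_sum_pot_ge (measurableC mB)) => //; first by rewrite setCK.
move=> z /= /negP; rewrite -leNgt => rz.
have xz : x != z by rewrite -edist_gt0 (lt_le_trans r0).
have d2 : r ^+ 2 <= edist x z ^+ 2 by apply: lerXn2r rz; rewrite nnegrE ?edist_ge0 // ltW.
have [|t te ->] := Hc x z h xz h_gt0.
  by apply: (le_trans hc2); apply: ler_wpM2l d2; exact: ltW.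
apply: lee_wpmul2r; first exact: kappa_ge0.
rewrite lee_fin; set u := h ^+ 2 / _.
have u0 : 0 <= u by rewrite divr_ge0 ?sqr_ge0.
have r20 : 0 < r ^+ 2 by rewrite exprn_gt0.
have ur : u * r ^+ 2 <= h ^+ 2.
  rewrite /u mulrAC ler_pdivrMr ?(lt_le_trans r20) //.
  by rewrite ler_wpM2l ?sqr_ge0.
have tu : - (e * h ^+ 2) <= t * u.
  have : - (e * r ^+ 2) <= t by move: te; rewrite ler_norml => /andP[].
  move=> /(ler_wpM2r u0); apply: le_trans.
  rewrite mulNr lerN2 -mulrA ler_wpM2l ?(ltW e0) //.
  by rewrite mulrC.
have su : 0 <= s * (2 - alpha) * u by exact: mulr_ge0.
by rewrite mulrDl; lra.
Qed.

Lemma shift_sum_pot_restrictC nu F (mF : measurable F) x h :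
  shift_sum (pot nu) x h = (shift_sum (pot (restrict_meas nu mF)) x h
    + shift_sum (pot (restrict_meas nu (measurableC mF))) x h)%E.
Proof.
rewrite !shift_sum_pot; apply: integral_restrict_measC.
  exact: measurable_shift_sum_kappa.
by move=> z; apply: shift_sum_ge0 => y; exact: kappa_ge0.
Qed.

(** The gain decays like the inverse squared distance, so it is uniform only on a bounded piece
    [nu1] of the mass, chosen nonzero; the remaining mass contributes at least its mean value. *)
Lemma shift_sum_pot_strict nu x (r : R) : alpha < 2 -> Mplus alpha nu -> 0 < r ->
  nu [set y | edist x y < r] = 0%E -> nu [set: Rn R n] != 0%E ->
  exists2 h0 : R, 0 < h0 & forall h, 0 < h <= h0 ->
    ((2 * n%:R)%:E * pot nu x < shift_sum (pot nu) x h)%E.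
Proof.
move=> a2 Mnu r0 nuB nuT.
have s0 : 0 < s * (2 - alpha) by rewrite mulr_gt0 // subr_gt0.
have e0 : 0 < s * (2 - alpha) / 2 by rewrite divr_gt0.
have [c /andP[c0 c1] Hc] := kappa_shift_sum e0.
have mB := @measurable_eball R n x r.
have p_lty : (pot nu x < +oo)%E by exact: pot_lty_off_mass nuB.
have [j nuj] : exists j : nat, nu [set y | edist x y <= j%:R] != 0%E.
  apply: contrapT => /forallNP H; move/negP: nuT; apply; apply/eqP.
  rewrite -(bigcup_ecball x); apply/(negligibleP nu) => /=.
    by apply: bigcupT_measurable => j; exact: measurable_ecball.
  apply: negligible_bigcup => j; apply/(negligibleP nu); first exact: measurable_ecball.
  by apply/eqP/negPn/negP/H.
pose L : R := j.+1%:R; have L0 : 0 < L by rewrite ltr0Sn.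
have mL := @measurable_ecball R n x j%:R.
pose nu1 := restrict_meas nu mL; pose nu2 := restrict_meas nu (measurableC mL).
have p1_lty : (pot nu1 x < +oo)%E by apply: le_lt_trans (pot_restrict_le _ _ _ _) p_lty.
have p2_lty : (pot nu2 x < +oo)%E by apply: le_lt_trans (pot_restrict_le _ _ _ _) p_lty.
have p1_gt0 : (0 < pot nu1 x)%E.
  rewrite lt_neqAle pot_ge0 andbT eq_sym; apply/eqP => p10.
  move/negP: nuj; apply; apply/eqP.
  have := pot_eq0 aln (radon_restrict mL Mnu.1) p10.
  by rewrite restrict_measE setTI.
exists (Num.sqrt c * r); first by rewrite mulr_gt0 ?sqrtr_gt0.
move=> h /andP[h_gt0 hc].
have hc2 : h ^+ 2 <= c * r ^+ 2.
  rewrite -[c in c * _](sqr_sqrtr (ltW c0)) -exprMn.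
  by apply: lerXn2r hc; rewrite nnegrE ?mulr_ge0 ?sqrtr_ge0 // ltW.
pose dl := s * (2 - alpha) / 2 * (h ^+ 2 / L ^+ 2).
have dl0 : 0 < dl by rewrite mulr_gt0 // divr_gt0 // exprn_gt0.
have n0 : 0 <= 2 * n%:R :> R by rewrite mulr_ge0.
have coef z : r <= edist x z -> exists2 t : R,
    2 * n%:R + s * (2 - alpha) / 2 * (h ^+ 2 / edist x z ^+ 2) <= t &
    shift_sum (k ^~ z) x h = (t%:E * k x z)%E.
  move=> rz.
  have xz : x != z by rewrite -edist_gt0 (lt_le_trans r0).
  have d2 : r ^+ 2 <= edist x z ^+ 2 by apply: lerXn2r rz; rewrite nnegrE ?edist_ge0 // ltW.
  have [|t te E] := Hc x z h xz h_gt0.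
    by apply: (le_trans hc2); apply: ler_wpM2l d2; exact: ltW.
  exists (2 * n%:R + (s * (2 - alpha) + t) * (h ^+ 2 / edist x z ^+ 2)) => //.
  have u0 : 0 <= h ^+ 2 / edist x z ^+ 2 by rewrite divr_ge0 ?sqr_ge0.
  have t1 : s * (2 - alpha) / 2 <= s * (2 - alpha) + t.
    by move: te; rewrite ler_norml => /andP[h1 _]; move: h1; lra.
  by have := ler_wpM2r u0 t1; lra.
have nullC (m : RM) F (mF : measurable F) : m [set y | edist x y < r] = 0%E ->
    restrict_meas m mF (~` (~` [set y | edist x y < r] `&` F)) = 0%E.
  move=> m0; rewrite restrict_measE; apply: subset_measure0 m0 => //.
    by apply: measurableI => //; apply: measurableC; apply: measurableI => //; exact: measurableC.
  move=> z [/= /not_andP[/contrapT//|nF] Fz]; by case: nF.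
have H1 : ((2 * n%:R + dl)%:E * pot nu1 x <= shift_sum (pot nu1) x h)%E.
  apply: (shift_sum_pot_ge (F := ~` [set y | edist x y < r] `&` [set y | edist x y <= j%:R])).
  - by apply: measurableI => //; exact: measurableC.
  - exact: nullC.
  - by rewrite addr_ge0 // ltW.
  move=> z [/= /negP]; rewrite -leNgt => rz zj.
  have [t tl ->] := coef z rz; apply: lee_wpmul2r; first exact: kappa_ge0.
  rewrite lee_fin; apply: le_trans tl; rewrite lerD2l /dl ler_wpM2l ?(ltW e0) //.
  have dz0 : 0 < edist x z by exact: lt_le_trans rz.
  rewrite ler_wpM2l ?sqr_ge0 // lef_pV2 ?posrE ?exprn_gt0 //.
  apply: lerXn2r; rewrite ?nnegrE ?edist_ge0 ?(ltW L0) //.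
  by apply: (le_trans zj); rewrite ler_nat.
have H2 : ((2 * n%:R)%:E * pot nu2 x <= shift_sum (pot nu2) x h)%E.
  apply: (shift_sum_pot_ge (F := ~` [set y | edist x y < r] `&` ~` [set y | edist x y <= j%:R])).
  - by apply: measurableI => //; exact: measurableC.
  - exact: nullC.
  - by [].
  move=> z [/= /negP]; rewrite -leNgt => rz zj.
  have [t tl ->] := coef z rz; apply: lee_wpmul2r; first exact: kappa_ge0.
  rewrite lee_fin; apply: le_trans tl; rewrite lerDl mulr_ge0 ?(ltW e0) //.
  by rewrite divr_ge0 ?sqr_ge0.
rewrite (shift_sum_pot_restrictC nu mL) (pot_restrictC alpha nu mL).
apply: lt_le_trans (leeD H1 H2).
rewrite -/nu1 -/nu2.
have f1 : pot nu1 x \is a fin_num by rewrite ge0_fin_numE // pot_ge0.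
have f2 : pot nu2 x \is a fin_num by rewrite ge0_fin_numE // pot_ge0.
move: p1_gt0; rewrite -(fineK f1) -(fineK f2) lte_fin => p1.
rewrite -EFinD -!EFinM -EFinD lte_fin.
by have := mulr_gt0 dl0 p1; lra.
Qed.

End KernelLaplacian.

(** * Maximum principle on a compact set *)

Section MaximumPrinciple.
Variables (R : realType) (n : nat) (alpha : R).
Hypotheses (aln : alpha < n%:R) (ha2 : alpha <= 2) (n_gt0 : (0 < n)%N).
Local Notation RM := (@RMeasure R n).
Local Notation pt := (pt R n).
Local Notation pot := (pot alpha).
Local Notation e_ i := (delta_mx ord0 i : pt).
Implicit Types (mu nu : RM) (x y z : pt).

(** Without a maximum, every point has a neighbourhood on which some value of [V] is strictly
    larger; a finite cover yields a point of [C] whose value exceeds its own. *)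
Lemma usc_maximum (C : set pt) (V : pt -> R) : compact C -> C !=set0 ->
  (forall x c, C x -> V x < c -> exists2 r : R, 0 < r &
     forall x', C x' -> edist x x' < r -> V x' < c) ->
  exists2 x, C x & forall y, C y -> V y <= V x.
Proof.
move=> cC [c0 Cc0] usc; apply: contrapT => H.
have {}H x : C x -> exists2 y, C y & V x < V y.
  move=> Cx; apply: contrapT => Hx; apply: H; exists x => // y Cy.
  by rewrite leNgt; apply/negP => xy; apply: Hx; exists y.
have [y Cy Hy] : exists2 y, C y & forall x, C x -> C x -> V x < V y.
  apply: (compact_covering_ind (P := fun B => exists2 y, C y & forall x, B x -> C x -> V x < V y) cC).
  - by exists c0.
  - move=> B1 B2 [y1 Cy1 H1] [y2 Cy2 H2].
    have [y12|y21] := leP (V y1) (V y2).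
      exists y2 => // x [B1x|B2x] Cx; last exact: H2.
      exact: lt_le_trans (H1 x B1x Cx) y12.
    exists y1 => // x [B1x|B2x] Cx; first exact: H1.
    exact: lt_trans (H2 x B2x Cx) y21.
  - by move=> B1 B2 B12 [y Cy Hy]; exists y => // x /B12; exact: Hy.
  - move=> x Cx; have [y Cy xy] := H x Cx.
    have [r r0 Hr] := usc x _ Cx xy.
    by exists r => //; exists y => // x' /= xx' Cx'; exact: Hr.
by have := Hy y Cy Cy; rewrite ltxx.
Qed.

Lemma edist_sqr_usc x0 x (d : R) : 0 < d -> exists2 r : R, 0 < r &
  forall x', edist x x' < r -> edist x0 x' ^+ 2 < edist x0 x ^+ 2 + d.
Proof.
move=> d0; have D0 := edist_ge0 x0 x; set D := edist x0 x in D0 *.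
have K0 : 0 < 2 * D + 1 by rewrite ltr_wpDl // mulr_ge0.
exists (Num.min 1 (d / (2 * D + 1))); first by rewrite lt_min ltr01 divr_gt0.
move=> x'; rewrite lt_min ltr_pdivlMr // => /andP[r1 r2].
have T := edist_triangle x x0 x'; rewrite -/D in T.
have h0 := edist_ge0 x x'; have q0 := edist_ge0 x0 x'.
apply: (@le_lt_trans _ _ ((D + edist x x') ^+ 2)).
  by apply: lerXn2r T; rewrite nnegrE // addr_ge0.
have : edist x x' * edist x x' <= edist x x' * 1 by rewrite ler_wpM2l // ltW.
by rewrite sqrrD; move: r2; rewrite -mulr_natl; lra.
Qed.

(* [pot nu + e |x - x0|^2] attains its maximum over [C] in the interior, where
   the discrete Laplacian of [pot nu] is too large to allow it. *)
Lemma compact_maximum_principle (C : set pt) nu (M : R) : compact C ->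
  (forall x, C x -> (pot nu x < +oo)%E) ->
  (forall x (c : R), C x -> (pot nu x < c%:E)%E -> exists2 r : R, 0 < r &
     forall x', C x' -> edist x x' < r -> (pot nu x' < c%:E)%E) ->
  (forall x, C x -> (M%:E < pot nu x)%E -> exists2 r : R, 0 < r &
     eball x r `<=` C /\ nu (eball x r) = 0%E) ->
  forall x, C x -> (pot nu x <= M%:E)%E.
Proof.
move=> cC fin usc int x0 Cx0; rewrite leNgt; apply/negP => Mx0.
have [u [uE u0]] : exists u : pt -> R,
    (forall x, C x -> pot nu x = (u x)%:E) /\ (forall x, 0 <= u x).
  exists (fun x => fine (pot nu x)); split => x; last by apply: fine_ge0; exact: pot_ge0.
  by move=> Cx; rewrite fineK // ge0_fin_numE; [exact: fin|exact: pot_ge0].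
have [L L0 CL] : exists2 L : R, 0 < L & forall x, C x -> edist x0 x <= L.
  have [L [_ HL]] := compact_bounded cC.
  pose L' := n%:R * (Num.max L 0 + 1 + `|x0|).
  have L'0 : 0 <= L' by rewrite mulr_ge0 // addr_ge0 // addr_ge0 // le_max lexx orbT.
  exists (L' + 1); first by rewrite ltr_wpDl.
  move=> x Cx; apply: (@le_trans _ _ L'); last by rewrite lerDl.
  apply: (le_trans (edist_le_norm _ _)); rewrite ler_wpM2l //.
  rewrite (le_trans (ler_normB _ _)) // addrC lerD2r.
  apply: HL Cx; rewrite ltr_pwDr // le_max lexx //.
(* The quadratic term stays below [u x0 - M] on [C], so the maximum of [V] is at a point where
   [u > M]. *)
pose e := (u x0 - M) / (2 * L ^+ 2).
have uM : M < u x0 by rewrite -lte_fin -uE.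
have L20 : 0 < L ^+ 2 by rewrite exprn_gt0.
have e0 : 0 < e by rewrite divr_gt0 ?subr_gt0 // mulr_gt0.
have eL : e * L ^+ 2 < u x0 - M.
  have -> : e * L ^+ 2 = (u x0 - M) / 2 by rewrite /e; field; rewrite gt_eqF.
  by rewrite ltr_pdivrMr // ltr_pMr ?subr_gt0 // ltr1n.
pose V x := u x + e * edist x0 x ^+ 2.
have [|x c Cx Vc|x1 Cx1 Hmax] := @usc_maximum C V cC.
- by exists x0.
- pose d := (c - V x) / 2; have d0 : 0 < d by rewrite divr_gt0 // subr_gt0.
  have [|r1 r10 Hr1] := usc x (u x + d) Cx; first by rewrite uE // lte_fin ltrDl.
  have [r2 r20 Hr2] := @edist_sqr_usc x0 x (d / e) (divr_gt0 d0 e0).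
  exists (Num.min r1 r2); first by rewrite lt_min r10.
  move=> x' Cx'; rewrite lt_min => /andP[xr1 xr2].
  have := Hr1 x' Cx' xr1; rewrite uE // lte_fin.
  have ed : e * (d / e) = d by rewrite mulrC divfK // gt_eqF.
  have : e * edist x0 x' ^+ 2 < e * edist x0 x ^+ 2 + d.
    by rewrite -[X in _ + X]ed -mulrDr ltr_pM2l //; exact: Hr2.
  by move: Vc; rewrite /d /V; lra.
have Mx1 : M < u x1.
  have := Hmax x0 Cx0; rewrite /V edistxx expr0n mulr0 addr0 => h.
  have : e * edist x0 x1 ^+ 2 <= e * L ^+ 2.
    by rewrite ler_pM2l //; apply: lerXn2r (CL _ Cx1); rewrite nnegrE ?edist_ge0 ?ltW.
  by move: h eL; lra.
have [|r r0 [rC rnu]] := int x1 Cx1; first by rewrite uE // lte_fin.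
(* The defect [e1 * u x1 * h^2] is then at most [e * n * h^2], half of what the quadratic term
   forces at a maximum. *)
pose e1 := e * n%:R / (u x1 + 1).
have n0 : 0 < n%:R :> R by rewrite ltr0n.
have ux1 : 0 < u x1 + 1 by rewrite ltr_wpDl.
have e10 : 0 < e1 by rewrite divr_gt0 // mulr_gt0.
have [h0 h00 Hh] := shift_sum_pot_off_mass aln ha2 n_gt0 r0 e10 rnu.
pose h := Num.min h0 (r / 2).
have h_gt0 : 0 < h by rewrite lt_min h00 divr_gt0.
have hr : h < r.
  by rewrite gt_min; apply/orP; right; rewrite ltr_pdivrMr // ltr_pMr // ltr1n.
have [|a0] := Hh h; first by rewrite h_gt0 /h ge_min lexx.
have shiftC i (sg : R) : `|sg| = 1 -> C (x1 + (sg * h) *: e_ i).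
  by move=> sg1; apply: rC; rewrite /= edist_delta normrM sg1 mul1r gtr0_norm.
rewrite uE //.
have SE : shift_sum (pot nu) x1 h = (\sum_(i < n) (u (x1 + h *: e_ i) + u (x1 - h *: e_ i)))%:E.
  rewrite -sumEFin; apply: eq_bigr => i _; rewrite EFinD.
  have c1 := shiftC i 1 (normr1 _); have c2 := shiftC i (-1) _.
  rewrite mul1r in c1; rewrite mulN1r scaleNr in c2.
  by rewrite !uE //; apply: c2; rewrite normrN normr1.
rewrite SE -EFinM lee_fin => Hge.
have Hle : \sum_(i < n) (u (x1 + h *: e_ i) + u (x1 - h *: e_ i)) <=
    \sum_(i < n) (2 * u x1 - 2 * e * h ^+ 2).
  apply: ler_sum => i _.
  have c1 := shiftC i 1 (normr1 _); have c2 := shiftC i (-1) _.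
  have E1 := sqr_edist_shift x1 x0 h i; have E2 := sqr_edist_shift x1 x0 (- h) i.
  rewrite mul1r in c1; rewrite mulN1r in c2; rewrite scaleNr sqrrN in E2.
  have {}c2 : C (x1 - h *: e_ i) by rewrite scaleNr in c2; apply: c2; rewrite normrN normr1.
  have := Hmax _ c1; have := Hmax _ c2; rewrite /V !(edistC x0) E1 E2.
  set q := edist x1 x0 ^+ 2; set w := x1 _ _ - _; nra.
have := le_trans Hge Hle; rewrite sumr_const card_ord -mulr_natr.
have : e1 * u x1 <= e * n%:R.
  rewrite /e1 mulrAC ler_pdivrMr // ler_wpM2l ?lerDl //.
  by rewrite mulr_ge0 ?ltW.
have hh : 0 < h ^+ 2 by rewrite exprn_gt0.
move=> /(ler_wpM2r (ltW hh)) H1 H2.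
have := mulr_gt0 (mulr_gt0 e0 n0) hh.
by move: H1 H2; nra.
Qed.

End MaximumPrinciple.

(** * The contribution of nearby mass and Egorov's argument *)

Section Frostman.
Variables (R : realType) (n : nat) (alpha : R).
Hypothesis aln : alpha < n%:R.
Local Notation RM := (@RMeasure R n).
Local Notation pt := (pt R n).
Local Notation k := (kappa alpha).
Local Notation pot := (pot alpha).
Implicit Types (mu nu : RM) (x y z : pt).
Local Open Scope ereal_scope.

Lemma inv_truncnS_lt (r : R) : (0 < r)%R -> ((Num.truncn r^-1).+1%:R^-1 < r)%R.
Proof.
move=> r0; rewrite -[X in (_ < X)%R]invrK ltf_pV2 ?posrE ?invr_gt0 ?ltr0Sn //.
exact: truncnS_gt.
Qed.

Lemma pot_ecball_exhaust mu x c : c < pot mu x ->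
  exists j : nat, c < pot (restrict_meas mu (measurable_ecball (0%R : pt) j%:R)) x.
Proof.
move=> cx.
pose E j := [set y : Rn R n | (edist (0%R : pt) y <= j%:R)%R].
pose g j w := k x w * (\1_(E j) w)%:E.
have mE j : measurable (E j) by exact: measurable_ecball.
have mg j : measurable_fun [set: Rn R n] (g j).
  apply: emeasurable_funM; first exact: measurable_kappa.
  by apply/measurable_EFinP; exact: measurable_indic.
have g0 j w : 0 <= g j w by apply: mule_ge0; [exact: kappa_ge0|rewrite lee_fin indicE ler0n].
have g_homo w : {homo g^~ w : i j / (i <= j)%N >-> i <= j}.
  move=> i j ij; rewrite lee_wpmul2l ?kappa_ge0 // lee_fin !indicE ler_nat.
  case: (boolP (w \in E i)) => //; rewrite !inE /E /= => h.
  by rewrite mem_set //=; apply: (le_trans h); rewrite ler_nat.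
have gE w : limn (g^~ w) = k x w.
  apply/cvg_lim => //; apply: cvg_near_cst.
  exists (Num.truncn (edist 0%R w)).+1 => // j /= Nj.
  rewrite /g indicE mem_set ?mule1 // /E /=.
  by rewrite (le_trans (ltW (truncnS_gt _))) // ler_nat.
have gP j : \int[mu]_w g j w = pot (restrict_meas mu (mE j)) x.
  rewrite pot_restrict [RHS]integral_mkcond; apply: eq_integral => w _.
  by rewrite /g patchE indicE; case: ifPn => _; rewrite ?mule1 ?mule0.
apply: contrapT => /forallNP H.
suff : pot mu x <= c by rewrite leNgt cx.
have -> : pot mu x = limn (fun j => \int[mu]_w g j w).
  have <- := monotone_convergence mu measurableT mg (fun j w _ => g0 j w) (fun w _ => g_homo w).
  by apply: eq_integral => w _; rewrite gE.
apply: lime_le.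
  apply: ereal_nondecreasing_is_cvgn => i j ij.
  by apply: ge0_le_integral => // w _; exact: g_homo.
by apply: nearW => j; rewrite gP leNgt; apply/negP/H.
Qed.

(** The ball moves with [x]. Uniform smallness as [d] tends to [0] is the form in which continuity
    of a potential is used. *)
Definition near_pot mu (d : R) x := pot (restrict_meas mu (measurable_eball x d)) x.

Lemma near_pot_lsc mu (d : R) (c : \bar R) x : c < near_pot mu d x ->
  exists2 r : R, (0 < r)%R & forall x', (edist x x' < r)%R -> c < near_pot mu d x'.
Proof.
pose f x (z : Rn R n) := k x z * (\1_(eball x d) z)%:E.
have fE y : near_pot mu d y = \int[mu]_z f y z.
  rewrite /near_pot pot_restrict [LHS]integral_mkcond; apply: eq_integral => w _.
  by rewrite /f patchE indicE; case: ifPn => _; rewrite ?mule1 ?mule0.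
have f0 y z : 0 <= f y z by apply: mule_ge0; [exact: kappa_ge0|rewrite lee_fin indicE ler0n].
rewrite fE => cx.
have mf y : measurable_fun [set: Rn R n] (f y).
  apply: emeasurable_funM; first exact: measurable_kappa.
  by apply/measurable_EFinP; apply: measurable_indic; exact: measurable_eball.
have lf z c' : c' < f x z -> exists2 r : R, (0 < r)%R & forall y, (edist x y < r)%R -> c' < f y z.
  rewrite {1}/f indicE; case: (boolP (z \in _)) => [zd|_]; last first.
    by rewrite mule0 => c'0; exists 1%R => // y _; exact: lt_le_trans c'0 (f0 _ _).
  rewrite mule1 => h; have [r r0 Hr] := kappa_lsc aln h.
  rewrite inE /= in zd.
  exists (Num.min r (d - edist x z))%R; first by rewrite lt_min r0 subr_gt0.
  move=> y; rewrite lt_min => /andP[yr yd]; rewrite /f indicE mem_set ?mule1; first exact: Hr.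
  by rewrite /=; have := edist_triangle x y z; rewrite (edistC y x); move: yd; lra.
have [r r0 Hr] := @lsc_integral R n mu f x mf f0 lf c cx.
by exists r => // y /Hr; rewrite fE.
Qed.

Lemma near_pot_le mu (d d' : R) x : (d <= d')%R -> near_pot mu d x <= near_pot mu d' x.
Proof. by move=> dd'; apply: pot_restrict_sub => y /= /lt_le_trans; apply. Qed.

Lemma closed_near_pot_le mu d c : closed [set x : pt | near_pot mu d x <= c].
Proof.
rewrite -(setCK [set x | _]); apply: open_closedC; apply/open_edistP => x /= /negP.
rewrite -ltNge => /near_pot_lsc[r r0 Hr]; exists r => // y /Hr; rewrite ltNge => h.
exact/negP.
Qed.

(* Egorov's argument; [near_pot mu d] being lower semicontinuous, its sublevel
   sets are closed and so is [G]. *)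
Lemma near_pot_egorov mu (F : set pt) (e : R) : mu [set: Rn R n] < +oo -> closed F ->
  mu (~` F) = 0 -> (forall x, F x -> pot mu x < +oo) -> (0 < e)%R ->
  exists2 G : set pt, closed G /\ G `<=` F & mu (~` G) <= e%:E /\
    forall e' : R, (0 < e')%R -> exists2 d : R, (0 < d)%R &
      forall x, G x -> near_pot mu d x <= e'%:E.
Proof.
move=> mu_lty cF F0 fin e0.
have mF : measurable (F : set (Rn R n)) by exact: closed_measurable_Rn.
pose H (i m : nat) := [set x : pt | near_pot mu m.+1%:R^-1 x <= (i.+1%:R^-1)%:E].
have cH i m : closed (H i m) by exact: closed_near_pot_le.
have mH i m : measurable (H i m : set (Rn R n)) by exact: closed_measurable_Rn.
have Hmono i m1 m2 : (m1 <= m2)%N -> H i m1 `<=` H i m2.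
  move=> m12 x; apply: le_trans; apply: near_pot_le.
  by rewrite lef_pV2 ?posrE ?ltr0Sn // ler_nat ltnS.
have small i : exists m, mu (F `\` H i m) <= (e / (2 ^ i.+1)%:R)%:E.
  pose D m : set (Rn R n) := F `\` H i m.
  have mD m : measurable (D m) by exact: measurableD.
  have D0 : \bigcap_m D m = set0.
    apply/seteqP; split => // x Dx; have Fx := (Dx 0%N Logic.I).1.
    have i0 : (0 < i.+1%:R^-1 :> R)%R by rewrite invr_gt0 ltr0Sn.
    have [r /andP[r0 _] Hr] := pot_near_small (fin x Fx) i0 ltr01.
    have [_] := Dx (Num.truncn r^-1) Logic.I; apply; rewrite /H /=.
    apply: le_trans Hr; apply: near_pot_le.
    exact/ltW/inv_truncnS_lt.
  have : mu \o D @ \oo --> mu (\bigcap_m D m).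
    apply: nonincreasing_cvg_mu => //.
    - apply: le_lt_trans mu_lty; rewrite le_measure ?inE //.
    - by rewrite D0.
    - move=> m1 m2 m12; apply/subsetPset => x [Fx nH]; split => // h; apply: nH.
      exact: Hmono h.
  rewrite D0 measure0 => cvgD.
  have e'0 : 0 < (e / (2 ^ i.+1)%:R)%:E by rewrite lte_fin divr_gt0 // ltr0n expn_gt0.
  have [N _ HN] := cvgD _ (open_ereal_lt' e'0).
  exists N; apply/ltW; exact: (HN N (leqnn N)).
have {small}/choice[m Hm] := small.
pose G : set pt := F `&` \bigcap_i H i (m i).
exists G; first split.
- by apply: closedI => //; apply: closed_bigI => i _; exact: cH.
- by move=> x [].
split; last first.
  move=> e' e'0; pose i := Num.truncn e'^-1; exists ((m i).+1%:R^-1)%R.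
    by rewrite invr_gt0 ltr0Sn.
  move=> x [_ /(_ i Logic.I)]; rewrite /H /= => /le_trans; apply.
  by rewrite lee_fin; exact/ltW/inv_truncnS_lt.
have mG : measurable (G : set (Rn R n)).
  by apply: measurableI => //; apply: bigcapT_measurable => i; exact: mH.
have mU : measurable (\bigcup_i (F `\` H i (m i)) : set (Rn R n)).
  by apply: bigcupT_measurable => i; exact: measurableD.
apply: (@le_trans _ _ (mu (~` F `|` \bigcup_i (F `\` H i (m i))))).
  rewrite le_measure ?inE //; [exact: measurableC|apply: measurableU => //; exact: measurableC|].
  move=> x Gx; have [Fx|nF] := pselect (F x); [right|by left].
  apply: contrapT => h; apply: Gx; split => // i _; apply: contrapT => nH.
  by apply: h; exists i.
apply: (le_trans (measureU2 _ _ _)) => //; first exact: measurableC.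
rewrite [X in X + _](_ : _ = 0) // add0e.
have mFH i : measurable (F `\` H i (m i) : set (Rn R n)) by exact: measurableD.
apply: (le_trans (measure_sigma_subadditive mu mFH mU (@subset_refl _ _))).
apply: (@le_trans _ _ (\sum_(0 <= i <oo) (e / (2 ^ i.+1)%:R)%:E)).
  by apply: lee_nneseries => // i _; exact: Hm.
by apply: epsilon_trick0; exact: ltW.
Qed.

End Frostman.

(** * Maximum principle when the nearby contribution is uniformly small *)

Section FrostmanMaximum.
Variables (R : realType) (n : nat) (alpha : R).
Hypotheses (aln : alpha < n%:R) (ha2 : alpha <= 2) (n_gt0 : (0 < n)%N).
Local Notation RM := (@RMeasure R n).
Local Notation pt := (pt R n).
Local Notation k := (kappa alpha).
Local Notation pot := (pot alpha).
Local Notation near_pot := (near_pot alpha).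
Local Notation s := (n%:R - alpha).
Implicit Types (mu nu : RM) (x y z : pt).
Local Open Scope ereal_scope.

Lemma pot_restrict_mono mu (F F' G : set (Rn R n)) (mF : measurable F) (mF' : measurable F') x :
  measurable G -> mu (~` G) = 0 -> F `&` G `<=` F' ->
  pot (restrict_meas mu mF) x <= pot (restrict_meas mu mF') x.
Proof.
move=> mG G0 FG; rewrite !pot_restrict integral_mkcond [X in _ <= X]integral_mkcond.
have p0 H z : 0 <= (k x \_ H) z by rewrite patchE; case: ifP => // _; exact: kappa_ge0.
have mp H : measurable (H : set (Rn R n)) ->
    measurable_fun [set: Rn R n] ((k x : Rn R n -> \bar R) \_ H).
  move=> mH; apply/(measurable_restrictT _ mH).
  by apply: measurable_funTS; exact: measurable_kappa.
apply: (integral_null_compl mG G0) => //; [exact: mp|exact: mp|].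
move=> z Gz; rewrite !patchE; have [Fz|_] := boolP (z \in F).
  by rewrite ifT // inE; apply: FG; split => //; exact: set_mem.
by case: ifP => // _; exact: kappa_ge0.
Qed.

(** Near projection onto [G], at the cost of a factor [3] in the radius and 3^s in the value. *)
Lemma near_pot_uniform nu (G : set pt) : closed G -> nu (~` G) = 0 ->
  (forall e : R, (0 < e)%R -> exists2 d : R, (0 < d)%R &
      forall x, G x -> near_pot nu d x <= e%:E) ->
  forall e : R, (0 < e)%R -> exists2 d : R, (0 < d)%R & forall x, near_pot nu d x <= e%:E.
Proof.
move=> cG G0 H e e0.
have mG : measurable (G : set (Rn R n)) by exact: closed_measurable_Rn.
have c3 : (0 < 3 `^ s :> R)%R by rewrite powR_gt0.
have [d d0 Hd] := H (e / 3 `^ s)%R (divr_gt0 e0 c3).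
exists (d / 3)%R; first by rewrite divr_gt0.
move=> x; have mB := measurable_eball x (d / 3)%R.
have [GE|/set0P Gn0] := eqVneq G set0.
  rewrite (le_trans (pot_restrict_mono mB measurable0 x mG G0 _)) //.
    by rewrite GE setI0.
  by rewrite pot_restrict integral_set0 lee_fin ltW.
have [x' Gx' Hx'] := near_projection x cG Gn0.
have mGB : measurable (G `&` eball x (d / 3)%R : set (Rn R n)) by exact: measurableI.
have nullC : restrict_meas nu mB (~` (G `&` eball x (d / 3)%R)) = 0.
  rewrite restrict_measE; apply: subset_measure0 G0 => //.
  - by apply: measurableI => //; exact: measurableC.
  - exact: measurableC.
  - by move=> z [/= /not_andP[//|nF] Fz]; case: nF.
rewrite /near_pot; apply: (le_trans (pot_le_pot aln mGB nullC (ltr0Sn R 2) _)).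
  by move=> w [Gw _]; exact: Hx'.
apply: (@le_trans _ _ ((3 `^ s)%:E * near_pot nu d x')); last first.
  apply: (@le_trans _ _ ((3 `^ s)%:E * (e / 3 `^ s)%:E)).
    by apply: lee_wpmul2l (Hd _ Gx'); rewrite lee_fin ltW.
  by rewrite -EFinM mulrC divfK // gt_eqF.
apply: lee_wpmul2l; first by rewrite lee_fin ltW.
apply: (pot_restrict_mono mB _ x' mG G0) => z [/= zx Gz].
by apply: le_lt_trans (Hx' z Gz) _; lra.
Qed.

Lemma near_pot_uniform_lty nu x : nu [set: Rn R n] < +oo ->
  (forall e : R, (0 < e)%R -> exists2 d : R, (0 < d)%R & forall x, near_pot nu d x <= e%:E) ->
  pot nu x < +oo.
Proof.
move=> nu_lty H; have [d d0 Hd] := H 1%R ltr01.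
have mB := measurable_eball x d.
rewrite (pot_restrictC alpha nu mB) lte_add_pinfty //.
  by apply: le_lt_trans (Hd x) _; exact: ltry.
apply: (@le_lt_trans _ _ ((d `^ (alpha - n%:R))%:E * nu [set: Rn R n])).
  apply: (le_trans (pot_far_ub aln (measurableC mB) _ d0 _)).
  - by rewrite restrict_compl_null.
  - by move=> w /= /negP; rewrite -leNgt.
  rewrite lee_wpmul2l ?lee_fin ?powR_ge0 // restrict_measE setTI le_measure ?inE //.
  exact: measurableC.
by rewrite lte_mul_pinfty // lee_fin powR_ge0.
Qed.

(** The near part is uniformly small and the far part is upper semicontinuous at [x]; this gives
    upper semicontinuity on the support too, as [compact_maximum_principle] requires. *)
Lemma near_pot_uniform_usc nu x (e : R) : pot nu x < +oo ->
  (forall e : R, (0 < e)%R -> exists2 d : R, (0 < d)%R & forall x, near_pot nu d x <= e%:E) ->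
  (0 < e)%R -> exists2 r : R, (0 < r)%R & forall x', (edist x x' < r)%R ->
    pot nu x' <= pot nu x + e%:E.
Proof.
move=> fin H e0; have e20 : (0 < e / 2)%R by rewrite divr_gt0.
have [D D0 HD] := H _ e20.
have d0 : (0 < D / 2)%R by rewrite divr_gt0.
have mB := measurable_eball x (D / 2)%R.
have fin2 : pot (restrict_meas nu (measurableC mB)) x < +oo.
  exact: le_lt_trans (pot_restrict_le _ _ _ _) fin.
have null2 : restrict_meas nu (measurableC mB) (eball x (D / 2)%R) = 0.
  by rewrite restrict_measE setICr measure0.
have [r /andP[r0 rD] Hr] := pot_usc_off_mass aln d0 e20 fin2 null2.
exists r => // x' xx'.
have h1 : pot (restrict_meas nu mB) x' <= (e / 2)%:E.
  apply: le_trans (HD x'); apply: pot_restrict_sub => z /= xz.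
  by have := edist_triangle x x' z; rewrite (edistC x' x); lra.
have h2 : pot (restrict_meas nu (measurableC mB)) x' <= pot nu x + (e / 2)%:E.
  apply: le_trans (Hr x' xx') _; apply: leeD => //; exact: pot_restrict_le.
have -> : pot nu x + e%:E = (e / 2)%:E + (pot nu x + (e / 2)%:E).
  by rewrite addeCA -EFinD -splitr.
rewrite (pot_restrictC alpha nu mB x'); exact: leeD.
Qed.

Lemma uniform_maximum_principle nu (S : set pt) (rho : R) : nu [set: Rn R n] < +oo ->
  (forall e : R, (0 < e)%R -> exists2 d : R, (0 < d)%R & forall x, near_pot nu d x <= e%:E) ->
  closed S -> nu (~` S) = 0 -> nu (~` ecball (0%R : pt) rho) = 0 ->
  (forall x, S x -> pot nu x <= 1) -> forall x, pot nu x <= 1.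
Proof.
move=> nu_lty H cS S0 rho0 HS.
have fin x : pot nu x < +oo by exact: near_pot_uniform_lty.
have s0 : (0 < s)%R by rewrite subr_gt0.
have mE : measurable (ecball (0%R : pt) rho) by exact: measurable_ecball.
have nu_fin : nu [set: Rn R n] \is a fin_num by rewrite ge0_fin_numE.
have [m [mE' m0]] : exists m : R, nu [set: Rn R n] = m%:E /\ (0 <= m)%R.
  by exists (fine (nu [set: Rn R n])); rewrite fineK //; split => //; exact: fine_ge0.
(* Beyond distance [r] from the mass, the potential is at most [m / (m + 1)]; so only a large ball
   has to be examined. *)
pose r := ((m + 1) `^ s^-1)%R.
have m1 : (0 < m + 1)%R by rewrite ltr_wpDl.
have r0 : (0 < r)%R by rewrite powR_gt0.
have rE : (r `^ (alpha - n%:R) = (m + 1)^-1)%R.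
  rewrite /r -powRrM (_ : (s^-1 * (alpha - n%:R) = -1)%R) ?powR_inv1 // ?ltW //.
  by rewrite -(opprB n%:R alpha) mulrN mulVf // gt_eqF.
have far x : (rho + r <= edist (0%R : pt) x)%R -> pot nu x <= 1.
  move=> h; apply: (le_trans (pot_far_ub aln mE rho0 r0 _)).
    move=> w /= hw; have := edist_triangle w (0%R : pt) x; rewrite (edistC w x).
    by move: h hw; lra.
  rewrite rE mE' -EFinM lee_fin ler_pdivrMl // mulr1; lra.
have Cmp : compact [set y : pt | (edist (0%R : pt) y <= rho + r + 1)%R] by exact: compact_ecball.
move=> x; have [xC|xC] := leP (edist (0%R : pt) x) (rho + r + 1)%R; last first.
  by apply: far; move: xC; lra.
apply: (compact_maximum_principle aln ha2 n_gt0 Cmp _ _ _ xC) => //.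
- move=> y c _; have [u uE] : exists u : R, pot nu y = u%:E.
    by exists (fine (pot nu y)); rewrite fineK // ge0_fin_numE // pot_ge0.
  rewrite uE lte_fin => uc; have e0 : (0 < (c - u) / 2)%R by rewrite divr_gt0 // subr_gt0.
  have [r' r'0 Hr'] := near_pot_uniform_usc (fin y) H e0.
  exists r' => // x' _ /Hr' h; apply: le_lt_trans h _.
  by rewrite uE -EFinD lte_fin; move: uc; lra.
- move=> y yC y1; have nS : ~ S y by move=> /HS; rewrite leNgt y1.
  have {}yC : (edist (0%R : pt) y < rho + r)%R.
    by rewrite ltNge; apply/negP => /far; rewrite leNgt y1.
  have /open_edistP/(_ y nS)[q q0 Hq] : open (~` S) by exact: closed_openC.
  exists (Num.min q 1)%R; first by rewrite lt_min q0 ltr01.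
  split => [z /=|].
    rewrite lt_min => /andP[_ z1]; have := edist_triangle y (0%R : pt) z.
    by move: yC z1; lra.
  apply: (subset_measure0 _ _ _ S0) => //.
  - exact: measurable_eball.
  - by apply: measurableC; exact: closed_measurable_Rn.
  - by move=> z /=; rewrite lt_min => /andP[/Hq].
Qed.

End FrostmanMaximum.

(** * Frostman's maximum principle *)

Section Frostman.
Variables (R : realType) (n : nat) (alpha : R).
Hypotheses (aln : alpha < n%:R) (ha2 : alpha <= 2) (n_gt0 : (0 < n)%N).
Local Notation RM := (@RMeasure R n).
Local Notation pt := (pt R n).
Local Notation pot := (pot alpha).
Local Notation near_pot := (near_pot alpha).
Implicit Types (mu nu : RM) (x y z : pt).
Local Open Scope ereal_scope.

Lemma pot_eq_meas mu nu x : (forall B, measurable B -> mu B = nu B) -> pot mu x = pot nu x.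
Proof. by move=> H; apply: eq_measure_integral => B mB _; exact: H. Qed.

Lemma pot_restrict_restrict_le mu (F B : set (Rn R n)) (mF : measurable F) (mB : measurable B) x :
  pot (restrict_meas (restrict_meas mu mF) mB) x <= pot (restrict_meas mu mB) x.
Proof.
rewrite (@pot_eq_meas _ (restrict_meas (restrict_meas mu mB) mF)); last first.
  by move=> E mE; rewrite !restrict_measE setIAC.
exact: pot_restrict_le.
Qed.

(** A point [x0] violating the bound is at distance at least [rho] from the mass. Cutting to a large
    ball keeps the value at [x0] above some [c > 1], and Egorov's argument discards so little mass
    that, seen from distance [rho], it contributes at most [c - 1]; the remaining measure
    contradicts the uniform principle. *)
Lemma frostman_maximum_principle mu : radon mu ->
  (forall x, msupport mu x -> pot mu x <= 1) -> forall x, pot mu x <= 1.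
Proof.
move=> rmu HS x0; rewrite leNgt; apply/negP => H0.
have nS : ~ msupport mu x0 by move=> /HS; rewrite leNgt H0.
have [rho rho0 Hrho] := not_msupport_null nS.
have [j Hj] := pot_ecball_exhaust H0.
have mE := measurable_ecball (0%R : pt) j%:R.
set mj := restrict_meas mu mE in Hj.
have mjS : mj [set: Rn R n] < +oo by rewrite restrict_measE setTI; exact: radon_ecball_lty.
pose F : set pt := msupport mu `&` [set y : pt | (edist (0%R : pt) y <= j%:R)%R].
have cF : closed F by apply: closedI; [exact: msupport_closed|exact: closed_ecball].
have mF : measurable (F : set (Rn R n)) by exact: closed_measurable_Rn.
have mS : measurable (msupport mu : set (Rn R n)).
  by apply: closed_measurable_Rn; exact: msupport_closed.
have F0 : mj (~` F) = 0.
  rewrite restrict_measE; apply: (subset_measure0 _ _ _ (msupport_compl_null mu)) => //.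
  - by apply: measurableI => //; exact: measurableC.
  - exact: measurableC.
  - by move=> z [/= /not_andP[//|nF] Fz]; case: nF.
have le1 x : F x -> pot mj x <= 1.
  by move=> [Sx _]; apply: le_trans (pot_restrict_le _ _ _ _) (HS x Sx).
have lty x : F x -> pot mj x < +oo by move=> /le1 h; apply: le_lt_trans h _; exact: ltry.
have [c1 /andP[c11 c1p]] := ereal_between Hj.
have [c [cE c_gt1]] : exists c : R, c1 = c%:E /\ (1 < c)%R.
  move: c1 c11 c1p => [c c1 _|_|//]; first by exists c; rewrite -lte_fin.
  by rewrite ltNge leey.
have rs0 : (0 < rho `^ (alpha - n%:R))%R by rewrite powR_gt0.
have e0 : (0 < (c - 1) / rho `^ (alpha - n%:R))%R by rewrite divr_gt0 // subr_gt0.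
have [G [cG GF] [Ge Gu]] := near_pot_egorov aln mjS cF F0 lty e0.
have mG : measurable (G : set (Rn R n)) by exact: closed_measurable_Rn.
pose nu := restrict_meas mj mG.
have nuS : nu [set: Rn R n] < +oo.
  by apply: le_lt_trans mjS; rewrite restrict_measE setTI le_measure ?inE.
have nuG : nu (~` G) = 0 by exact: restrict_compl_null.
have Gu' e : (0 < e)%R -> exists2 d : R, (0 < d)%R & forall x, G x -> near_pot nu d x <= e%:E.
  move=> h; have [d d0 Hd] := Gu e h; exists d => // x Gx; apply: le_trans (Hd x Gx).
  exact: pot_restrict_restrict_le.
have Gn := near_pot_uniform aln cG nuG Gu'.
have rest : pot (restrict_meas mj (measurableC mG)) x0 <= (c - 1)%:E.
  have mB := measurable_eball x0 rho.
  have B0 : restrict_meas mj (measurableC mG) (~` (~` eball x0 rho)) = 0.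
    rewrite setCK !restrict_measE; apply: (subset_measure0 _ _ _ Hrho) => //.
      by apply: measurableI => //; apply: measurableI => //; exact: measurableC.
    by move=> z [[]].
  apply: (le_trans (pot_far_ub aln (measurableC mB) B0 rho0 _)).
    by move=> w /= /negP; rewrite -leNgt.
  rewrite restrict_measE setTI.
  apply: (@le_trans _ _ ((rho `^ (alpha - n%:R))%:E * ((c - 1) / rho `^ (alpha - n%:R))%:E)).
    by rewrite lee_wpmul2l // lee_fin ltW.
  by rewrite -EFinM mulrC divfK // gt_eqF.
have nu1 : 1 < pot nu x0.
  rewrite ltNge; apply/negP => h; move: c1p; rewrite ltNge => /negP; apply.
  suff : pot mj x0 <= c1 by [].
  rewrite (pot_restrictC alpha mj mG) cE (_ : c%:E = 1 + (c - 1)%:E); first exact: leeD.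
  by rewrite -EFinD addrC subrK.
move: nu1; rewrite ltNge => /negP; apply.
apply: (uniform_maximum_principle aln ha2 n_gt0 (S := G) (rho := j%:R)) => //.
  rewrite !restrict_measE (_ : _ `&` _ = set0) ?measure0 //.
  by apply/seteqP; split => // z [[]].
move=> x /GF Fx; exact: le_trans (pot_restrict_le _ _ _ _) (le1 x Fx).
Qed.
End Frostman.

(** * Strong maximum principle off the mass *)

Section StrongMaximum.
Variables (R : realType) (n : nat) (alpha : R).
Hypotheses (aln : alpha < n%:R) (ha2 : alpha <= 2) (n_gt0 : (0 < n)%N).
Local Notation RM := (@RMeasure R n).
Local Notation pt := (pt R n).
Local Notation k := (kappa alpha).
Local Notation pot := (pot alpha).
Implicit Types (mu nu : RM) (x y z : pt).
Local Open Scope ereal_scope.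

Lemma pot_lt_near nu x (r c : R) : (0 < r)%R -> nu (eball x r) = 0 -> pot nu x < c%:E ->
  exists2 d : R, (0 < d <= r)%R & forall z, (edist x z < d)%R -> pot nu z < c%:E.
Proof.
move=> r0 nu0 pc; have fin : pot nu x < +oo by apply: lt_trans pc _; exact: ltry.
have [u uE] : exists u : R, pot nu x = u%:E.
  by exists (fine (pot nu x)); rewrite fineK // ge0_fin_numE // pot_ge0.
have e0 : (0 < (c - u) / 2)%R by rewrite divr_gt0 // subr_gt0 -lte_fin -uE.
have [d dr Hd] := pot_usc_off_mass aln r0 e0 fin nu0. exists d; [exact: dr|]. move=> z /Hd h.
by apply: le_lt_trans h _; rewrite uE -EFinD lte_fin; move: e0; lra.
Qed.

(* If [pot nu p < 1], a small point mass added at [p] keeps the potential below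
   its value on the outer sphere of an annulus about [p] containing [x]; this
   contradicts [pot nu x = 1]. *)
Lemma strong_maximum_principle nu x (r : R) p : (0 < r)%R -> nu (eball x r) = 0 ->
  (forall z, pot nu z <= 1) -> pot nu x = 1 -> (edist x p < r / 4)%R -> pot nu p = 1.
Proof.
move=> r0 nu0 le1 px xp; apply/eqP; rewrite eq_le le1 /= leNgt; apply/negP => p1.
have [v [vE v1]] : exists v : R, pot nu p = v%:E /\ (v < 1)%R.
  exists (fine (pot nu p)); rewrite -lte_fin fineK //.
  by rewrite ge0_fin_numE ?pot_ge0 // (lt_le_trans p1) // leey.
have r20 : (0 < r / 2)%R by rewrite divr_gt0.
have nup : nu (eball p (r / 2)%R) = 0.
  apply: (subset_measure0 _ _ _ nu0); [exact: measurable_eball|exact: measurable_eball|].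
  by move=> z /= pz; have := edist_triangle p x z; lra.
pose w := ((1 + v) / 2)%R; have w1 : (w < 1)%R by rewrite /w; lra.
have pw : pot nu p < w%:E by rewrite vE lte_fin /w; lra.
have [d1 /andP[d10 d1r] Hd1] := pot_lt_near r20 nup pw.
pose d := (d1 / 2)%R; have d0 : (0 < d)%R by rewrite divr_gt0.
have ds0 : (0 < d `^ (alpha - n%:R))%R by rewrite powR_gt0.
(* On the inner sphere [pot nu < w], and [c'] adds exactly [1 - w] there. On the outer sphere the
   point mass adds [c' * q], but strictly more at [x], which is closer to [p]. *)
pose c' := ((1 - w) / d `^ (alpha - n%:R))%R.
have c'0 : (0 < c')%R by rewrite divr_gt0 // subr_gt0.
have c'd : (c' * d `^ (alpha - n%:R) = 1 - w)%R by rewrite divfK // gt_eqF.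
pose q := ((r / 2) `^ (alpha - n%:R))%R; have q0 : (0 < q)%R by rewrite powR_gt0.
pose mu := add_meas nu (scale_meas (NngNum (ltW c'0)) (dirac_pt p)).
have muE z : pot mu z = pot nu z + c'%:E * k p z by rewrite pot_add pot_scale pot_dirac kappaC.
pose C : set pt := [set z | (edist p z <= r / 2)%R] `&` ~` [set z : pt | (edist p z < d)%R].
have cC : compact C.
  apply: (@subclosed_compact _ _ [set z : pt | (edist p z <= r / 2)%R]).
  - by apply: closedI; [exact: closed_ecball|apply: open_closedC; exact: open_eball].
  - exact: compact_ecball.
  - by move=> z [].
have Cnull z : C z -> exists2 e : R, (0 < e)%R & mu (eball z e) = 0.
  move=> [/= z1 /negP]; rewrite -leNgt => z2.
  exists (Num.min d (r / 4)%R); first by rewrite lt_min d0 divr_gt0.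
  set B := eball z _.
  have nB : nu B = 0.
    apply: (subset_measure0 _ _ _ nu0); [exact: measurable_eball|exact: measurable_eball|].
    move=> y; rewrite /B /= lt_min => /andP[_ zy].
    by have := edist_triangle z x y; have := edist_triangle p x z; lra.
  have dB : dirac_pt p B = 0.
    rewrite /dirac_pt [LHS]diracE memNset // /B /= edistC; apply/negP.
    by rewrite -leNgt ge_min z2.
  rewrite /mu /add_meas [LHS]measure_addE nB add0e.
  transitivity (c'%:E * dirac_pt p B); last by rewrite dB mule0.
  by [].
have xC : C x.
  split => /=; first by rewrite edistC; move: xp r0; lra.
  move=> px'; have := Hd1 x; rewrite px => H.
  have /H : (edist p x < d1)%R by move: px'; rewrite /d; lra.
  by rewrite lte_fin; move: w1; lra.
have {}xp : (edist p x < r / 4)%R by rewrite edistC.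
have px0 : p != x by apply: contraTneq p1 => ->; rewrite px ltxx.
have Cfin z : C z -> pot mu z < +oo.
  move=> [_ /negP]; rewrite -leNgt => z2; rewrite muE lte_add_pinfty //.
    by apply: le_lt_trans (le1 z) _; exact: ltry.
  by rewrite kappa_neq ?ltry // -edist_gt0 (lt_le_trans d0).
have : pot mu x <= (1 + c' * q)%:E.
  apply: (compact_maximum_principle aln ha2 n_gt0 cC Cfin _ _ xC).
  - move=> z c Cz zc; have [e e0 He] := Cnull z Cz.
    have [d2 /andP[d20 _] Hd2] := pot_lt_near e0 He zc.
    exists d2; [exact: d20|move=> z' _; exact: Hd2].
  - move=> z Cz zM; have [z1 /negP] := Cz; rewrite -leNgt => z2 /=.
    have pz : p != z by rewrite -edist_gt0 (lt_le_trans d0).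
    have z1' : (edist p z < r / 2)%R.
      rewrite lt_neqAle z1 andbT; apply/negP => /eqP zr; move: zM; apply/negP; rewrite -leNgt.
      have kz : k p z = q%:E by rewrite kappa_neq // zr.
      by rewrite muE kz EFinD EFinM; apply: leeD; [exact: le1|exact: lexx].
    have z2' : (d < edist p z)%R.
      rewrite lt_neqAle z2 andbT; apply/negP => /eqP zr; move: zM; apply/negP; rewrite -leNgt.
      have kz : k p z = (d `^ (alpha - n%:R))%:E by rewrite kappa_neq // zr.
      have zw : pot nu z < w%:E by apply: Hd1; rewrite -zr /d; move: d10; lra.
      rewrite muE kz -EFinM c'd; apply: (@le_trans _ _ (w%:E + (1 - w)%:E)).
        by apply: leeD; [exact: ltW|exact: lexx].
      by rewrite -EFinD lee_fin addrC subrK lerDl; apply: mulr_ge0; exact: ltW.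
    have [e e0 He] := Cnull z Cz.
    pose e' := Num.min e (Num.min (edist p z - d) (r / 2 - edist p z))%R.
    exists e'; first by rewrite !lt_min e0 !subr_gt0 z1' z2'.
    split => [y /=|].
      rewrite !lt_min => /and3P[_ y1 y2]; split => /=.
        by have := edist_triangle z p y; move: y2; lra.
      apply/negP; rewrite -leNgt; have := edist_triangle y p z; rewrite (edistC y z).
      by move: y1; lra.
    apply: (subset_measure0 _ _ _ He); [exact: measurable_eball|exact: measurable_eball|].
    by move=> y /=; rewrite lt_min => /andP[].
rewrite muE px kappa_neq // -EFinM -EFinD lee_fin lerD2l ler_pM2l // leNgt => /negP; apply.
apply: powR_lt_decr; rewrite ?edist_gt0 //; first by rewrite subr_lt0.
by move: xp r0; lra.
Qed.

End StrongMaximum.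

(** * The equilibrium potential on and off [A]; the support for [alpha < 2] *)

Section ReducedKernel.
Variables (R : realType) (n : nat) (alpha : R).
Hypotheses (aln : alpha < n%:R) (ha2 : alpha <= 2) (n_gt0 : (0 < n)%N).
Local Notation RM := (@RMeasure R n).
Local Notation pt := (pt R n).
Local Notation pot := (pot alpha).
Variables (A : set pt) (ga : RM).
Hypotheses (hA : reduced_kernel alpha A = A) (gaE : is_equilibrium alpha A ga).
Implicit Types (x y z : pt).
Local Open Scope ereal_scope.

Lemma equilibrium_le1 x : pot ga x <= 1.
Proof.
apply: (frostman_maximum_principle aln ha2 n_gt0); first by case: gaE => [[]].
by move=> y; exact: (equilibrium_le1_msupport aln n_gt0 gaE).
Qed.

(** Near a point of its reduced kernel [A] has positive capacity, so the exceptional set of capacity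
    zero cannot exhaust it. *)
Lemma reduced_kernel_point x (r : R) : closure A x -> (0 < r)%R ->
  exists y, [/\ A y, (edist x y < r)%R & pot ga y = 1].
Proof.
move=> cx r0; have r20 : (0 < r / 2)%R by rewrite divr_gt0.
have [a Aa xa] := (closure_edistP A x).1 cx _ r20.
have [_ /(_ _ r20) ca] : reduced_kernel alpha A a by rewrite hA.
apply: contrapT => H; move: ca; rewrite (_ : cap _ _ = 0) ?ltxx //.
apply: cap0_sub (equilibrium_is_competitor aln gaE) => y [Ay ay]; split => // y1.
apply: H; exists y; split => //; last by apply/eqP; rewrite eq_le equilibrium_le1.
have := edist_triangle a x y; move: xa ay => /=; lra.
Qed.

Lemma equilibrium_lt1_off_mass x (r : R) : (alpha < 2)%R -> (0 < r)%R -> ga (eball x r) = 0 ->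
  pot ga x < 1.
Proof.
move=> a2 r0 ga0; rewrite lt_neqAle equilibrium_le1 andbT; apply/eqP => p1.
have gaT : ga [set: Rn R n] != 0.
  apply/negP => /eqP g0.
  have p0 : pot ga x = 0 by apply: null_set_integral => //; exact: measurable_kappa.
  by move: p1; rewrite p0 => /esym/eqP; rewrite onee_eq0.
have [h0 h00 Hh] := shift_sum_pot_strict aln a2 gaE.1 r0 ga0 gaT.
have := Hh h0; rewrite h00 lexx p1 mule1 => /(_ isT); rewrite ltNge => /negP; apply.
rewrite /shift_sum; apply: (@le_trans _ _ (\sum_(i < n) 2%:E)).
  apply: lee_sum => i _; apply: (@le_trans _ _ (1 + 1)).
    by apply: leeD; exact: equilibrium_le1.
  by rewrite -EFinD lee_fin.
by rewrite sumEFin sumr_const card_ord mulr_natr.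
Qed.

Lemma equilibrium_msupport_lt2 : (alpha < 2)%R -> msupport ga = closure A.
Proof.
move=> a2; apply/seteqP; split; first exact: (equilibrium_msupport_sub aln n_gt0 gaE).
move=> x cx; apply: contrapT => /not_msupport_null[r r0 Hr].
have r20 : (0 < r / 2)%R by rewrite divr_gt0.
have [y [_ xy py]] := reduced_kernel_point cx r20.
have : pot ga y < 1.
  apply: (equilibrium_lt1_off_mass a2 r20).
  apply: (subset_measure0 _ _ _ Hr); [exact: measurable_eball|exact: measurable_eball|].
  by move=> z /= yz; have := edist_triangle y x z; lra.
by rewrite py ltxx.
Qed.

Lemma equilibrium_null_off_closure x : ~ closure A x ->
  exists2 r : R, (0 < r)%R & ga (eball x r) = 0.
Proof.
move=> nx; apply: not_msupport_null => Sx; apply: nx.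
exact: (equilibrium_msupport_sub aln n_gt0 gaE).
Qed.

End ReducedKernel.

(** * Dilated test measures and open sets *)

Section TestMeasures.
Variables (R : realType) (n : nat) (alpha : R).
Hypothesis aln : alpha < n%:R.
Local Notation RM := (@RMeasure R n).
Local Notation pt := (pt R n).
Local Notation k := (kappa alpha).
Local Notation pot := (pot alpha).
Local Notation s := (n%:R - alpha).
Implicit Types (mu nu : RM) (x y z : pt).
Local Open Scope ereal_scope.

Lemma measurable_affine y (a : R) :
  measurable_fun [set: Rn R n] ((fun z : pt => y + a *: z)%R : Rn R n -> Rn R n).
Proof.
apply: (@measurability _ _ (Rn R n) (Rn R n) _ _ (@open pt)) => [//|].
move=> _ [U oU <-]; rewrite setTI; apply: open_measurable_Rn.
apply/open_edistP => x Ux; have [r r0 Hr] := (open_edistP U).1 oU _ Ux.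
have a0 : (0 < `|a| + 1)%R by rewrite ltr_wpDl.
exists (r / (`|a| + 1))%R; first by rewrite divr_gt0.
move=> z; rewrite ltr_pdivlMr // => xz; apply: Hr; rewrite edistDl edistZ.
by apply: le_lt_trans xz; rewrite mulrC ler_wpM2l ?edist_ge0 // lerDl.
Qed.

Definition affine_meas mu y (a : R) : RM :=
  measure_function_pushforward__canonical__measure_function_Measure mu (measurable_affine y a).

Lemma affine_measE mu y a B : affine_meas mu y a B = mu [set z : Rn R n | B (y + a *: z)%R].
Proof. by []. Qed.

Lemma pot_affine mu y a x : (0 < a)%R ->
  pot (affine_meas mu y a) (y + a *: x)%R = (a `^ (alpha - n%:R))%:E * pot mu x.
Proof.
move=> a0; set q := (y + a *: x)%R.
have mk : measurable_fun [set: Rn R n] (k q : Rn R n -> \bar R) := measurable_kappa alpha q.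
have k0 : {in [set: Rn R n], forall z, 0 <= k q z} by move=> z _; exact: kappa_ge0.
have E := ge0_integral_pushforward (measurable_affine y a) mu measurableT mk k0.
transitivity (\int[mu]_z k q (y + a *: z)%R); first exact: E.
rewrite -ge0_integral_RnZl; last 3 first.
- exact: measurable_kappa.
- exact: kappa_ge0.
- by rewrite lee_fin powR_ge0.
by apply: eq_integral => z _; exact: kappa_dilate.
Qed.

(** Dilated copies about [y] of a bounded piece of [mu]. The point is scaling: the bound on the
    potential of [tau] and the value forced at the centre by its mass [m] are the same power of [d],
    up to constants independent of [d] and [y]. *)
Lemma test_measure mu : radon mu -> (forall x, pot mu x <= 1) -> mu [set: Rn R n] != 0 ->
  exists m j : R, [/\ (0 < m)%R, (0 < j)%R & forall y (d : R), (0 < d)%R -> exists tau : RM,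
    [/\ tau [set: Rn R n] = m%:E, tau (~` eball y d) = 0 &
        forall z, pot tau z <= ((d / j) `^ (alpha - n%:R))%:E]].
Proof.
move=> rmu mu1 muT.
have p0 : 0 < pot mu 0%R.
  by rewrite lt_neqAle pot_ge0 andbT eq_sym; apply: contra_neq muT; exact: pot_eq0.
have [J HJ] := pot_ecball_exhaust p0.
have mE := measurable_ecball (0%R : pt) J%:R.
pose mj := restrict_meas mu mE.
have mj_lty : mj [set: Rn R n] < +oo by rewrite restrict_measE setTI; exact: radon_ecball_lty.
have mj0 : mj [set: Rn R n] != 0.
  apply/negP => /eqP g0; move: HJ; rewrite (_ : pot _ _ = 0) ?ltxx //.
  by apply: null_set_integral => //; exact: measurable_kappa.
have mj_fin : mj [set: Rn R n] \is a fin_num by rewrite ge0_fin_numE.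
(* Dividing by [J + 1] sends the closed ball of radius [J] into the open ball of radius [d], also
   when [J = 0]. *)
exists (fine (mj [set: Rn R n])), (J%:R + 1)%R; split.
- by rewrite fine_gt0 // mj_lty andbT lt_neqAle eq_sym mj0 measure_ge0.
- by rewrite ltr_wpDl.
move=> y d d0; have J0 : (0 < J%:R + 1 :> R)%R by rewrite ltr_wpDl.
have a0 : (0 < d / (J%:R + 1))%R by rewrite divr_gt0.
exists (affine_meas mj y (d / (J%:R + 1))); split.
- by rewrite fineK.
- rewrite affine_measE; apply: (subset_measure0 _ _ _ (restrict_compl_null mu mE)).
  + rewrite -[X in measurable X]setTI; apply: (measurable_affine y _ measurableT).
    by apply: measurableC; exact: measurable_eball.
  + exact: measurableC.
  + move=> z /= h zJ; apply: h.
    rewrite -[X in edist X _]addr0 -(scaler0 _ (d / (J%:R + 1))%R) edistDl edistZ gtr0_norm //.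
    rewrite mulrAC ltr_pdivrMr // ltr_pM2l //; move: zJ; lra.
- move=> z; set a := (d / (J%:R + 1))%R.
  have {1}-> : z = (y + a *: (a^-1 *: (z - y)))%R.
    by rewrite scalerA mulfV ?gt_eqF // scale1r addrC subrK.
  rewrite pot_affine // -[leRHS]mule1 lee_wpmul2l ?lee_fin ?powR_ge0 //.
  exact: le_trans (pot_restrict_le _ _ _ _) (mu1 _).
Qed.

(** An inequality valid nearly everywhere on an open set holds everywhere on it. Otherwise
    [thin_estimate] bounds the potential at [y] of a test measure by [eta] times its supremum; the
    chosen [eta] makes this half of what the mass [m] forces. *)
Lemma thick_at_interior mu0 nu (O : set pt) y : radon mu0 -> (forall x, pot mu0 x <= 1) ->
  mu0 [set: Rn R n] != 0 -> Mplus alpha nu -> open O -> O y ->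
  cap alpha [set z | O z /\ pot nu z < 1] = 0 -> 1 <= pot nu y.
Proof.
move=> r0 p1 T0 Mnu oO Oy capO; rewrite leNgt; apply/negP => nu1.
have [m [j [m0 j0 Htau]]] := test_measure r0 p1 T0.
pose eta := (m / (2 * j `^ s))%R.
have js0 : (0 < j `^ s)%R by rewrite powR_gt0.
have eta0 : (0 < eta)%R by rewrite divr_gt0 // mulr_gt0.
have [d1 d10 Hd1] := thin_estimate aln Mnu nu1 eta0.
have [d2 d20 Hd2] := (open_edistP O).1 oO y Oy.
pose d := Num.min d1 d2; have d0 : (0 < d)%R by rewrite lt_min d10.
have [tau [tauT tauC tauM]] := Htau y d d0.
have tauf : tau [set: Rn R n] < +oo by rewrite tauT ltry.
have rtau := radon_finite tauf.
have mB := measurable_eball y d.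
have mN : measurable ([set z | pot nu z < 1] : set (Rn R n)).
  rewrite -[X in measurable X]setTI; apply: emeasurable_fun_infty_o => //.
  by apply: measurable_pot; case: Mnu.
set N := [set z | pot nu z < 1] in mN.
have N0 : tau N = 0.
  have mNB : measurable (N `&` eball y d : set (Rn R n)) by exact: measurableI.
  have NB0 : tau (N `&` eball y d) = 0.
    apply: (cap0_null capO rtau tauM mNB) => [z [Nz]|].
      by rewrite /= lt_min => /andP[_ zd]; split => //; exact: Hd2.
    by apply: le_lt_trans tauf; rewrite le_measure ?inE.
  apply: (subset_measure0 (B := (N `&` eball y d) `|` ~` eball y d : set (Rn R n)) mN).
  - by apply: measurableU => //; exact: measurableC.
  - move=> z Nz; have [zB|zB] := pselect (eball y d z); [by left|by right].
  - by apply/eqP; rewrite eq_le measure_ge0 andbT -[0]adde0 -{1}NB0 -tauC;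
      apply: measureU2 => //; exact: measurableC.
have tau1 : tau (~` eball y d1) = 0.
  apply: (subset_measure0 _ _ _ tauC) => //.
  - by apply: measurableC; exact: measurable_eball.
  - exact: measurableC.
  - by move=> z /= h zd; apply: h; move: zd; rewrite lt_min => /andP[].
have up := Hd1 tau _ rtau tau1 N0 tauM.
have lo : (d `^ (alpha - n%:R))%:E * m%:E <= pot tau y.
  by rewrite -tauT; apply: (pot_near_lb aln mB tauC d0) => w /ltW.
have ds0 : (0 < d `^ (alpha - n%:R))%R by rewrite powR_gt0.
have jE : ((d / j) `^ (alpha - n%:R) = d `^ (alpha - n%:R) * j `^ s)%R.
  have -> : (j^-1 = j `^ (-1))%R by rewrite powR_inv1 // ltW.
  by rewrite powRM ?powR_ge0 ?ltW // -powRrM mulN1r opprB.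
have := le_trans lo up; rewrite -EFinM lee_fin jE.
have -> : (eta * (d `^ (alpha - n%:R) * j `^ s) = d `^ (alpha - n%:R) * (m / 2))%R.
  by rewrite /eta; field; rewrite gt_eqF.
by rewrite ler_pM2l // leNgt ltr_pdivrMr // ltr_pMr // ltr1n.
Qed.

End TestMeasures.

(** * Measures with a prescribed density, up to rounding *)

Section Density.
Variables (R : realType) (n : nat).
Local Notation RM := (@RMeasure R n).
Implicit Types (g : RM) (h f : Rn R n -> \bar R).
Local Open Scope ereal_scope.

(** Summed over [j] it rounds a nonnegative [x] up to an integer, whence the bounds [x] and
    [x + 1]. *)
Definition layer (x : \bar R) (j : nat) : \bar R := (j%:R%:E < x)%E%:R%:E.

Lemma layer_ge0 x j : 0 <= layer x j. Proof. by rewrite lee_fin. Qed.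

Lemma layer_sum_ge (x : R) N : (0 <= x)%R -> (Num.min x N%:R)%:E <= \sum_(0 <= j < N) layer x%:E j.
Proof.
move=> x0; elim: N => [|N IH]; first by rewrite big_geq // lee_fin ge_min lexx orbT.
rewrite big_nat_recr //= /layer lte_fin; have [Nx|xN] := ltP N%:R x.
  apply: (@le_trans _ _ ((Num.min x N%:R)%:E + 1)); last exact: leeD.
  by rewrite -EFinD lee_fin (min_idPr (ltW Nx)) ge_min; apply/orP; right; rewrite -natr1.
apply: (@le_trans _ _ (Num.min x N%:R)%:E); last by rewrite adde0.
by rewrite (min_idPl xN) lee_fin ge_min lexx.
Qed.

Lemma layer_sum_le (x : R) N : (0 <= x)%R ->
  \sum_(0 <= j < N) layer x%:E j <= (Num.min (x + 1) N%:R)%:E.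
Proof.
move=> x0; elim: N => [|N IH]; first by rewrite big_geq // lee_fin le_min addr_ge0 /=.
rewrite big_nat_recr //= /layer lte_fin; have [Nx|xN] := ltP N%:R x.
  apply: (@le_trans _ _ (N%:R%:E + 1)).
    by apply: leeD => //; apply: le_trans IH _; rewrite lee_fin ge_min lexx orbT.
  by rewrite -EFinD lee_fin le_min lerD2r (ltW Nx) natr1 lexx.
rewrite adde0; apply: le_trans IH _; rewrite lee_fin le_min ge_min lexx /=.
by rewrite ge_min ler_nat leqnSn orbT.
Qed.

Lemma layer_series_ge (x : \bar R) : 0 <= x -> x <= \sum_(0 <= j <oo) layer x j.
Proof.
have H N y : \sum_(0 <= j < N) layer y j <= \sum_(0 <= j <oo) layer y j.
  by apply: nneseries_lim_ge => i _ _; exact: layer_ge0.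
case: x => [x| |//]; last first.
  move=> _; rewrite leye_eq; apply/eqP/eqyP => A A0.
  apply: le_trans (H (Num.truncn A).+1 +oo).
  rewrite (eq_bigr (fun=> 1)); last by move=> i _; rewrite /layer ltry.
  rewrite big_mkord sumEFin sumr_const card_ord lee_fin.
  by rewrite ltW // -mulr_natl mulr1; have /andP[] := truncn_itv (ltW A0).
rewrite lee_fin => x0; apply: le_trans (H (Num.truncn x).+1 _).
apply: le_trans (layer_sum_ge _ x0); rewrite lee_fin le_min lexx /=.
by rewrite ltW //; have /andP[] := truncn_itv x0.
Qed.

Lemma layer_series_le (x : \bar R) : 0 <= x -> \sum_(0 <= j <oo) layer x j <= x + 1.
Proof.
case: x => [x| |//]; last by rewrite addye ?leey.
rewrite lee_fin => x0; apply: lime_le.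
  by apply: is_cvg_nneseries => i _ _; exact: layer_ge0.
apply: nearW => N; apply: le_trans (layer_sum_le N x0) _.
by rewrite -EFinD lee_fin ge_min lexx.
Qed.

(* [lam] is the sum over [j] of the restrictions of [g] to [h > j], whose density
   is [h] rounded up. *)
Lemma density_measure g h : measurable_fun [set: Rn R n] h -> (forall w, 0 <= h w) ->
  exists lam : RM, (forall f, measurable_fun [set: Rn R n] f -> (forall w, 0 <= f w) ->
      \int[g]_w (h w * f w) <= \int[lam]_w f w) /\
    lam [set: Rn R n] <= \int[g]_w (h w + 1).
Proof.
move=> mh h0.
pose Ej (j : nat) : set (Rn R n) := [set w | j%:R%:E < h w].
have mE (j : nat) : measurable (Ej j).
  by rewrite -[X in measurable X]setTI; exact: emeasurable_fun_o_infty.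
have lE (j : nat) w : (\1_(Ej j) w)%:E = layer (h w) j.
  rewrite indicE /layer; congr (nat_of_bool _)%:R%:E.
  by apply/idP/idP => [/set_mem|hj] //; apply/mem_set.
pose lj (j : nat) : RM := restrict_meas g (mE j).
exists (mseries lj 0).
have mL (j : nat) : measurable_fun [set: Rn R n] (fun w : Rn R n => layer (h w) j).
  rewrite (_ : (fun w => _) = (fun w => (\1_(Ej j) w)%:E)).
    by apply/measurable_EFinP; exact: measurable_indic.
  by apply/funext => w; rewrite lE.
have ljE j f : measurable_fun [set: Rn R n] f -> (forall w, 0 <= f w) ->
    \int[lj j]_w f w = \int[g]_w (layer (h w) j * f w).
  move=> mf f0; rewrite (integral_restrict_meas g (mE j) mf f0) [LHS]integral_mkcond.
  apply: eq_integral => w _; rewrite patchE -lE indicE.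
  by case: ifPn => _; rewrite ?mul1e ?mul0e.
have E f : measurable_fun [set: Rn R n] f -> (forall w, 0 <= f w) ->
    \int[mseries lj 0]_w f w = \int[g]_w \sum_(0 <= j <oo) (layer (h w) j * f w).
  move=> mf f0; transitivity (\sum_(0 <= j <oo) \int[lj j]_w f w).
    exact: (ge0_integral_measure_series lj measurableT (fun w _ => f0 w) mf).
  rewrite (eq_eseriesr (fun j _ => ljE j f mf f0)).
  apply/esym; apply: (@integral_nneseries _ _ _ g _ measurableT (fun j w => layer (h w) j * f w)).
    by move=> j; apply: emeasurable_funM.
  by move=> j w _; apply: mule_ge0 (layer_ge0 _ _) (f0 w).
have mS f : measurable_fun [set: Rn R n] f -> (forall w, 0 <= f w) ->
    measurable_fun [set: Rn R n] (fun w => \sum_(0 <= j <oo) (layer (h w) j * f w)).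
  move=> mf f0; apply: ge0_emeasurable_sum => [j w _ _|j _].
    by apply: mule_ge0 (layer_ge0 _ _) (f0 w).
  exact: emeasurable_funM.
have S0 f w : (forall w, 0 <= f w) -> 0 <= \sum_(0 <= j <oo) (layer (h w) j * f w).
  by move=> f0; apply: nneseries_ge0 => j _ _; apply: mule_ge0 (layer_ge0 _ _) (f0 w).
split=> [f mf f0|].
  rewrite E //; apply: ge0_le_integral_Rn => //; [exact: emeasurable_funM|exact: mS| |].
    by move=> w; apply: mule_ge0.
  (* A finite [f w] factors out of the series; when [f w] is infinite, the first layer alone gives
     [+oo] unless [h w = 0]. *)
  move=> w; have [r [fE|fE]] : exists r : R, f w = r%:E \/ f w = +oo.
    by move: (f0 w); case: (f w) => [r _| _|//]; [exists r; left|exists 0%R; right].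
    rewrite fE (eq_eseriesr (fun j _ => muleC _ _)) nneseriesZl; last first.
      by move=> j _; exact: layer_ge0.
    rewrite muleC; apply: lee_wpmul2l (layer_series_ge (h0 w)).
    by rewrite -fE.
  have [->|hw] := eqVneq (h w) 0.
    by rewrite mul0e; apply: nneseries_ge0 => j _ _; apply: mule_ge0 (layer_ge0 _ _) (f0 w).
  rewrite fE; apply: (@le_trans _ _ (\sum_(0 <= j < 1) (layer (h w) j * +oo))).
    rewrite big_nat1 /layer lt_neqAle eq_sym hw h0 mul1e; exact: leey.
  by apply: nneseries_lim_ge => j _ _; apply: mule_ge0 (layer_ge0 _ _) _.
apply: (@le_trans _ _ (\int[mseries lj 0]_w (cst 1 w))).
  by rewrite integral_cst // mul1e.
rewrite E //; apply: ge0_le_integral_Rn => //.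
- exact: mS.
- by apply: emeasurable_funD.
- by move=> w; exact: (S0 (cst 1) w).
move=> w; rewrite (eq_eseriesr (fun j _ => mule1 _)); exact: layer_series_le.
Qed.
End Density.

(** * Single points and capacity *)

Section RegularPoints.
Variables (R : realType) (n : nat) (alpha : R).
Hypothesis aln : alpha < n%:R.
Local Notation RM := (@RMeasure R n).
Local Notation pt := (pt R n).
Local Notation k := (kappa alpha).
Local Notation pot := (pot alpha).
Implicit Types (mu nu : RM) (x y z : pt).
Local Open Scope ereal_scope.

Lemma powR_large (K : R) : (0 < K)%R ->
  exists2 d0 : R, (0 < d0)%R & forall d, (0 < d <= d0)%R -> (K <= d `^ (alpha - n%:R))%R.
Proof.
move=> K0; have e0 : (alpha - n%:R < 0)%R by rewrite subr_lt0.
exists (K `^ (alpha - n%:R)^-1)%R; first by rewrite powR_gt0.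
move=> d /andP[d0 dd]; have := powR_le_decr (ltW e0) d0 dd.
by rewrite -powRrM mulVf ?lt_eqF // powRr1 // ltW.
Qed.

Lemma finite_energy_atomless mu y : radon mu -> energy alpha mu < +oo -> mu [set y] = 0.
Proof.
move=> rmu en; have m1 := measurable_set1_Rn y.
have [py|py] := boolP (pot mu y < +oo); first exact: pot_lty_atomless py.
have {}py : pot mu y = +oo by apply/eqP; rewrite -leye_eq leNgt.
have [//|my] := eqVneq (mu [set y]) 0; move: en; rewrite ltNge => /negP[].
have m0 : 0 < mu [set y] by rewrite lt_neqAle eq_sym my measure_ge0.
rewrite -(gt0_mulye m0) -integral_cst //.
rewrite /energy integral_mkcond; apply: ge0_le_integral_Rn.
- by apply/(measurable_restrictT _ m1); exact: measurable_cst.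
- exact: measurable_pot.
- by move=> z; rewrite patchE; case: ifP => // _; exact: leey.
move=> z; rewrite patchE; case: ifPn => [/set_mem ->|_]; last exact: pot_ge0.
by have -> : \int[mu]_(w in [set: Rn R n]) k y w = +oo by exact: py.
Qed.

(** A measure of finite energy has no atoms. This discards the pole [y] when kernels with pole [y]
    are compared nearly everywhere. *)
Lemma cap0_setU1 (E F : set pt) y : F `<=` E `|` [set y] -> cap alpha E = 0 -> cap alpha F = 0.
Proof.
move=> FE /cap_eq0P cE; apply/cap_eq0P => mu [[rmu px] [en cmu]].
apply: cE; split; first by split.
split => //; have my := finite_energy_atomless y rmu en.
have m1 := measurable_set1_Rn y.
have ny : mu.-negligible [set y] by exists [set y]; split => //; exact: subset_refl.
apply: negligibleS (negligibleU cmu ny) => z Ez.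
have [->|zy] := pselect (z = y); first by right.
by left => Fz; case: (FE z Fz).
Qed.
End RegularPoints.

(** * Potentials at regular points *)

Section RegularPotential.
Variables (R : realType) (n : nat) (alpha : R).
Hypotheses (aln : alpha < n%:R) (n_gt0 : (0 < n)%N).
Local Notation RM := (@RMeasure R n).
Local Notation pt := (pt R n).
Local Notation k := (kappa alpha).
Local Notation pot := (pot alpha).
Local Notation s := (n%:R - alpha).
Implicit Types (mu nu : RM) (x y z : pt).
Local Open Scope ereal_scope.

Lemma le_half_quarter (P : R) : (P <= P / 2 + P / 4 -> 0 < P -> False)%R.
Proof. by move=> ? ?; lra. Qed.

(** By Tonelli the integral of [pot mu] against [tau] is that of the bounded [pot tau] against the
    finite [mu]; it is finite, so [pot mu] is not identically [+oo]. *)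
Lemma pot_lty_of_tau mu tau (M : R) : mu [set: Rn R n] < +oo -> radon tau ->
  tau [set: Rn R n] != 0 -> (forall z, pot tau z <= M%:E) -> exists x, pot mu x < +oo.
Proof.
move=> mu_lty rtau tau0 HM; have rmu := radon_finite mu_lty.
apply: contrapT => H.
have {}H x : pot mu x = +oo.
  by apply/eqP; rewrite -leye_eq leNgt; apply/negP => h; apply: H; exists x.
have : \int[tau]_x pot mu x < +oo.
  rewrite (pot_tonelli alpha rtau rmu).
  apply: (@le_lt_trans _ _ (\int[mu]_x (cst M%:E x))).
    apply: ge0_le_integral_Rn => //; first exact: measurable_pot.
    by move=> x; exact: pot_ge0.
  have M0 : (0 <= M)%R by rewrite -lee_fin (le_trans (pot_ge0 alpha tau 0%R) (HM _)).
  by rewrite integral_cst // lte_mul_pinfty // lee_fin.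
rewrite (eq_integral (cst +oo)); last by move=> x _; exact: H.
by rewrite integral_cst // gt0_mulye ?ltxx // lt_neqAle eq_sym tau0 measure_ge0.
Qed.

Lemma add_scale_Mplus (lam tau : RM) (y : pt) (c t : {nonneg R}) (M : R) :
  lam [set: Rn R n] < +oo -> radon tau -> tau [set: Rn R n] != 0 ->
  (forall z, pot tau z <= M%:E) ->
  Mplus alpha (add_meas (scale_meas c lam) (scale_meas t (dirac_pt y))).
Proof.
move=> lam_lty rtau tau0 HM.
have rdir : radon (dirac_pt y) by exact: radon_dirac.
split.
  by apply: radon_add; apply: radon_scale => //; exact: radon_finite.
have d_lty : dirac_pt y [set: Rn R n] < +oo.
  have -> : dirac_pt y [set: Rn R n] = 1 by exact: diracT.
  exact: ltry.
have sum_lty : add_meas lam (dirac_pt y) [set: Rn R n] < +oo.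
  by rewrite /add_meas [X in X < _]measure_addE lte_add_pinfty.
have [x] := pot_lty_of_tau sum_lty rtau tau0 HM.
rewrite pot_add => px; exists x; rewrite pot_add !pot_scale.
have [p1 p2] : pot lam x < +oo /\ pot (dirac_pt y) x < +oo.
  split; apply: le_lt_trans px; rewrite ?leeDl ?leeDr //; exact: pot_ge0.
by rewrite lte_add_pinfty // lte_mul_pinfty.
Qed.

(* If [pot nu y < 1], the mass of [nu] near [y] weighted by [k y], completed by a
   point mass off [y], competes for the balayage of [dirac_pt y]; tested against
   measures concentrating at [y], its potential is too small. *)
Lemma regular_pot_ge1 (A : set pt) mu0 nu y : radon mu0 -> (forall x, pot mu0 x <= 1) ->
  mu0 [set: Rn R n] != 0 -> Mplus alpha nu ->
  nearly_on alpha A (fun z => 1 <= pot nu z) -> regular_pts alpha A y -> 1 <= pot nu y.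
Proof.
move=> r0 p1 T0 Mnu nuA [_ regE]; rewrite leNgt; apply/negP => nu1.
have [c c0 Hc] := thin_localization aln Mnu nu1.
have [m [j [m0 j0 Htau]]] := test_measure aln r0 p1 T0.
have js0 : (0 < j `^ s)%R by rewrite powR_gt0.
have s20 : (0 < 2 `^ s :> R)%R by rewrite powR_gt0.
pose C := (2 `^ s * (2 / c))%R.
have C0 : (0 < C)%R by rewrite mulr_gt0 // divr_gt0.
(* The first bound permits the absorption in [kappa_le_double_pot], the second makes [lam]
   contribute at most half of the final inequality. *)
pose e := Num.min (c / 2 / 2 `^ s)%R (m / (4 * C * j `^ s))%R.
have e0 : (0 < e)%R.
  rewrite lt_min (divr_gt0 (divr_gt0 c0 (ltr0Sn _ 1)) s20).
  exact: (divr_gt0 m0 (mulr_gt0 (mulr_gt0 (ltr0Sn _ 3) C0) js0)).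
have e1 : (2 `^ s * e <= c / 2)%R.
  by rewrite mulrC -ler_pdivlMr // ge_min lexx.
have e2 : (C * j `^ s * (2 * e) <= m / 2)%R.
  have : (e <= m / (4 * C * j `^ s))%R by rewrite ge_min lexx orbT.
  rewrite -(mulrA 4%R) ler_pdivlMr; last exact: (mulr_gt0 (ltr0Sn _ 3) (mulr_gt0 C0 js0)).
  by move: (C * j `^ s)%R => P; lra.
have [r [d [/andP[d0 dr] r1 pe Hd]]] := Hc e 1%R e0 ltr01.
have mB := measurable_eball y r.
set g := restrict_meas nu mB in pe Hd.
have mky := measurable_kappa alpha y.
(* Since [r <= 1], [k y] is at least [1] on the ball; so the rounding error [1] in the density at
   most doubles the mass, which is at most [2 * e]. *)
have [lam [Hlam lamT]] := density_measure g mky (kappa_ge0 alpha y).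
have {}lamT : lam [set: Rn R n] <= (2 * e)%:E.
  apply: (le_trans lamT); apply: (@le_trans _ _ (\int[g]_w (2%:E * k y w))).
    apply: (integral_null_compl (F := eball y r)) => //.
    - exact: restrict_compl_null.
    - by apply: emeasurable_funD.
    - exact: measurable_kappaZ.
    - by move=> w; apply: adde_ge0 => //; exact: kappa_ge0.
    - by move=> w; apply: mule_ge0 => //; exact: kappa_ge0.
    move=> w /= yw; have kw : 1 <= k y w.
      have := kappa_lb aln ltr01 (_ : edist y w <= 1)%R; rewrite powR1; apply.
      by rewrite (le_trans (ltW yw)).
    have -> : 2%:E * k y w = k y w + k y w.
      by rewrite mule_natl mule2n.
    by apply: leeD.
  rewrite (ge0_integral_RnZl g mky (kappa_ge0 alpha y)) ?lee_fin // EFinM.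
  by apply: lee_wpmul2l; rewrite ?lee_fin.
have lam_lty : lam [set: Rn R n] < +oo by apply: le_lt_trans lamT _; exact: ltry.
have rlam := radon_finite lam_lty.
(* Points at distance at least [d] from [y] are at most twice as far from [y'], so a mass 2^s at
   [y'] dominates [k y] there. *)
have [y' yy'] := edist_surj n_gt0 y (ltW d0).
pose Q := add_meas (scale_meas (NngNum (ltW C0)) lam)
  (scale_meas (NngNum (ltW s20)) (dirac_pt y')).
have QE z : pot Q z = C%:E * pot lam z + (2 `^ s)%:E * k y' z.
  by rewrite pot_add !pot_scale pot_dirac kappaC.
have Qcomp : nearly_on alpha A (fun z => pot (dirac_pt y) z <= pot Q z).
  apply: (cap0_setU1 (y := y) _ nuA) => z [Az zQ].
  have [->|/eqP zy] := pselect (z = y); first by right.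
  left; split => // nuz; apply: zQ.
  rewrite pot_dirac kappaC QE; have [yz|yz] := ltP (edist y z) d.
    have yz' : y != z by rewrite eq_sym.
    apply: (le_trans (kappa_le_double_pot aln yz' c0 e1 pe (Hd z yz nuz))).
    apply: (@le_trans _ _ (C%:E * pot lam z)).
      apply: lee_wpmul2l; first by rewrite lee_fin ltW.
      exact: (Hlam _ (measurable_kappa alpha z) (kappa_ge0 alpha z)).
    by rewrite leeDl // mule_ge0 ?kappa_ge0 // lee_fin ltW.
  apply: (@le_trans _ _ ((2 `^ s)%:E * k y' z)).
    apply: kappa_le_dist => //; have := edist_triangle y y' z.
    by rewrite (edistC y' y) yy'; move: yz; lra.
  by rewrite leeDr // mule_ge0 ?pot_ge0 // lee_fin ltW.
have [d1 d10 Hd1] := @powR_large R n alpha aln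
  (4 * (2 `^ s * (d / 2) `^ (alpha - n%:R)))%R (mulr_gt0 (ltr0Sn _ 3) (mulr_gt0 s20
    (powR_gt0 _ (divr_gt0 d0 (ltr0Sn _ 1))))).
(* At most [d / 2] keeps the test measure away from [y']; at most [d1] makes the point mass
   contribute at most a quarter. *)
pose dl := Num.min d1 (d / 2)%R.
have dl0 : (0 < dl)%R by rewrite lt_min d10 divr_gt0.
have {Hd1} Hdl : (4 * (2 `^ s * (d / 2) `^ (alpha - n%:R)) <= dl `^ (alpha - n%:R))%R.
  by apply: Hd1; rewrite dl0 /dl ge_min lexx.
have [tau [tauT tauC tauM]] := Htau y dl dl0.
have tauf : tau [set: Rn R n] < +oo by rewrite tauT ltry.
have rtau := radon_finite tauf.
have tau0 : tau [set: Rn R n] != 0 by rewrite tauT gt_eqF // lte_fin.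
have MQ : Mplus alpha Q by exact: (add_scale_Mplus _ _ _ lam_lty rtau tau0 tauM).
(* Regularity enters here: the Dirac mass at [y] is its own balayage, so its potential is the
   infimum, and the competitor [Q] dominates it at every point. *)
have Qge x : k y x <= C%:E * pot lam x + (2 `^ s)%:E * k y' x.
  rewrite -QE kappaC -pot_dirac regE; apply: ereal_inf_lbound.
  by exists Q.
have mBl := measurable_eball y dl.
have lo : (dl `^ (alpha - n%:R))%:E * m%:E <= pot tau y.
  by rewrite -tauT; apply: (pot_near_lb aln mBl tauC dl0) => w /ltW.
have mpl := measurable_pot alpha rlam.
have pl0 z : 0 <= C%:E * pot lam z by rewrite mule_ge0 ?pot_ge0 // lee_fin ltW.
have kl0 z : 0 <= (2 `^ s)%:E * k y' z by rewrite mule_ge0 ?kappa_ge0 // lee_fin ltW.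
have mCl : measurable_fun [set: Rn R n] (fun z : Rn R n => C%:E * pot lam z).
  by apply: emeasurable_funM => //; exact: measurable_cst.
have up : pot tau y <= C%:E * \int[tau]_x pot lam x + (2 `^ s)%:E * pot tau y'.
  apply: (@le_trans _ _ (\int[tau]_x (C%:E * pot lam x + (2 `^ s)%:E * k y' x))).
    apply: ge0_le_integral_Rn => //; last exact: kappa_ge0.
    apply: emeasurable_funD => //; exact: measurable_kappaZ.
  rewrite (ge0_integral_RnD tau mCl (measurable_kappaZ alpha (2 `^ s)%:E y') pl0 kl0).
  rewrite (ge0_integral_RnZl tau mpl (pot_ge0 alpha lam)) ?lee_fin ?(ltW C0) //.
  by rewrite (ge0_integral_RnZl tau (measurable_kappa alpha y') (kappa_ge0 alpha y'))
    ?lee_fin ?(ltW s20).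
pose M := ((dl / j) `^ (alpha - n%:R))%R.
have M0 : (0 <= M)%R by exact: powR_ge0.
have up1 : \int[tau]_x pot lam x <= (M * (2 * e))%:E.
  rewrite (pot_tonelli alpha rtau rlam).
  apply: (@le_trans _ _ (\int[lam]_x (cst M%:E x))).
    exact: (ge0_le_integral_Rn lam (measurable_pot alpha rtau) (measurable_cst M%:E)
      (pot_ge0 alpha tau) tauM).
  by rewrite integral_cst // EFinM; apply: lee_wpmul2l; rewrite ?lee_fin.
have d20 : (0 < d / 2)%R by rewrite divr_gt0.
have up2 : pot tau y' <= ((d / 2) `^ (alpha - n%:R))%:E * m%:E.
  rewrite -tauT; apply: (pot_far_ub aln mBl tauC d20) => w /=; rewrite lt_min => /andP[_ yw].
  by have := edist_triangle w y y'; rewrite yy' (edistC w y'); move: yw; lra.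
have := le_trans lo up.
have := lee_wpmul2l (_ : 0 <= C%:E) up1; rewrite lee_fin (ltW C0) => /(_ isT) H1.
have := lee_wpmul2l (_ : 0 <= (2 `^ s)%:E) up2; rewrite lee_fin (ltW s20) => /(_ isT) H2 H3.
have := le_trans H3 (leeD H1 H2); rewrite -!EFinM -EFinD lee_fin.
have jE : (M = dl `^ (alpha - n%:R) * j `^ s)%R.
  have jV : (j^-1 = j `^ (-1))%R by rewrite powR_inv1 // ltW.
  by rewrite /M jV powRM ?powR_ge0 ?ltW // -powRrM mulN1r opprB.
rewrite jE => H4.
have D0 : (0 < dl `^ (alpha - n%:R))%R by rewrite powR_gt0.
have {}H4 : (dl `^ (alpha - n%:R) * m <= dl `^ (alpha - n%:R) * (m / 2)
    + dl `^ (alpha - n%:R) / 4 * m)%R.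
  apply: (le_trans H4); apply: lerD.
    have -> : (C * (dl `^ (alpha - n%:R) * j `^ s * (2 * e)) =
        dl `^ (alpha - n%:R) * (C * j `^ s * (2 * e)))%R by ring.
    by rewrite ler_pM2l.
  by rewrite [leLHS]mulrA ler_pM2r // ler_pdivlMr // mulrC.
have := mulr_gt0 D0 m0; move: H4; rewrite mulrA [X in (_ <= _ + X)%R]mulrAC.
exact: le_half_quarter.
Qed.
End RegularPotential.

(** * Minimum principle for lower semicontinuous functions *)

Section MinimumPrinciple.
Variables (R : realType) (n : nat).
Hypothesis n_gt0 : (0 < n)%N.
Local Notation pt := (pt R n).
Local Notation e_ i := (delta_mx ord0 i : pt).
Implicit Types (x y z : pt).

Lemma lsc_minimum_principle (F : pt -> \bar R) y (r : R) : 0 < r ->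
  (forall x, (0 <= F x)%E) ->
  (forall x (c : \bar R), edist y x <= r -> (c < F x)%E ->
     exists2 d : R, 0 < d & forall x', edist x x' < d -> (c < F x')%E) ->
  (forall x, edist y x = r -> (1 <= F x)%E) ->
  (forall x (e : R), edist y x < r -> 0 < e -> exists2 h0 : R, 0 < h0 &
     forall h, 0 < h <= h0 ->
       (shift_sum F x h <= (2 * n%:R + e * h ^+ 2)%:E * F x)%E) ->
  (1 <= F y)%E.
Proof.
move=> r0 F0 lsc bd int; rewrite leNgt; apply/negP => Fy.
(* Truncation at a level above [1] gives a real function that agrees with [F] where [F < 1];
   elsewhere it can only decrease, which is harmless for the upper bound on the neighbours. *)
pose v x := fine (Order.min (F x) 2%:E).
have vE x : (v x)%:E = Order.min (F x) 2%:E.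
  rewrite /v fineK // ge0_fin_numE; last by rewrite le_min F0 lee_fin ler0n.
  by rewrite gt_min ltry orbT.
have v0 x : 0 <= v x by rewrite -lee_fin vE le_min F0 lee_fin ler0n.
have vF x : ((v x)%:E <= F x)%E by rewrite vE ge_min lexx.
have vyE : (v y)%:E = F y.
  by rewrite vE; apply/min_idPl; rewrite (le_trans (ltW Fy)) // lee_fin ler1n.
have vy1 : v y < 1 by rewrite -lte_fin vyE.
(* As the quadratic term stays below [1 - v y], the maximum of [V] is at a point with [v < 1], hence
   strictly inside the ball. *)
pose e := (1 - v y) / (2 * r ^+ 2).
have r2 : 0 < r ^+ 2 by rewrite exprn_gt0.
have e0 : 0 < e by rewrite divr_gt0 ?subr_gt0 // mulr_gt0.
have er : e * r ^+ 2 < 1 - v y.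
  have -> : e * r ^+ 2 = (1 - v y) / 2 by rewrite /e; field; rewrite gt_eqF.
  by rewrite ltr_pdivrMr // ltr_pMr ?subr_gt0 // ltr1n.
pose C : set pt := [set x | edist y x <= r].
have cC : compact C by exact: compact_ecball.
pose V x := - v x + e * edist y x ^+ 2.
have C0 : C !=set0 by exists y; rewrite /C /= edistxx ltW.
have [|x1 Cx1 Hmax] := @usc_maximum R n C V cC C0.
  move=> x c Cx Vc; pose d := (c - V x) / 2.
  have d0 : 0 < d by rewrite divr_gt0 // subr_gt0.
  have lv : ((v x - d)%:E < F x)%E.
    by apply: lt_le_trans (vF x); rewrite lte_fin ltrBlDr ltrDl.
  have [r1 r10 Hr1] := lsc x _ Cx lv.
  have [r2' r20 Hr2] := @edist_sqr_usc R n y x (d / e) (divr_gt0 d0 e0).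
  exists (Num.min r1 r2'); first by rewrite lt_min r10.
  move=> x' Cx'; rewrite lt_min => /andP[xr1 xr2].
  have vx' : v x - d < v x'.
    rewrite -lte_fin vE lt_min (Hr1 _ xr1) lte_fin /=.
    have : v x <= 2 by rewrite -lee_fin vE ge_min lexx orbT.
    by move: d0; lra.
  have ed : e * (d / e) = d by rewrite mulrC divfK // gt_eqF.
  have : e * edist y x' ^+ 2 < e * edist y x ^+ 2 + d.
    by rewrite -[X in _ + X]ed -mulrDr ltr_pM2l //; exact: Hr2.
  by move: vx' Vc; rewrite /d /V; lra.
have v1 : v x1 < 1.
  have Cy : C y by rewrite /C /= edistxx ltW.
  have := Hmax y Cy; rewrite /V edistxx expr0n mulr0 addr0 => h.
  have : e * edist y x1 ^+ 2 <= e * r ^+ 2.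
    by rewrite ler_pM2l //; apply: lerXn2r Cx1; rewrite nnegrE ?edist_ge0 ?ltW.
  by move: h er; lra.
have FE : F x1 = (v x1)%:E.
  rewrite vE; have [//|h] := leP (F x1) 2%:E.
  move: v1; rewrite -lte_fin vE; case: leP h => // _ _.
  by rewrite lte_fin ltNge ler1n.
have x1r : edist y x1 < r.
  rewrite lt_neqAle Cx1 andbT; apply/negP => /eqP /bd; rewrite FE lee_fin.
  by rewrite leNgt v1.
have n0 : 0 < n%:R :> R by rewrite ltr0n.
have e10 : 0 < e * n%:R by rewrite mulr_gt0.
have [h0 h00 Hh] := int x1 _ x1r e10.
pose h := Num.min h0 ((r - edist y x1) / 2).
have h_gt0 : 0 < h by rewrite lt_min h00 divr_gt0 // subr_gt0.
have hr : h < r - edist y x1.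
  by rewrite gt_min; apply/orP; right; rewrite ltr_pdivrMr // ltr_pMr ?subr_gt0 // ltr1n.
have shiftC i (sg : R) : `|sg| = 1 -> C (x1 + (sg * h) *: e_ i).
  move=> sg1; rewrite /C /=; apply: le_trans (edist_triangle x1 _ _) _.
  by rewrite edist_delta normrM sg1 mul1r gtr0_norm //; move: hr; lra.
have up : ((\sum_(i < n) (v (x1 + h *: e_ i) + v (x1 - h *: e_ i)))%:E <= shift_sum F x1 h)%E.
  rewrite -sumEFin; apply: lee_sum => i _; rewrite EFinD; exact: leeD.
have hh0 : 0 < h <= h0 by rewrite h_gt0 /h ge_min lexx.
have := le_trans up (Hh h hh0); rewrite FE -EFinM lee_fin => Hle.
have Hge : \sum_(i < n) (2 * v x1 + 2 * e * h ^+ 2) <=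
    \sum_(i < n) (v (x1 + h *: e_ i) + v (x1 - h *: e_ i)).
  apply: ler_sum => i _.
  have c1 := shiftC i 1 (normr1 _); have c2 := shiftC i (-1) _.
  have E1 := sqr_edist_shift x1 y h i; have E2 := sqr_edist_shift x1 y (- h) i.
  rewrite mul1r in c1; rewrite mulN1r in c2; rewrite scaleNr sqrrN in E2.
  have {}c2 : C (x1 - h *: e_ i) by rewrite scaleNr in c2; apply: c2; rewrite normrN normr1.
  have := Hmax _ c1; have := Hmax _ c2; rewrite /V !(edistC y) E1 E2.
  set q := edist x1 y ^+ 2; set w := x1 _ _ - _; nra.
have := le_trans Hge Hle; rewrite sumr_const card_ord -[X in X <= _]mulr_natr.
have hh : 0 < h ^+ 2 by rewrite exprn_gt0.
have : e * n%:R * h ^+ 2 * v x1 <= e * n%:R * h ^+ 2.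
  by rewrite ler_piMr ?(ltW v1) // mulr_ge0 // ltW.
have := mulr_gt0 e10 hh.
by move: (h ^+ 2) => hh2; move: (v x1) => vx; clearbody e; move: (n%:R : R) => nn; clear; lra.
Qed.

End MinimumPrinciple.

(** * Inversion in a sphere and the reflected kernel *)

Section Inversion.
Variables (R : realType) (n : nat) (alpha : R).
Local Notation pt := (pt R n).
Local Notation k := (kappa alpha).
Local Notation s := (n%:R - alpha).
Variables (y : pt) (r : R).
Hypothesis r0 : 0 < r.
Implicit Types (x z : pt).

(* [refl z] is the image of [z] under the inversion in the sphere of radius [r]
   about [y] when [z] lies inside, and [z] itself otherwise; at the centre the
   power of [0] makes the ratio [1]. *)
Definition refl_ratio z : R := Num.max 1 ((edist z y / r) `^ (-2)).
Definition refl z : pt := y + refl_ratio z *: (z - y).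
Definition refl_kernel x z : \bar R := ((refl_ratio z `^ (s / 2))%:E * k x (refl z))%E.

Lemma refl_ratio_ge1 z : 1 <= refl_ratio z.
Proof. by rewrite /refl_ratio le_max lexx. Qed.

Lemma refl_ratio_out z : r <= edist z y -> refl_ratio z = 1.
Proof.
move=> h; apply/max_idPl.
have := @powR_le_decr R 1 (edist z y / r) (-2); rewrite powR1; apply => //.
by rewrite ler_pdivlMr // mul1r.
Qed.

Lemma refl_out z : r <= edist z y -> refl z = z.
Proof. by move=> /refl_ratio_out h; rewrite /refl h scale1r addrC subrK. Qed.

Lemma refl_kernel_out x z : r <= edist z y -> refl_kernel x z = k x z.
Proof.
by move=> h; rewrite /refl_kernel refl_ratio_out // refl_out // powR1 mul1e.
Qed.

Lemma refl_ratio_in z : z != y -> edist z y <= r -> refl_ratio z * edist z y ^+ 2 = r ^+ 2.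
Proof.
rewrite -edist_gt0 => d0 h; have q0 : 0 < edist z y / r by rewrite divr_gt0.
have E : (edist z y / r) `^ (-2) = r ^+ 2 / edist z y ^+ 2.
  rewrite powRN -[2]/(2%:R) powR_mulrn ?ltW // expr_div_n invf_div //.
rewrite /refl_ratio E (max_idPr _) ?divfK ?gt_eqF ?exprn_gt0 //.
rewrite ler_pdivlMr ?exprn_gt0 // mul1r; apply: lerXn2r => //; rewrite nnegrE ltW //.
Qed.

(** For [z] inside the ball and distinct from [y], the product of the ratio and the squared distance
    of [z] to [y] is [r^2]. So the last term vanishes for [x] on the sphere, and for [x = y] the
    right side becomes the ratio times [r^2]; in both cases the weight in [refl_kernel] cancels the
    ratio. *)
Lemma edist_refl x z : edist x (refl z) ^+ 2 =
  refl_ratio z * edist x z ^+ 2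
  + (1 - refl_ratio z) * (edist x y ^+ 2 - refl_ratio z * edist z y ^+ 2).
Proof.
rewrite !sqr_edist !mulr_sumr -sumrB mulr_sumr -big_split /=.
by apply: eq_bigr => i _; rewrite !mxE; ring.
Qed.

(** Reflected poles lie outside the ball, at a distance from [x] bounded below uniformly in [z]. *)
Lemma edist_refl_ge x z : z != y -> r - edist y x <= edist x (refl z).
Proof.
move=> zy; suff h : r <= edist y (refl z).
  by have := edist_triangle x y (refl z); move: h; lra.
have d0 : 0 < edist z y by rewrite edist_gt0.
have -> : edist y (refl z) = refl_ratio z * edist z y.
  rewrite /refl -[X in edist X _]addr0 -(scaler0 _ (refl_ratio z)) edistDl edistZ.
  rewrite ger0_norm ?(le_trans ler01 (refl_ratio_ge1 z)) //; congr (_ * _).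
  by rewrite -(edistDl y) addr0 (addrC y) subrK edistC.
have [h|h] := leP r (edist z y); first by rewrite refl_ratio_out // mul1r.
rewrite -(ler_pM2r d0) -mulrA -expr2 refl_ratio_in ?(ltW h) // expr2.
by rewrite ler_pM2l // ltW.
Qed.

Lemma refl_neq x z : edist y x < r -> z != y -> x != refl z.
Proof.
move=> h zy; rewrite -edist_gt0; apply: lt_le_trans (edist_refl_ge x zy).
by rewrite subr_gt0.
Qed.

Lemma refl_kernel_ge0 x z : (0 <= refl_kernel x z)%E.
Proof. by rewrite mule_ge0 ?kappa_ge0 // lee_fin powR_ge0. Qed.

Lemma refl_kernel_sphere x z : z != y -> edist x y = r -> refl_kernel x z = k x z.
Proof.
move=> zy xr; have [h|h] := leP r (edist z y); first exact: refl_kernel_out.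
have xz : x != z by apply: contraTneq h => <-; rewrite xr ltxx.
have a0 : 0 < refl_ratio z := lt_le_trans ltr01 (refl_ratio_ge1 z).
have E : edist x (refl z) ^+ 2 = refl_ratio z * edist x z ^+ 2.
  by rewrite edist_refl xr refl_ratio_in ?(ltW h) // subrr mulr0 addr0.
have d0 : 0 < edist x z ^+ 2 by rewrite exprn_gt0 // edist_gt0.
have xf : x != refl z.
  by apply/eqP => xf; have := mulr_gt0 a0 d0; rewrite -E {1}xf edistxx expr0n ltxx.
rewrite /refl_kernel !kappa_sqr // E -EFinM; congr EFin.
by rewrite powRM ?(ltW a0) ?(ltW d0) // mulrA powRN mulfV ?gt_eqF ?powR_gt0 // mul1r.
Qed.

Lemma refl_kernel_center z : z != y -> edist z y < r ->
  refl_kernel y z = (r `^ (alpha - n%:R))%:E.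
Proof.
move=> zy h; have a0 : 0 < refl_ratio z := lt_le_trans ltr01 (refl_ratio_ge1 z).
have E : edist y (refl z) ^+ 2 = refl_ratio z * r ^+ 2.
  rewrite edist_refl edistxx expr0n /= refl_ratio_in ?(ltW h) //.
  by rewrite (edistC y) refl_ratio_in ?(ltW h) //; ring.
have r20 : 0 < r ^+ 2 by rewrite exprn_gt0.
have yf : y != refl z by apply: refl_neq => //; rewrite edistxx.
rewrite /refl_kernel kappa_sqr // E -EFinM; congr EFin.
rewrite powRM ?(ltW a0) ?(ltW r20) // mulrA powRN mulfV ?gt_eqF ?powR_gt0 // mul1r.
rewrite -powR_mulrn ?(ltW r0) // -powRrM; congr (_ `^ _); by field.
Qed.

End Inversion.

(** * A Newtonian potential constant on a sphere and at most that at the centre *)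

Section InversionPotential.
Variables (R : realType) (n : nat) (alpha : R).
Hypotheses (aln : alpha < n%:R) (n_gt0 : (0 < n)%N) (alpha2 : alpha = 2).
Local Notation RM := (@RMeasure R n).
Local Notation pt := (pt R n).
Local Notation k := (kappa alpha).
Local Notation pot := (pot alpha).
Local Notation s := (n%:R - alpha).
Variables (y : pt) (r : R).
Hypothesis r0 : 0 < r.
Local Notation rk := (refl_kernel alpha y r).
Local Notation ratio := (refl_ratio y r).
Local Notation refl := (refl y r).
Implicit Types (mu nu : RM) (x z : pt).

Lemma refl_weight_gt0 z : 0 < ratio z `^ (s / 2).
Proof. by rewrite powR_gt0 // (lt_le_trans ltr01) // refl_ratio_ge1. Qed.

Lemma measurable_refl_ratio : measurable_fun [set: Rn R n] (ratio : Rn R n -> R).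
Proof.
apply: measurable_maxr; first exact: measurable_cst.
apply: (measurableT_comp (measurable_powR _)).
apply: measurable_funM; last exact: measurable_cst.
apply: (@measurable_edist R n _ (Rn R n) id (cst y)) => i.
  exact: measurable_coord.
exact: measurable_cst.
Qed.

Lemma measurable_refl_kernel x : measurable_fun [set: Rn R n] (rk x : Rn R n -> \bar R).
Proof.
apply: emeasurable_funM.
  apply/measurable_EFinP; apply: (measurableT_comp (measurable_powR _)).
  exact: measurable_refl_ratio.
apply: (@measurable_kappa_comp R n alpha _ (Rn R n) (cst x) refl) => i.
  exact: measurable_cst.
have -> : (fun z : Rn R n => refl z ord0 i) =
    (fun z : Rn R n => y ord0 i + ratio z * ((z : pt) ord0 i - y ord0 i)).
  by apply/funext => z; rewrite !mxE.
apply: measurable_funD; first exact: measurable_cst.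
apply: measurable_funM; first exact: measurable_refl_ratio.
apply: measurable_funB; [exact: measurable_coord|exact: measurable_cst].
Qed.

Lemma refl_kernel_lsc x z (c : \bar R) : (c < rk x z)%E ->
  exists2 d : R, 0 < d & forall x', edist x x' < d -> (c < rk x' z)%E.
Proof.
have w0 := refl_weight_gt0 z; rewrite /refl_kernel.
move: (ratio z `^ (s / 2)) w0 => w w0.
have L K : (c < w%:E * K)%E = ((w^-1)%:E * c < K)%E by rewrite lte_pdivrMl.
rewrite L => /(kappa_lsc aln)[d d0 Hd]; exists d; first exact: d0.
by move=> x' xx'; rewrite L; exact: Hd.
Qed.

Definition refl_pot nu x : \bar R := (\int[nu]_z rk x z)%E.

Lemma shift_sum_refl_kernel z x h :
  shift_sum (rk ^~ z) x h = ((ratio z `^ (s / 2))%:E * shift_sum (k ^~ (refl z)) x h)%E.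
Proof.
rewrite /shift_sum ge0_sume_distrr; last first.
  by move=> i _; apply: adde_ge0; exact: kappa_ge0.
by apply: eq_bigr => i _; rewrite ge0_muleDr //; exact: kappa_ge0.
Qed.

(** For [alpha = 2] the main term of [kappa_shift_sum] vanishes, and the error is uniform in [z]
    because the reflected poles stay at distance at least [d] from [x]. *)
Lemma shift_sum_refl_kernel_le x (e : R) : edist y x < r -> 0 < e ->
  exists2 h0 : R, 0 < h0 & forall h z, 0 < h <= h0 -> z != y ->
    (shift_sum (rk ^~ z) x h <= (2 * n%:R + e * h ^+ 2)%:E * rk x z)%E.
Proof.
move=> xr e0; pose d := r - edist y x; have d0 : 0 < d by rewrite subr_gt0.
have e1 : 0 < e * d ^+ 2 by rewrite mulr_gt0 // exprn_gt0.
have [c /andP[c0 c1] Hc] := kappa_shift_sum aln e1.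
exists (d * c); first by rewrite mulr_gt0.
move=> h z /andP[h0 hd] zy; have D := edist_refl_ge r0 x zy; rewrite -/d in D.
have xz := refl_neq r0 xr zy.
have D0 : 0 < edist x (refl z) := lt_le_trans d0 D.
have DD : d ^+ 2 <= edist x (refl z) ^+ 2.
  by apply: lerXn2r D; rewrite nnegrE ltW.
have hc : h ^+ 2 <= c * edist x (refl z) ^+ 2.
  apply: (@le_trans _ _ ((d * c) ^+ 2)); first by apply: lerXn2r hd; rewrite nnegrE ltW ?mulr_gt0.
  rewrite exprMn mulrC; apply: ler_pM => //; rewrite ?sqr_ge0 //.
  by rewrite expr2 ler_piMr // ltW.
have [t te E] := Hc x (refl z) h xz h0 hc.
rewrite shift_sum_refl_kernel E muleCA /refl_kernel.
have D20 : 0 < edist x (refl z) ^+ 2 by rewrite exprn_gt0.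
apply: lee_wpmul2r.
  by rewrite mule_ge0 ?kappa_ge0 // lee_fin ltW // refl_weight_gt0.
rewrite lee_fin lerD2l alpha2 subrr mulr0 add0r.
apply: (@le_trans _ _ (e * edist x (refl z) ^+ 2 * (h ^+ 2 / edist x (refl z) ^+ 2))).
  rewrite ler_wpM2r ?divr_ge0 ?sqr_ge0 //.
  by apply: (le_trans (le_trans (ler_norm t) te)); rewrite ler_pM2l.
by rewrite mulrA -(mulrA e) (mulrC (_ ^+ 2)) mulrA mulfK // gt_eqF.
Qed.

Lemma shift_sum_refl_pot nu x h :
  shift_sum (refl_pot nu) x h = (\int[nu]_z shift_sum (rk ^~ z) x h)%E.
Proof. exact: shift_sum_integral measurable_refl_kernel (refl_kernel_ge0 alpha y r). Qed.

Lemma refl_pot_lsc nu x c : (c < refl_pot nu x)%E ->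
  exists2 d : R, 0 < d & forall x', edist x x' < d -> (c < refl_pot nu x')%E.
Proof.
move=> cx; apply: (lsc_integral (f := fun x z => rk x z)) cx => [z|z w|z c'].
- exact: measurable_refl_kernel.
- exact: refl_kernel_ge0.
- exact: refl_kernel_lsc.
Qed.

(* The reflected potential is harmonic inside the sphere and agrees with the
   potential on it, so at the centre it is at least [1]; its kernel there is the
   truncation of [k y] at its value on the sphere. *)
Lemma constant_potential_null nu : (pot nu y <= 1)%E ->
  (forall x, edist y x = r -> (1 <= pot nu x)%E) -> nu (eball y (r / 2)) = 0%E.
Proof.
move=> py sph.
have ny : nu [set y] = 0%E.
  by apply: (@pot_lty_atomless _ _ alpha); apply: le_lt_trans py _; exact: ltry.
have m1 := measurable_set1_Rn y.
have mC1 := measurableC m1.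
have nC : nu (~` ~` [set y]) = 0%E by rewrite setCK.
have F1 : (1 <= refl_pot nu y)%E.
  apply: (lsc_minimum_principle n_gt0 r0).
  - by move=> x; apply: integral_ge0 => z _; exact: refl_kernel_ge0.
  - by move=> x c _; exact: refl_pot_lsc.
  - move=> x xr; apply: (le_trans (sph x xr)).
    apply: (integral_null_compl mC1 nC).
    + exact: measurable_kappa.
    + exact: measurable_refl_kernel.
    + exact: kappa_ge0.
    + exact: refl_kernel_ge0.
    + move=> z /= /eqP zy; rewrite refl_kernel_sphere //; by rewrite edistC.
  - move=> x e xr e0; have [h0 h00 Hh] := shift_sum_refl_kernel_le xr e0.
    exists h0 => // h hh; have a0 : (0 <= (2 * n%:R + e * h ^+ 2)%:E :> \bar R)%E.
      by rewrite lee_fin addr_ge0 // mulr_ge0 ?sqr_ge0 // ltW.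
    have E := ge0_integral_RnZl nu (measurable_refl_kernel x) (refl_kernel_ge0 alpha y r x) a0.
    rewrite -E shift_sum_refl_pot; apply: (integral_null_compl mC1 nC).
    + by apply: emeasurable_sum => i; apply: emeasurable_funD; exact: measurable_refl_kernel.
    + by apply: emeasurable_funM; [exact: measurable_cst|exact: measurable_refl_kernel].
    + by move=> z; apply: shift_sum_ge0 => x'; exact: refl_kernel_ge0.
    + by move=> z; rewrite mule_ge0 // refl_kernel_ge0.
    + by move=> z /= /eqP zy; exact: Hh.
(* The truncated kernel at the centre is [c], while [k y] is at least [c2] on the half ball; hence
   [1] plus [c2 - c] times the mass of the half ball is at most [pot nu y <= 1]. *)
pose c := r `^ (alpha - n%:R); pose c2 := (r / 2) `^ (alpha - n%:R).
have r20 : 0 < r / 2 by rewrite divr_gt0.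
have c12 : 0 < c2 - c.
  rewrite subr_gt0; apply: powR_lt_decr => //; first by rewrite subr_lt0.
  by rewrite ltr_pdivrMr // ltr_pMr // ltr1n.
have mB := measurable_eball y (r / 2).
have mI : measurable_fun [set: Rn R n] ((fun z => (\1_(eball y (r / 2)) z)%:E) : Rn R n -> \bar R).
  by apply/measurable_EFinP; exact: measurable_indic.
have I0 z : (0 <= (\1_(eball y (r / 2)) z)%:E :> \bar R)%E by rewrite lee_fin.
have c0 : (0 <= (c2 - c)%:E)%E by rewrite lee_fin ltW.
have mcI : measurable_fun [set: Rn R n]
    (fun z : Rn R n => (c2 - c)%:E * (\1_(eball y (r / 2)) z)%:E)%E.
  by apply: emeasurable_funM => //; exact: measurable_cst.
have cI0 z : (0 <= (c2 - c)%:E * (\1_(eball y (r / 2)) z)%:E)%E by rewrite mule_ge0.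
have H : (refl_pot nu y + (c2 - c)%:E * nu (eball y (r / 2)) <= pot nu y)%E.
  have IE : (\int[nu]_z (\1_(eball y (r / 2)) z)%:E = nu (eball y (r / 2)))%E.
    by rewrite integral_indic // setIT.
  rewrite -IE -(ge0_integral_RnZl nu mI I0 c0).
  rewrite -(ge0_integral_RnD nu (measurable_refl_kernel y) mcI (refl_kernel_ge0 alpha y r y) cI0).
  apply: (integral_null_compl mC1 nC).
  + by apply: emeasurable_funD => //; exact: measurable_refl_kernel.
  + exact: measurable_kappa.
  + by move=> z; rewrite adde_ge0 // refl_kernel_ge0.
  + exact: kappa_ge0.
  move=> z /= /eqP zy; have [h|h] := leP r (edist z y).
    rewrite refl_kernel_out // indicE memNset ?mule0 ?adde0 //= edistC.
    by apply/negP; rewrite -leNgt; move: h r20; lra.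
  rewrite refl_kernel_center // -/c indicE; have [h2|h2] := boolP (z \in _).
    rewrite mule1 -EFinD subrKC; apply: kappa_lb => //.
    by have /set_mem/ltW := h2.
  rewrite mule0 adde0; apply: kappa_lb => //; by rewrite edistC ltW.
have {H} := le_trans H py; move=> /(le_trans (leeD F1 (lexx _))) H.
apply/eqP; rewrite eq_le measure_ge0 andbT.
have : ((c2 - c)%:E * nu (eball y (r / 2)) <= (c2 - c)%:E * 0)%E.
  by rewrite mule0 -(@leeD2lE _ 1%E) // adde0.
by rewrite lee_pmul2l.
Qed.

End InversionPotential.

(** * The case [alpha = 2] *)

Section NewtonianEquilibrium.
Variables (R : realType) (n : nat) (alpha : R).
Hypotheses (aln : alpha < n%:R) (n_gt0 : (0 < n)%N) (alpha2 : alpha = 2).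
Local Notation RM := (@RMeasure R n).
Local Notation pt := (pt R n).
Local Notation pot := (pot alpha).
Variables (A : set pt) (ga : RM).
Hypotheses (hA : reduced_kernel alpha A = A) (gaE : is_equilibrium alpha A ga).
Hypothesis cap_irr : cap alpha (irregular_pts alpha A) = 0%E.
Hypothesis conD : connected (~` closure A).
Implicit Types (x y z : pt).
Local Open Scope ereal_scope.

Let ha2 : (alpha <= 2)%R. Proof. by rewrite alpha2. Qed.
Let le1 x : pot ga x <= 1. Proof. exact: (equilibrium_le1 aln ha2 n_gt0 gaE). Qed.
Let radon_ga : radon ga. Proof. by case: gaE => [[]]. Qed.
Let openD : open (~` closure A). Proof. exact/closed_openC/closed_closure. Qed.

Lemma constant_not_msupport y (r : R) : (0 < r)%R ->
  (forall x, (edist y x < r)%R -> pot ga x = 1) -> ~ msupport ga y.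
Proof.
move=> r0 H Sy; have r20 : (0 < r / 2)%R by rewrite divr_gt0.
have r40 : (0 < r / 2 / 2)%R by rewrite divr_gt0.
have g0 : ga (eball y (r / 2 / 2)%R) = 0.
  apply: (constant_potential_null aln n_gt0 alpha2 r20 (le1 y)) => x yx.
  by rewrite H // yx ltr_pdivrMr // ltr_pMr // ltr1n.
have := Sy _ (@open_eball R n y (r / 2 / 2)%R) _; rewrite /= edistxx => /(_ r40).
by rewrite [X in 0 < X]g0 ltxx.
Qed.

(** In [closure A] the potential is at least [1] at regular points, and irregular points have
    capacity zero; so the bound holds nearly everywhere on [O], and [thick_at_interior] removes the
    exception. *)
Lemma pot_ge1_inside (O : set pt) : ga [set: Rn R n] != 0 -> open O ->
  (forall x, O x -> ~ closure A x -> 1 <= pot ga x) -> forall x, O x -> pot ga x = 1.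
Proof.
move=> ga0 oO H x Ox; apply/eqP; rewrite eq_le le1 /=.
apply: (thick_at_interior aln radon_ga le1 ga0 gaE.1 oO Ox).
apply: cap0_sub cap_irr => z [Oz z1]; split.
  by apply: contrapT => /(H z Oz); rewrite leNgt z1.
move=> reg; move: z1; apply/negP; rewrite -leNgt.
exact: (regular_pot_ge1 aln n_gt0 radon_ga le1 ga0 gaE.1 (equilibrium_is_competitor aln gaE) reg).
Qed.

Lemma pot_neq0_mass x : pot ga x != 0 -> ga [set: Rn R n] != 0.
Proof.
move=> p0; apply/negP => /eqP g0; move/negP: p0; apply; apply/eqP.
by apply: null_set_integral => //; exact: measurable_kappa.
Qed.

(** The set where the value is [1] is open in the complement of [closure A] by the strong maximum
    principle, and relatively closed because the potential is upper semicontinuous off the mass. *)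
Lemma pot_eq1_off_closure x : ~ closure A x -> pot ga x = 1 ->
  forall z, ~ closure A z -> pot ga z = 1.
Proof.
move=> nx px; pose B : set pt := [set z | (~ closure A z) /\ pot ga z = 1].
suff BE : B = ~` closure A by move=> z nz; have [] : B z by rewrite BE.
apply: conD; first by exists x.
- exists B; last by apply/seteqP; split => z; [case|case].
  apply/open_edistP => z [nz pz].
  have [r1 r10 Hr1] := (open_edistP _).1 openD z nz.
  have [r r0 gr] := equilibrium_null_off_closure aln n_gt0 gaE nz.
  exists (Num.min r1 (r / 4)%R); first by rewrite lt_min r10 divr_gt0.
  move=> w; rewrite lt_min => /andP[w1 w2]; split; first exact: Hr1.
  exact: (strong_maximum_principle aln ha2 n_gt0 r0 gr le1 pz w2).
- exists (~` [set z : pt | (~ closure A z) /\ pot ga z < 1]).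
    apply: open_closedC; apply/open_edistP => z [nz pz].
    have [r1 r10 Hr1] := (open_edistP _).1 openD z nz.
    have [r r0 gr] := equilibrium_null_off_closure aln n_gt0 gaE nz.
    have [d /andP[d0 _] Hd] := pot_lt_near aln r0 gr pz.
    exists (Num.min r1 d); first by rewrite lt_min r10.
    by move=> w; rewrite lt_min => /andP[/Hr1 w1 /Hd w2]; split.
  apply/seteqP; split => z [nz].
    by move=> pz; split => // -[_]; rewrite pz ltxx.
  move=> h; split; [exact: nz|]; apply/eqP; rewrite eq_le le1 /= leNgt.
  by apply/negP => h1; apply: h.
Qed.

Lemma newtonian_pot_lt1 x : ~ closure A x -> pot ga x < 1.
Proof.
move=> nx; rewrite lt_neqAle le1 andbT; apply/eqP => px.
have ga0 : ga [set: Rn R n] != 0 by apply: (@pot_neq0_mass x); rewrite px onee_neq0.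
have all1 z : pot ga z = 1.
  apply: (pot_ge1_inside ga0 openT) => // w _ nw.
  by rewrite (pot_eq1_off_closure nx px nw).
move/eqP: ga0; apply; rewrite -(msupport_compl_null ga); congr (ga _).
apply/seteqP; split => // z _ Sz.
exact: (constant_not_msupport ltr01 (fun w _ => all1 w) Sz).
Qed.

Lemma newtonian_msupport : msupport ga = boundary (~` closure A).
Proof.
have iD : interior (~` closure A) = ~` closure A by exact/interior_id.
rewrite /boundary iD; apply/seteqP; split => x.
  move=> Sx; split; last by move=> /(_ (equilibrium_msupport_sub aln n_gt0 gaE Sx)).
  apply: contrapT => nD.
  (* A ball about [x] then lies in [closure A], so the assumption of [pot_ge1_inside] off
     [closure A] is vacuous and the potential is constant there. *)
  have /open_edistP/(_ x nD)[r r0 Hr] : open (~` closure (~` closure A)).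
    exact/closed_openC/closed_closure.
  have ga0 : ga [set: Rn R n] != 0 by rewrite gt_eqF // (Sx setT) //; exact: openT.
  apply: (constant_not_msupport r0 _ Sx) => y xy.
  apply: (pot_ge1_inside ga0 (@open_eball R n x r)) => // z xz nz.
  by case: (Hr z xz); exact: subset_closure.
move=> [cD /contrapT cA]; apply: contrapT => /not_msupport_null[r r0 Hr].
(* Points [y] of [A] with value [1] and [p] off [closure A], both within [r / 16] of [x], are less
   than [r / 8] apart: a quarter of the radius [r / 2] of a massless ball about [y]. So the value
   [1] spreads to [p]. *)
have r10 : (0 < r / 16)%R by rewrite divr_gt0.
have [y [_ xy py]] := reduced_kernel_point aln ha2 n_gt0 hA gaE cA r10.
have [p nDp xp] := (closure_edistP _ x).1 cD _ r10.
have r20 : (0 < r / 2)%R by rewrite divr_gt0.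
have gy : ga (eball y (r / 2)%R) = 0.
  apply: (subset_measure0 _ _ _ Hr); [exact: measurable_eball|exact: measurable_eball|].
  by move=> z /= yz; have := edist_triangle y x z; lra.
have yp : (edist y p < r / 2 / 4)%R.
  by have := edist_triangle x y p; rewrite (edistC y x); lra.
have := newtonian_pot_lt1 nDp.
by rewrite (strong_maximum_principle aln ha2 n_gt0 r20 gy le1 py yp) ltxx.
Qed.

End NewtonianEquilibrium.

Theorem mainTheorem10 (R : realType) (n : nat) (alpha : R)
  (hn : (3 <= n)%N) (ha0 : 0 < alpha) (ha2 : alpha <= 2)
  (A : set (pt R n))
  (hA : reduced_kernel alpha A = A)
  (h2 : alpha = 2 ->
        cap alpha (irregular_pts alpha A) = 0%E /\
        (~` closure A) !=set0 /\ connected (~` closure A))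
  (ga : @RMeasure R n) (hga : is_equilibrium alpha A ga) :
  (forall x, ~ closure A x -> (pot alpha ga x < 1)%E) /\
  msupport ga = (if alpha < 2 then closure A else boundary (~` closure A)).
Proof.
have n_gt0 : (0 < n)%N by exact: leq_trans hn.
have aln : alpha < n%:R.
  by apply: le_lt_trans ha2 _; rewrite ltr_nat.
have off x : ~ closure A x -> (pot alpha ga x < 1)%E.
  move=> nx; have [a2|a2] := ltP alpha 2.
    have [r r0 gr] := equilibrium_null_off_closure aln n_gt0 hga nx.
    exact: (equilibrium_lt1_off_mass aln ha2 n_gt0 hga a2 r0 gr).
  have alpha2 : alpha = 2 by apply/eqP; rewrite eq_le ha2.
  have [cap_irr [_ conD]] := h2 alpha2.
  exact: (newtonian_pot_lt1 aln n_gt0 alpha2 hga cap_irr conD nx).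
split; first exact: off.
case: ifPn => [a2|]; first exact: (equilibrium_msupport_lt2 aln ha2 n_gt0 hA hga a2).
rewrite -leNgt => a2; have alpha2 : alpha = 2 by apply/eqP; rewrite eq_le ha2.
have [cap_irr [_ conD]] := h2 alpha2.
exact: (newtonian_msupport aln n_gt0 alpha2 hA hga cap_irr conD).
Qed.
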